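(* Let $K=2^r$ for an integer $r\ge0$, $\omega=1-1/K$, $\mathcal K=\{2^0,2^1,\ldots,2^r\}$ and $\dot{\mathcal K}=\mathcal K\setminus\{K\}$. Let $\sigma>0$ and let ${\tt Matching}$ be a 1-hop $\sigma$-stretched skew-symmetric matching cover. Let $\beta_k>0$ for $k\in\dot{\mathcal K}$, and define $\sigma_1=\sigma$, $\sigma_{2k}=(1+\omega^k)\sigma_k-\beta_k$ for $k\in\dot{\mathcal K}$. Choose an increasing sequence $\{\delta_k\}_{k\in\mathcal K}$ in $(0,1)$ and define $\lambda_1=\delta_1$ and $\lambda_{2k}=\theta_{2k}\lambda_k^2$ with $\theta_{2k}=\tfrac12\big(\tfrac12(\delta_{2k}-\delta_k)\big)^{2/(1-\omega)}$ for $k\in\dot{\mathcal K}$. Suppose that $$\exp\Big(-\frac{\beta_k^2}{2(k+1)(1-\omega^k)\Delta}\Big)\le\tfrac12\lambda_{2k}\qquad\forall k\in\dot{\mathcal K}.$$ Then for every $k\in\mathcal K$ and every skew-symmetric matching cover $\mathcal M\subseteq{\tt Matching}$ with ${\tt size}(\mathcal M)\ge\delta_k$, one has ${\tt size}_{\omega^{k-1}}(\mathcal M^k)\ge\lambda_k$.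
   Context: Fix integers $d,n\ge1$, a set $V\subset\mathbb R^d$ of $n$ distinct points, and a parameter $\Delta>0$. A path is a sequence $p=(p_0,\ldots,p_\ell)$ of points of $V$ with $\ell\ge1$. A path is violating if it contains a contiguous subsequence $(p'_0,\ldots,p'_m)$, $m\ge1$, with $\sum_{j=1}^m\|p'_j-p'_{j-1}\|^2\le\|p'_m-p'_0\|^2-\Delta$; otherwise it is nonviolating. A generalized matching is a set $M$ of paths such that every $x\in V$ is the first point of at most one path of $M$ and the last point of at most one path of $M$. For generalized matchings $M_1,M_2$, $M_1\circ M_2$ is the set of all concatenations $(p_0,\ldots,p_\ell=q_0,q_1,\ldots,q_m)$ of a path $(p_0,\ldots,p_\ell)\in M_1$ and a path $(q_0,\ldots,q_m)\in M_2$ with $p_\ell=q_0$. For a generalized matching $M$, $u\in\mathbb R^d$ and $s\in\mathbb R$, ${\tt Truncate}_s(M;u)$ is the set of violating paths of $M$ together with the nonviolating paths $(x,\ldots,y)\in M$ with $\langle y-x,u\rangle\ge s$. Gaussians: $u\sim\mathcal N$ means $u\in\mathbb R^d$ has i.i.d. $N(0,1)$ coordinates; for $\rho\in[0,1)$, $u'\sim_\rho u$ means $u'=\rho u+\sqrt{1-\rho^2}\,g$ with $g\sim\mathcal N$ independent; for $\rho=1$, $u'\sim_1 u$ means $u'=u$. $(u,u')\sim\mathcal N_\rho$ means $u\sim\mathcal N$, $u'\sim_\rho u$. $\mathcal N_\omega^k$ is the law of $(u_1,\ldots,u_k)$ with $u_1\sim\mathcal N$, $u_{i+1}\sim_\omega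 u_i$. A matching cover is a map $\mathcal M$ assigning to each $u\in\mathbb R^d$ a probability distribution $\mathcal M(u)$ over generalized matchings. ${\tt size}(\mathcal M)=\frac1n\mathbb E_{u\sim\mathcal N,M\sim\mathcal M(u)}[|M|]$. $\mathcal M$ is skew-symmetric if for every $u$, sampling $M\sim\mathcal M(-u)$ and reversing all its paths gives the distribution $\mathcal M(u)$. $\mathcal M$ is $s$-stretched if for every $u$ every nonviolating path $(x,\ldots,y)$ of every $M$ in the support of $\mathcal M(u)$ satisfies $\langle y-x,u\rangle\ge s$. $\mathcal M$ is 1-hop if for every $u$ every path of every $M$ in the support of $\mathcal M(u)$ has the form $(p_0,p_1)$ with $\|p_1-p_0\|^2\le\Delta$. $\mathcal M\subseteq\mathcal M'$ means the two covers are coupled so that for every $u$, the sample $M\sim\mathcal M(u)$ is a subset of the coupled sample $M'\sim\mathcal M'(u)$. An extended matching cover is a map $\mathcal E$ assigning to each pair $(u,u')\in\mathbb R^d\times\mathbb R^d$ a distribution over generalized matchings; ${\tt size}_\rho(\mathcal E)=\frac1n\mathbb E_{(u,u')\sim\mathcal N_\rho,M\sim\mathcal E(u,u')}[|M|]$. For a matching cover $\mathcal M\subseteq{\tt Matching}$ and $k\in\mathcal K$, the extended matching cover $\mathcal M^k$ is defined as follows: given $(u_1,u_k)$, sample $(u_1,\ldots,u_k)\sim\mathcal N_\omega^k$ conditioned on the given values of $u_1$ and $u_k$ (for $k=1$ the two inputs coincide, $u_k=u_1$), sample $M_i\sim\mathcal M(u_i)$ independently, let $M=M_1\circ\cdots\circ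 M_k$, and output ${\tt Truncate}_{\sigma_k}(M;u_1)\cap{\tt Truncate}_{\sigma_k}(M;u_k)$. *)

(* Defs.v *)
From HB Require Import structures.
From mathcomp Require Import all_boot all_order all_algebra finmap.
From mathcomp Require Import all_classical all_reals all_analysis.
From mathcomp Require Import measurable_realfun.

Set Implicit Arguments.
Unset Strict Implicit.
Unset Printing Implicit Defensive.

Import Order.TTheory GRing.Theory Num.Theory.
Import numFieldNormedType.Exports.

Local Open Scope classical_set_scope.
Local Open Scope ring_scope.

Section GeneralizedMatchings.
Variable T : finType.
Implicit Types (p q : seq T) (x : T) (A B : {fset seq T}).

Definition path_first p : option T := ohead p.
Definition path_last p : option T := ohead (rev p).

(* A set of paths with this property has at most #|T| elements, so that no
   generality is lost by considering finite sets only. *)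
Definition is_gmatching A : bool :=
  [&& all (fun p => 1 < size p)%N A,
      [forall x, #|` [fset p in A | path_first p == Some x]%fset| <= 1]%N
    & [forall x, #|` [fset p in A | path_last p == Some x]%fset| <= 1]%N].

Record gmatching := GMatching {
  gm_paths :> {fset seq T} ;
  gm_is_gmatching : is_gmatching gm_paths }.

HB.instance Definition _ := [isSub for gm_paths].
HB.instance Definition _ := [Countable of gmatching by <:].

Lemma path_firstS p : (1 < size p)%N -> exists x, path_first p = Some x.
Proof. by case: p => [//|x p] _; exists x. Qed.

Lemma path_lastS p : (1 < size p)%N -> exists x, path_last p = Some x.
Proof.
rewrite /path_last; case/lastP: p => [//|p z] _.
by exists z; rewrite rev_rcons.
Qed.

Lemma card_fibersP (f : seq T -> option T) A :
  {in A, forall p, exists x, f p = Some x} ->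
  reflect {in A &, injective f}
    [forall x, #|` [fset p in A | f p == Some x]%fset| <= 1]%N.
Proof.
move=> fS; apply: (iffP forallP) => [h p q pA qA fpq|h x].
  have [x fp] := fS _ pA.
  apply/eqP; apply: contraT => pq; have := h x.
  rewrite (cardfsD1 p) (cardfsD1 q) !inE /=.
  by rewrite pA qA fp -fpq fp eqxx eq_sym pq.
set B := [fset p in A | f p == Some x]%fset.
have [->|/fset0Pn[p pB]] := eqVneq B fset0; first by rewrite cardfs0.
suff -> : B = [fset p]%fset by rewrite cardfs1.
apply/fsetP => q; rewrite in_fset1; apply/idP/eqP => [qB|->//].
move: pB qB; rewrite !inE /= => /andP[pA /eqP fp] /andP[qA /eqP fq].
by apply: h; rewrite // fp fq.
Qed.

Lemma is_gmatchingP A :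
  reflect [/\ {in A, forall p, 1 < size p}%N,
              {in A &, injective path_first}
            & {in A &, injective path_last}] (is_gmatching A).
Proof.
apply: (iffP and3P) => [[/allP h hf hl]|[h hf hl]]; split => //.
- by apply/card_fibersP => // p /h /path_firstS.
- by apply/card_fibersP => // p /h /path_lastS.
- exact/allP.
- by apply/card_fibersP => // p /h /path_firstS.
- by apply/card_fibersP => // p /h /path_lastS.
Qed.

Lemma is_gmatching0 : is_gmatching fset0.
Proof. by apply/is_gmatchingP; split => [p|p q|p q]; rewrite inE. Qed.

Definition gm0 := GMatching is_gmatching0.

Lemma is_gmatching_sub A B : (B `<=` A)%fset -> is_gmatching A -> is_gmatching B.
Proof.
move=> /fsubsetP BA /is_gmatchingP[h hf hl]; apply/is_gmatchingP; split.
- by move=> p /BA/h.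
- by move=> p q /BA pA /BA qA; exact: hf.
- by move=> p q /BA pA /BA qA; exact: hl.
Qed.

Lemma is_gmatching_filter (M : gmatching) (P : pred (seq T)) :
  is_gmatching [fset p in gm_paths M | P p]%fset.
Proof. by apply: is_gmatching_sub (gm_is_gmatching M); exact: fset_sub. Qed.

Definition gm_filter (M : gmatching) (P : pred (seq T)) : gmatching :=
  GMatching (is_gmatching_filter M P).

Definition gm_inter (M1 M2 : gmatching) : gmatching :=
  gm_filter M1 (fun p => p \in gm_paths M2).

Definition rev_paths A : {fset seq T} := [fset rev p | p in A]%fset.

Lemma is_gmatching_rev (M : gmatching) : is_gmatching (rev_paths M).
Proof.
have /is_gmatchingP[h hf hl] := gm_is_gmatching M.
apply/is_gmatchingP; split.
- by move=> _ /imfsetP[p /= pM ->]; rewrite size_rev; exact: h.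
- move=> _ _ /imfsetP[p /= pM ->] /imfsetP[q /= qM ->] pq.
  by rewrite (hl p q).
- move=> _ _ /imfsetP[p /= pM ->] /imfsetP[q /= qM ->].
  by rewrite /path_last !revK => pq; rewrite (hf p q).
Qed.

Definition gm_rev (M : gmatching) : gmatching := GMatching (is_gmatching_rev M).

Definition comp_paths A B : {fset seq T} :=
  [fset p ++ behead q | p in A, q in B & path_last p == path_first q]%fset.

Lemma is_gmatching_comp (M1 M2 : gmatching) : is_gmatching (comp_paths M1 M2).
Proof.
have /is_gmatchingP[h1 hf1 hl1] := gm_is_gmatching M1.
have /is_gmatchingP[h2 hf2 hl2] := gm_is_gmatching M2.
have cP r : r \in comp_paths M1 M2 -> exists p q, [/\ p \in gm_paths M1,
    q \in gm_paths M2, path_last p = path_first q & r = p ++ behead q].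
  move=> /imfset2P[p /= pM [q /=]]; rewrite inE => /andP[qM /eqP pq] ->.
  by exists p, q.
have firstE p s : (1 < size p)%N -> path_first (p ++ s) = path_first p.
  by case: p.
have lastE (p q : seq T) : (1 < size q)%N -> path_last (p ++ behead q) = path_last q.
  case: q => [|x q] //=; case/lastP: q => [//|q z] _.
  by rewrite /path_last -rcons_cat -rcons_cons !rev_rcons.
apply/is_gmatchingP; split.
- move=> _ /cP[p [q [pM qM _ ->]]]; rewrite size_cat.
  by apply: leq_trans (leq_addr _ _); exact: h1.
- move=> _ _ /cP[p [q [pM qM pq ->]]] /cP[p' [q' [pM' qM' pq' ->]]].
  rewrite !firstE ?h1// => /hf1 -/(_ pM pM') pp'.
  by rewrite -pp' in pq' *; rewrite (hf2 q q')// -pq -pq'.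
- move=> _ _ /cP[p [q [pM qM pq ->]]] /cP[p' [q' [pM' qM' pq' ->]]].
  rewrite !lastE ?h2// => /hl2 -/(_ qM qM') qq'.
  by rewrite -qq' in pq' *; rewrite (hl1 p p')// pq pq'.
Qed.

Definition gm_comp (M1 M2 : gmatching) : gmatching :=
  GMatching (is_gmatching_comp M1 M2).

(* The value on the empty sequence is never used. *)
Definition gm_comps (Ms : seq gmatching) : gmatching :=
  if Ms is M :: Ms' then foldl gm_comp M Ms' else gm0.

End GeneralizedMatchings.

HB.instance Definition _ (T : finType) := isPointed.Build (gmatching T) (gm0 T).
HB.instance Definition _ (T : finType) := @isMeasurable.Build
  default_measure_display (gmatching T) (@discrete_measurable (gmatching T))
  (@discrete_measurable0 _) (@discrete_measurableC _) (@discrete_measurableU _).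

Lemma gmatching_measurable (T : finType) (A : set (gmatching T)) : measurable A.
Proof. by []. Qed.

(* Row vectors carry the product sigma-algebra (the Borel sets when the
   entries are real). *)
Section MeasurableRowVectors.
Context {d : measure_display} {T : measurableType d} (n : nat).

Let coord (i : 'I_n) (v : 'rV[T]_n) : T := v ord0 i.

Let rV_set0 : g_sigma_preimage coord set0.
Proof. exact: sigma_algebra0. Qed.

Let rV_setC A : g_sigma_preimage coord A -> g_sigma_preimage coord (~` A).
Proof. exact: sigma_algebraC. Qed.

Let rV_bigcup (F : _^nat) : (forall i, g_sigma_preimage coord (F i)) ->
  g_sigma_preimage coord (\bigcup_i (F i)).
Proof. exact: sigma_algebra_bigcup. Qed.

HB.instance Definition _ := @isMeasurable.Build (measure_tuple_display d)
  'rV[T]_n (g_sigma_preimage coord) rV_set0 rV_setC rV_bigcup.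

Lemma measurable_rV_coord (i : 'I_n) :
  measurable_fun [set: 'rV[T]_n] (fun v : 'rV[T]_n => v ord0 i).
Proof.
move=> _ Y mY; rewrite setTI; apply: sub_sigma_algebra => /=.
rewrite -bigcup_seq/=; exists i => /=; first by rewrite mem_index_enum.
by exists Y => //; rewrite setTI.
Qed.

Lemma measurable_fun_rVP d' (X : measurableType d') (f : X -> 'rV[T]_n) :
  (forall i, measurable_fun [set: X] (fun x => f x ord0 i)) ->
  measurable_fun [set: X] f.
Proof.
move=> mf _ Y mY; rewrite setTI.
pose S : set (set 'rV[T]_n) := [set B | measurable (f @^-1` B)].
suff : g_sigma_preimage coord `<=` S by exact.
apply: smallest_sub.
  split.
  - by rewrite /S /= preimage_set0.
  - by move=> B SB; rewrite /S /= setTD preimage_setC; exact: measurableC.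
  - by move=> F SF; rewrite /S /= preimage_bigcup; apply: bigcup_measurable => k _; exact: SF.
rewrite -bigcup_seq/=; apply: bigcup_sub => i _ _ [B mB <-].
by rewrite /S /= setTI -[X in measurable X]setTI; exact: (mf i measurableT _ mB).
Qed.

End MeasurableRowVectors.

Section IndependentSampling.
Context {R : realType} {d : measure_display} {T : measurableType d}.

Definition tuple_cons n (xt : T * n.-tuple T) : n.+1.-tuple T :=
  [the n.+1.-tuple T of xt.1 :: xt.2].

Lemma measurable_tuple_cons n : measurable_fun setT (@tuple_cons n).
Proof. exact: measurable_cons. Qed.

HB.instance Definition _ n := isMeasurableFun.Build _ _ _ _ (@tuple_cons n)
  (@measurable_tuple_cons n).

(* The product measure P_0 \x ... \x P_(n-1). *)
Fixpoint iprod n : ('I_n -> probability T R) -> probability (n.-tuple T) R :=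
  match n with
  | 0 => fun=> \d_([tuple] : 0.-tuple T)
  | m.+1 => fun P => distribution
      (P ord0 \x iprod (fun i : 'I_m => P (lift ord0 i)))%E (@tuple_cons m)
  end.

End IndependentSampling.

Section GaussianVectors.
Context {R : realType} (d : nat).
Local Notation U := 'rV[R]_d.

Definition row_of_tuple (t : d.-tuple (measurableTypeR R)) : U :=
  \row_i tnth t i.

Lemma measurable_row_of_tuple : measurable_fun setT row_of_tuple.
Proof.
apply: measurable_fun_rVP => i.
rewrite [X in measurable_fun _ X](_ : _ = fun t => tnth t i).
  by apply: (@measurable_tnth _ (measurableTypeR R)).
by apply/funext => t; rewrite mxE.
Qed.

HB.instance Definition _ := isMeasurableFun.Build _ _ _ _ row_of_tuple
  measurable_row_of_tuple.

Definition gauss : probability U R :=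
  distribution (iprod (fun _ : 'I_d => normal_prob (0 : R) 1)) row_of_tuple.

(* For rho = 1 the coefficient of the noise [g] vanishes. *)
Definition correlate (rho : R) (u g : U) : U :=
  rho *: u + Num.sqrt (1 - rho ^+ 2) *: g.

Definition corr_pair (rho : R) (ug : U * U) : U * U :=
  (ug.1, correlate rho ug.1 ug.2).

(* The path u_0 = g_0, u_(i+1) = correlate omega u_i g_(i+1), driven by the
   noise sequence g. *)
Fixpoint corr_seq (omega : R) (g : nat -> U) (i : nat) : U :=
  if i is j.+1 then correlate omega (corr_seq omega g j) (g j.+1) else g 0%N.

Definition corr_chain (omega : R) k (g : k.-tuple U) : k.-tuple U :=
  [tuple corr_seq omega (nth 0 g) i | i < k].

Lemma measurable_correlate rho d' (X : measurableType d') (f h : X -> U) :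
  measurable_fun setT f -> measurable_fun setT h ->
  measurable_fun setT (fun x => correlate rho (f x) (h x)).
Proof.
move=> mf mh; apply: measurable_fun_rVP => i.
rewrite [X in measurable_fun _ X](_ : _ = fun x =>
    rho * f x ord0 i + Num.sqrt (1 - rho ^+ 2) * h x ord0 i).
  by apply: measurable_funD; apply: measurable_funM => //;
    apply: (measurableT_comp (measurable_rV_coord i)).
by apply/funext => x; rewrite !mxE.
Qed.

Lemma measurable_corr_pair rho : measurable_fun setT (corr_pair rho).
Proof.
by apply: measurable_fun_pair => //; exact: measurable_correlate.
Qed.

HB.instance Definition _ rho := isMeasurableFun.Build _ _ _ _ (corr_pair rho)
  (measurable_corr_pair rho).

Lemma measurable_corr_chain omega k : measurable_fun setT (@corr_chain omega k).
Proof.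
apply/measurable_fun_tnthP => i.
rewrite [X in measurable_fun _ X](_ : _ = fun g : k.-tuple U =>
    corr_seq omega (nth 0 g) i); last first.
  by apply/funext => g /=; rewrite tnth_mktuple.
have mnth j : (j < k)%N -> measurable_fun setT (fun g : k.-tuple U => nth 0 g j).
  move=> jk; rewrite [X in measurable_fun _ X](_ : _ =
      fun g : k.-tuple U => tnth g (Ordinal jk)); first exact: measurable_tnth.
  by apply/funext => g; rewrite (tnth_nth 0).
case: i => i /=; elim: i => [|i IHi] ik /=; first exact: mnth.
by apply: measurable_correlate; [exact: IHi (ltnW ik) | exact: mnth].
Qed.

HB.instance Definition _ omega k := isMeasurableFun.Build _ _ _ _
  (@corr_chain omega k) (@measurable_corr_chain omega k).

(* N_rho, the law of (u, u') with u ~ N and u' ~_rho u. *)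
Definition gauss_pair (rho : R) : probability (U * U)%type R :=
  distribution (gauss \x gauss)%E (corr_pair rho).

(* N_omega^k. *)
Definition gauss_chain (omega : R) k : probability (k.-tuple U) R :=
  distribution (iprod (fun _ : 'I_k => gauss)) (@corr_chain omega k).

End GaussianVectors.

Section Kernels.
Context {R : realType}.

Section KernelValue.
Context {d1 d2} {X : measurableType d1} {Y : measurableType d2}.
Variable k : R.-pker X ~> Y.

Definition kernel_at (x : X) : set Y -> \bar R := k x.

HB.instance Definition _ x := Measure.on (kernel_at x).
HB.instance Definition _ x := Measure_isProbability.Build _ _ _ (kernel_at x)
  (prob_kernel x).

End KernelValue.

Section KernelPullback.
Context {d1 d2 d3} {X : measurableType d1} {Y : measurableType d2}
  {Z : measurableType d3}.
Variables (k : R.-pker Y ~> Z) (f : X -> Y).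

Definition kpullback (mf : measurable_fun setT f) (x : X) :
  {measure set Z -> \bar R} := k (f x).

Hypothesis mf : measurable_fun setT f.

Let kpullback_measurable A : measurable A ->
  measurable_fun setT (kpullback mf ^~ A).
Proof.
move=> mA; exact: (measurableT_comp (measurable_kernel k _ mA) mf).
Qed.

HB.instance Definition _ := isKernel.Build _ _ _ _ _ (kpullback mf)
  kpullback_measurable.

Let kpullback_prob x : kpullback mf x setT = 1%E.
Proof. exact: prob_kernel. Qed.

HB.instance Definition _ := Kernel_isProbability.Build _ _ _ _ _
  (kpullback mf) kpullback_prob.

End KernelPullback.

Section KernelComposition.
Context {d1 d2 d3} {X : measurableType d1} {Y : measurableType d2}
  {Z : measurableType d3}.
Variables (l : R.-pker X ~> Y) (k : R.-pker (X * Y) ~> Z).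

(* Given x, sample y from l x and then return a sample from k (x, y). *)
Definition kbind : X -> {measure set Z -> \bar R} := (l \; k)%E.

HB.instance Definition _ := Kernel.on kbind.

Let kbind_prob x : kbind x setT = 1%E.
Proof.
rewrite /kbind /= /kcomp (eq_integral (cst 1%E)) ?integral_cst//=.
  by rewrite mul1e prob_kernel.
by move=> y _; rewrite prob_kernel.
Qed.

HB.instance Definition _ := Kernel_isProbability.Build _ _ _ _ _ kbind
  kbind_prob.

End KernelComposition.

Section IndependentSamplingKernel.
Context {d1 d2} {X : measurableType d1} {Y : measurableType d2}.
Variable M : R.-pker X ~> Y.

Definition ksample n (xs : n.-tuple X) : {measure set (n.-tuple Y) -> \bar R} :=
  iprod (fun i => kernel_at M (tnth xs i)).

Let thead_tuple n (xs : n.+1.-tuple X) : X := tnth xs ord0.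

Let measurable_thead n : measurable_fun setT (@thead_tuple n).
Proof. exact: measurable_tnth. Qed.

Let behead_fst n (xsy : n.+1.-tuple X * Y) : n.-tuple X :=
  [tuple of behead xsy.1].

Let measurable_behead_fst n : measurable_fun setT (@behead_fst n).
Proof. exact: (measurableT_comp (@measurable_behead _ X n) measurable_fst). Qed.

Let ksample_prob n (xs : n.-tuple X) : ksample xs setT = 1%E.
Proof. exact: probability_setT. Qed.

Let ksampleS n (k : R.-pker (n.-tuple X) ~> (n.-tuple Y)) :
  (forall xs, k xs = ksample xs) ->
  forall A, measurable A ->
    measurable_fun setT (fun xs : n.+1.-tuple X => ksample xs A).
Proof.
move=> kE A mA.
pose k1 := kpullback M (@measurable_thead n).
pose k2 := kpullback k (@measurable_behead_fst n).
have mB : measurable (@tuple_cons _ Y n @^-1` A).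
  by rewrite -[X in measurable X]setTI; exact: measurable_tuple_cons.
rewrite [X in measurable_fun _ X](_ : _ =
    kproduct k1 k2 ^~ (@tuple_cons _ Y n @^-1` A)).
  exact: measurable_kproduct.
apply/funext => xs; rewrite /ksample /= /distribution /pushforward.
rewrite /product_measure1 /kproduct /=; apply: eq_integral => y _.
rewrite kernel.intker_indicE//.
transitivity (k (behead_fst (xs, y)) (xsection (@tuple_cons _ Y n @^-1` A) y));
  last by [].
rewrite kE /ksample /=.
congr (iprod _ _); apply/funext => i; congr (kernel_at M _).
by rewrite /behead_fst [in LHS](tuple_eta xs) tnthS.
Qed.

Let ksample_measurable n A : measurable A ->
  measurable_fun setT (fun xs : n.-tuple X => ksample xs A).
Proof.
elim: n A => [|n IHn] A mA.
  rewrite [X in measurable_fun _ X](_ : _ = cst (\d_([tuple] : 0.-tuple Y) A)) //.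
pose m1 := isKernel.Build _ _ _ _ R (@ksample n) IHn.
pose k1 : R.-ker (n.-tuple X) ~> (n.-tuple Y) := HB.pack (@ksample n) m1.
pose m2 := Kernel_isProbability.Build _ _ _ _ _ k1 (@ksample_prob n).
pose k2 : R.-pker (n.-tuple X) ~> (n.-tuple Y) := HB.pack (@ksample n) m1 m2.
exact: (@ksampleS n k2).
Qed.

HB.instance Definition _ n := isKernel.Build _ _ _ _ _ (@ksample n)
  (@ksample_measurable n).
HB.instance Definition _ n := Kernel_isProbability.Build _ _ _ _ _ (@ksample n)
  (@ksample_prob n).

End IndependentSamplingKernel.
End Kernels.

Section CountableMeasurability.

Lemma measurable_fun_countable d1 d2 (X : measurableType d1)
    (Y : measurableType d2) (f : X -> Y) : countable [set: Y] ->
  (forall y, measurable (f @^-1` [set y])) -> measurable_fun setT f.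
Proof.
move=> cY mf _ A mA; rewrite setTI.
rewrite [X in measurable X](_ : _ =
    \bigcup_y (if y \in A then f @^-1` [set y] else set0)).
  by apply: countable_bigcupT_measurable => // y; case: ifP.
apply/seteqP; split => x /=.
  by move=> Afx; exists (f x) => //; rewrite mem_set.
by move=> [y _]; case: ifPn => //; rewrite inE => Ay /= ->.
Qed.

Lemma measurable_fun_countable_snd d1 d2 d3 (X : measurableType d1)
    (Y : measurableType d2) (Z : measurableType d3) (f : X * Y -> Z) :
  countable [set: Y] -> (forall y : Y, measurable [set y]) ->
  (forall y, measurable_fun setT (fun x => f (x, y))) -> measurable_fun setT f.
Proof.
move=> cY mY mf _ A mA; rewrite setTI.
rewrite [X in measurable X](_ : _ =
    \bigcup_y (((fun x => f (x, y)) @^-1` A) `*` [set y])).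
  apply: countable_bigcupT_measurable => // y; apply: measurableX => //.
  by rewrite -[X in measurable X]setTI; exact: mf.
apply/seteqP; split => [[x y] Afxy|[x y] [z _ [/= + ->]]//].
by exists y.
Qed.

End CountableMeasurability.

Section MatchingCovers.
Context {R : realType} (d : nat) (V : {fset 'rV[R]_d}).
Local Notation U := 'rV[R]_d.
Local Notation path := (seq V).
Local Notation GM := (gmatching V).

Definition dot (u v : U) : R := \sum_(i < d) u ord0 i * v ord0 i.
Definition sqnorm (u : U) : R := dot u u.

Definition points (p : path) : seq U := [seq val x | x <- p].

(* y - x for a path (x, ..., y); the default values are never used. *)
Definition displacement (p : path) : U :=
  last 0 (points p) - head 0 (points p).

Definition violating (Delta : R) (p : path) : Prop :=
  exists q : path, [/\ infix q p, (1 < size q)%N &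
    \sum_(1 <= j < size q) sqnorm ((points q)`_j - (points q)`_j.-1)
      <= sqnorm (displacement q) - Delta].

Definition truncate (Delta s : R) (M : GM) (u : U) : GM :=
  gm_filter M
    (fun p => `[< violating Delta p >] || (s <= dot (displacement p) u)).

(* The distributions M(u) form a probability kernel, i.e. they depend
   measurably on u, so that the expectations below are meaningful. *)
Definition matching_cover := R.-pker U ~> GM.
Definition ext_matching_cover := R.-pker (U * U) ~> GM.

Definition in_support (mu : set GM -> \bar R) (M : GM) : Prop :=
  (0 < mu [set M])%E.

Definition npaths (M : GM) : \bar R := (#|` gm_paths M|%:R)%:E.

Definition cover_size (M : matching_cover) : \bar R :=
  ((#|` V|%:R^-1)%:E * \int[gauss d]_u \int[M u]_N npaths N)%E.

Definition ext_size (rho : R) (E : ext_matching_cover) : \bar R :=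
  ((#|` V|%:R^-1)%:E * \int[gauss_pair d rho]_uu \int[E uu]_N npaths N)%E.

Definition skew_symmetric (M : matching_cover) : Prop :=
  forall (u : U) (A : set GM), M u A = M (- u) (@gm_rev V @^-1` A).

Definition stretched (Delta s : R) (M : matching_cover) : Prop :=
  forall (u : U) (N : GM), in_support (M u) N ->
  forall p, p \in gm_paths N -> ~ violating Delta p ->
  s <= dot (displacement p) u.

Definition one_hop (Delta : R) (M : matching_cover) : Prop :=
  forall (u : U) (N : GM), in_support (M u) N ->
  forall p, p \in gm_paths N ->
  exists x y : V, p = [:: x; y] /\ sqnorm (val y - val x) <= Delta.

(* For every u there is a coupling of M(u) and M'(u) under which the first
   sample is a subset of the second one. *)
Definition subcover (M M' : matching_cover) : Prop :=
  forall u : U, exists C : probability (GM * GM)%type R,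
  [/\ forall A : set GM, C (A `*` setT) = M u A,
      forall A : set GM, C (setT `*` A) = M' u A &
      C [set NN : GM * GM | (gm_paths NN.1 `<=` gm_paths NN.2)%fset] = 1%E].

(* Q is a regular conditional distribution of w ~ P given X(w). *)
Definition is_cond_law d1 d2 (W : measurableType d1) (E : measurableType d2)
    (P : probability W R) (X : W -> E) (Q : R.-pker E ~> W) : Prop :=
  forall (A : set E) (B : set W), measurable A -> measurable B ->
  P (X @^-1` A `&` B) = (\int[P]_(w in X @^-1` A) Q (X w) B)%E.

(* (u_1, u_k); only used for k >= 1. *)
Definition endpoints k (us : k.-tuple U) : U * U := (head 0 us, last 0 us).

Definition truncated_comp (Delta s : R) k (arg : (U * U) * k.-tuple U * k.-tuple GM)
    : GM :=
  let: ((u1, uk), _, Ms) := arg in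
  let N := gm_comps Ms in
  gm_inter (truncate Delta s N u1) (truncate Delta s N uk).

Lemma measurable_dot (v : U) : measurable_fun setT (dot v).
Proof.
apply: measurable_sum => i; apply: measurable_funM => //.
exact: measurable_rV_coord.
Qed.

Lemma measurable_gm_filter d' (X : measurableType d') (N : GM)
    (P : X -> pred path) :
  (forall p, measurable_fun setT (fun x => P x p)) ->
  measurable_fun setT (fun x => gm_filter N (P x)).
Proof.
move=> mP; apply: measurable_fun_countable => [|B]; first exact: countableP.
have [BN|BN] := boolP (gm_paths B `<=` gm_paths N)%fset; last first.
  rewrite [X in measurable X](_ : _ = set0)//.
  apply/seteqP; split => x //= xB; move: BN; rewrite -xB.
  by rewrite fset_sub.
rewrite [X in measurable X](_ : _ = \bigcap_(p in [set` gm_paths N])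
    [set x | P x p = (p \in gm_paths B)]).
  apply: fin_bigcap_measurable => [|p _]; first exact: finite_fset.
  by rewrite -[X in measurable X]setTI; exact: (mP p measurableT [set _]).
apply/seteqP; split => x /=.
  by move=> <- p /= pN; rewrite !inE /= pN.
move=> xB; apply/val_inj/fsetP => p /=; rewrite !inE /=.
have [pN|pN] := boolP (p \in gm_paths N); first by rewrite (xB p).
by apply/esym/negbTE; apply: contra pN; exact/fsubsetP.
Qed.

Lemma measurable_truncated_comp Delta s k :
  measurable_fun setT (@truncated_comp Delta s k).
Proof.
apply: measurable_fun_countable_snd => [|Ms|Ms].
  exact: countableP.
  rewrite [X in measurable X](_ : _ = \bigcap_(i in [set: 'I_k])
      (fun t : k.-tuple GM => tnth t i) @^-1` [set tnth Ms i]).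
    apply: fin_bigcap_measurable => [|i _]; first exact: finite_finset.
    by rewrite -[X in measurable X]setTI; exact: measurable_tnth.
  apply/seteqP; split => t /=; first by move=> ->.
  by move=> tMs; apply: eq_from_tnth => i; exact: tMs.
set N := gm_comps Ms.
pose P (x : (U * U) * k.-tuple U) p :=
  (`[< violating Delta p >] || (s <= dot (displacement p) x.1.1)) &&
  (`[< violating Delta p >] || (s <= dot (displacement p) x.1.2)).
rewrite [X in measurable_fun _ X](_ : _ = fun x => gm_filter N (P x)).
  apply: measurable_gm_filter => p; rewrite /P.
  case: `[< _ >] => /=; first exact: measurable_cst.
  apply: measurable_and; apply: measurable_fun_ler => //.
  - apply: (measurableT_comp (measurable_dot _)).
    exact: (measurableT_comp measurable_fst measurable_fst).
  - apply: (measurableT_comp (measurable_dot _)).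
    exact: (measurableT_comp measurable_snd measurable_fst).
apply/funext => -[[u1 uk] us]; apply/val_inj/fsetP => p /=.
rewrite !inE /= -/N /P /=.
by case: (p \in gm_paths N).
Qed.

(* The extended matching cover M^k: given uu = (u1, uk), draw
   us = (u_1, ..., u_k) from Q uu, then Ms = (M_1, ..., M_k) from
   M u_1 \x ... \x M u_k, and return truncated_comp Delta s (uu, us, Ms).
   Here Q stands for the law of us ~ N_omega^k conditioned on
   endpoints us = uu; such a Q exists and is unique up to null sets of uu. *)
Definition cover_power (Delta s : R) (M : matching_cover) k
    (Q : R.-pker (U * U) ~> (k.-tuple U)) : ext_matching_cover :=
  kbind Q (kbind (kpullback (@ksample _ _ _ _ _ M k) measurable_snd)
    (kdirac (@measurable_truncated_comp Delta s k))).

End MatchingCovers.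

(* The sets {2^0, ..., 2^r} and {2^0, ..., 2^(r-1)}. *)
Definition scales (r : nat) : seq nat := [seq (2 ^ i)%N | i <- iota 0 r.+1].
Definition dscales (r : nat) : seq nat := [seq k <- scales r | k != (2 ^ r)%N].

(* Main.v *)
Require Import Defs.
From HB Require Import structures.
From mathcomp Require Import all_boot all_order all_algebra finmap.
From mathcomp Require Import all_classical all_reals all_analysis.
From mathcomp Require Import measurable_realfun.
From mathcomp Require Import zify ring lra.

Set Implicit Arguments.
Unset Strict Implicit.
Unset Printing Implicit Defensive.

Import Order.TTheory GRing.Theory Num.Theory.
Import numFieldNormedType.Exports.

Local Open Scope classical_set_scope.
Local Open Scope ring_scope.

(** Only the hop probabilities [N x y u] of [M] matter: the chance that a sample of [M u] contains
    the hop [(x, y)]. With [u_1, ..., u_k] drawn from the Gaussian chain, a vertex sequence is a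
    path of the composition with probability the product of its hop probabilities, so the size of
    the extended cover is bounded below by a sum over walks. Each scale [k] is treated directly,
    without recursion through the covers of smaller scales: the expected number of all walks with
    [k] hops is bounded below, and the expected number of walks removed by the truncation is bounded
    above.

    Many walks. Borell's reverse hypercontractivity with exponent [1/K] and correlation
    [omega = 1 - 1/K] is proved on the line by monotone transport ([rh_pointwise], [rh_nice], [rh1])
    and tensorized ([gauss_rh]). Its entropy form [log_rh] says how much a mean logarithm can drop
    under one noise step. By skew-symmetry the hops entering [y] in direction [u] are those leaving
    [y] in direction [- u], so the same mass functions govern arrival and departure. With Jensen's
    inequality at each hop, a logarithmic potential loses a bounded amount per hop, and
    [chain_lower] gives at least [n delta^(1 + (k-1)(2K-1))] walks.

    Few lost walks. Violating paths are kept. A nonviolating walk is within squared distance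
    [(i+1) Delta] of its start after [i] hops, and within [Delta] after one. In an exponential
    moment ([chernoff]) every hop contributes [sigma] damped by a power of [omega], and every noise
    step costs variance controlled by these distances. Hence walks short along [u_k] number at most
    [n exp (- B_k^2 / (2 S_k))], where [B_k = sigma (1 + omega + ... + omega^(k-1)) - sigma_k].
    Reversing walks ([sum_rev_paths]) gives the same for [u_1].

    Numerics. One has [B_(2k) = (1 + omega^k) B_k + beta_k], and the hypothesis bounds [beta_k^2]
    below by a multiple of [- ln (lambda_(2k) / 2)]. By the inequality of means, [budget] carries
    this over to [B_k^2]; then the loss is at most half of the main term, and the other half is at
    least [lambda_k] ([final_numerics]). *)

Local Notation mu := lebesgue_measure.

(** * Integration against densities and affine substitutions on the line *)

Section density.
Context d (T : measurableType d) {R : realType} (m : {measure set T -> \bar R})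
  (p : T -> R) (nu : {measure set T -> \bar R}).
Hypotheses (mp : measurable_fun setT p) (p0 : forall x, 0 <= p x)
  (nuE : forall A, measurable A -> nu A = (\int[m]_(x in A) (p x)%:E)%E).
Local Open Scope ereal_scope.
Import HBNNSimple.

Let density_nnsfun (f : {nnsfun T >-> R}) :
  \int[nu]_x (f x)%:E = \int[m]_x ((f x)%:E * (p x)%:E).
Proof.
under [LHS]eq_integral do rewrite fimfunE -fsumEFin//.
rewrite [LHS]ge0_integral_fsum//; last 2 first.
  - move=> r; exact/measurable_EFinP/measurableT_comp.
  - by move=> n x _; rewrite EFinM nnfun_muleindic_ge0.
under [RHS]eq_integral.
  move=> x xD; rewrite fimfunE -fsumEFin// ge0_mule_fsuml; last first.
    by move=> r; rewrite EFinM nnfun_muleindic_ge0.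
  over.
rewrite [RHS]ge0_integral_fsum//; last 2 first.
  - move=> r; apply: emeasurable_funM; last exact/measurable_EFinP.
    exact/measurable_EFinP/measurableT_comp.
  - move=> n x _; rewrite mule_ge0//; last by rewrite lee_fin.
    by rewrite EFinM nnfun_muleindic_ge0.
apply: eq_fsbigr => r _; rewrite integralZl_indic_nnsfun//.
rewrite integral_indic//= setIT nuE//.
have [r0|r0] := leP 0%R r; last first.
  rewrite preimage_nnfun0// integral_set0 mule0 integral0_eq// => x _.
  by rewrite indicE in_set0 mulr0 mul0e.
have mpE D : measurable_fun D (fun x => (p x)%:E).
  by apply/measurable_EFinP; exact: measurable_funTS.
rewrite -ge0_integralZl_EFin//; last by move=> x _; rewrite lee_fin.
rewrite integral_mkcond; apply: eq_integral => x _.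
rewrite patchE indicE; case: ifPn => _; first by rewrite mulr1.
by rewrite mulr0 mul0e.
Qed.

(** The measure [nu] is known only through its values on sets, which is how both the normal law
    (density [phi]) and the restriction of a law to an event (density an indicator) are given below.
    Simple functions and monotone convergence do the rest. *)
Lemma ge0_integral_density (f : T -> \bar R) :
  measurable_fun setT f -> (forall x, 0 <= f x) ->
  \int[nu]_x f x = \int[m]_x (f x * (p x)%:E).
Proof.
move=> mf f0; pose f_ := nnsfun_approx measurableT mf.
transitivity (lim (\int[nu]_x (f_ n x)%:E @[n --> \oo])).
  rewrite -monotone_convergence//=.
  - apply: eq_integral => ? /[!inE] xD; apply/esym/cvg_lim => //=.
    exact: cvg_nnsfun_approx.
  - by move=> n; exact/measurable_EFinP/measurable_funTS.
  - by move=> n ? _; rewrite lee_fin.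
  - by move=> ? _ ? ? mn; rewrite lee_fin; exact/lefP/nd_nnsfun_approx.
rewrite [RHS](_ : _ = lim (\int[m]_x ((f_ n x)%:E * (p x)%:E) @[n --> \oo])).
  by apply: congr_lim; apply/funext => n /=; exact: density_nnsfun.
rewrite -monotone_convergence//=.
- apply: eq_integral => x /[!inE] xD; apply/esym/cvg_lim => //.
  by apply: cvgeZr => //; exact: cvg_nnsfun_approx.
- move=> n; apply: emeasurable_funM; last exact/measurable_EFinP.
  exact/measurable_EFinP/measurable_funTS.
- by move=> n x _; rewrite mule_ge0// lee_fin.
- move=> x _ a b ab; rewrite lee_wpmul2r ?lee_fin//.
  exact/lefP/nd_nnsfun_approx.
Qed.
End density.

Section affine.
Context {R : realType}.
Local Open Scope ereal_scope.

Lemma ge0_integral_oppr (h : R -> \bar R) : measurable_fun [set: R] h ->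
  (forall x, 0 <= h x) -> \int[mu]_x h x = \int[mu]_x h (- x)%R.
Proof.
move=> mh h0; rewrite -(@ge0_integral_pushforward _ _ _ _ _
  (-%R : measurableTypeR R -> measurableTypeR R) _ _ setT)//=.
by apply: eq_measure_integral => A mA _; exact/esym/lebesgue_measureN.
Qed.

Lemma ge0_integral_affine (a b : R) (h : R -> \bar R) : a != 0%R ->
  measurable_fun [set: R] h -> (forall x, 0 <= h x) ->
  \int[mu]_x h x = `|a|%:E * \int[mu]_x h (a * x + b)%R.
Proof.
wlog a0 : a h / (0 < a)%R.
  move=> wl a0 mh h0; case: (ltrgtP 0%R a) => [ap|an|a00].
  - exact: wl.
  - rewrite (wl (- a)%R)// ?oppr_gt0 ?oppr_eq0// normrN; congr (_ * _).
    rewrite ge0_integral_oppr//.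
      by apply: eq_integral => x _; rewrite mulrNN.
    apply: measurableT_comp => //.
    by apply: measurable_funD => //; exact: measurable_funM.
  - by rewrite -a00 eqxx in a0.
move=> _ mh h0.
pose f (x : measurableTypeR R) : measurableTypeR R := (a * x + b)%R.
have mf : measurable_fun setT f by apply: measurable_funD => //; exact: measurable_funM.
have aE : (0 <= a)%R by exact: ltW.
rewrite (eq_measure_integral (mscale (NngNum aE) (pushforward mu f))).
  by rewrite ge0_integral_mscale//= gtr0_norm// ge0_integral_pushforward.
(* By uniqueness of Lebesgue measure only half-open intervals have to be compared; as [a] is
   positive, the preimage of one is again one, with length divided by [a]. *)
move=> A mA _; apply: lebesgue_measure_unique => // _ [[x y]] _ <-.
rewrite /mscale /= /pushforward.
rewrite [X in _ = _ * mu X](_ : _ = [set` `](x - b) / a, (y - b) / a]%R]); last first.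
  apply/seteqP; split => z /=; rewrite !in_itv/= /f.
    by rewrite ltr_pdivrMr// ler_pdivlMr// ltrBlDr lerBrDr [(z * a)%R]mulrC.
  by rewrite ltr_pdivrMr// ler_pdivlMr// ltrBlDr lerBrDr [(z * a)%R]mulrC.
rewrite !lebesgue_measure_itv/= !lte_fin ltr_pM2r ?invr_gt0// ltrD2r.
case: ifP => xy; last by rewrite mule0.
rewrite -!EFinD -EFinM; congr (_%:E); field.
by rewrite gt_eqF.
Qed.
End affine.

(** * Correlated pairs of standard normals *)

Section normal_pair.
Context {R : realType}.
Local Open Scope ereal_scope.

Definition stdnormal : probability (measurableTypeR R) R := normal_prob (0 : R) 1.
Definition phi (x : R) : R := normal_pdf 0 1 x.

Lemma phiE x : phi x = (normal_peak 1 * expR (- (x ^+ 2 / 2)))%R.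
Proof.
rewrite /phi normal_pdfE ?oner_neq0// /normal_fun subr0 expr1n.
by rewrite mulNr -[(1 *+ 2)%R]/(2 : R)%R.
Qed.

Lemma phi_gt0 x : (0 < phi x)%R.
Proof. by rewrite phiE mulr_gt0 ?expR_gt0// normal_peak_gt0// oner_neq0. Qed.

Lemma phi_ge0 x : (0 <= phi x)%R. Proof. exact/ltW/phi_gt0. Qed.

Lemma phiN x : phi (- x) = phi x. Proof. by rewrite !phiE sqrrN. Qed.

Lemma measurable_phi : measurable_fun [set: R] phi.
Proof. exact: measurable_normal_pdf. Qed.

Lemma continuous_phi : continuous phi.
Proof. by apply: continuous_normal_pdf; rewrite oner_neq0. Qed.

Lemma integral_stdnormal (f : R -> \bar R) :
  measurable_fun setT f -> (forall x, 0 <= f x) ->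
  \int[stdnormal]_x f x = \int[mu]_x (f x * (phi x)%:E).
Proof.
move=> mf f0.
apply: (@ge0_integral_density _ (measurableTypeR R) R mu phi) => //.
- exact: measurable_phi.
- exact: phi_ge0.
Qed.

(* The joint density of [(x, a x + b v)] for independent standard normal
   [x] and [v]. *)
Definition kern (a b x z : R) : R := (phi x * phi ((z - a * x) / b) / `|b|)%R.

Lemma kern_ge0 a b x z : (0 <= kern a b x z)%R.
Proof. by rewrite /kern divr_ge0 ?mulr_ge0 ?phi_ge0. Qed.

Lemma measurable_kern d' (X : measurableType d') (f g : X -> R) (a b : R) :
  measurable_fun setT f -> measurable_fun setT g ->
  measurable_fun setT (fun x => kern a b (f x) (g x)).
Proof.
move=> mf mg; rewrite /kern; apply: measurable_funM => //; apply: measurable_funM.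
  exact: (measurableT_comp measurable_phi).
apply: (measurableT_comp measurable_phi); apply: measurable_funM => //.
apply: measurable_funB => //; exact: measurable_funM.
Qed.

(** The normalization [a^2 + b^2 = 1] makes the exponent a quadratic form symmetric in [x] and [z];
    this is the exchangeability of the correlated pair. *)
Lemma kernE a b x z : b != 0%R -> (a ^+ 2 + b ^+ 2 = 1)%R ->
  kern a b x z = (normal_peak 1 * normal_peak 1 / `|b| *
    expR (- (x ^+ 2 + z ^+ 2 - 2 * a * x * z) / (2 * b ^+ 2)))%R.
Proof.
move=> b0 ab1; rewrite /kern !phiE mulrACA -expRD [LHS]mulrAC; congr (_ * expR _)%R.
rewrite !exprMn !exprVn.
have E : (x ^+ 2 = x ^+ 2 * (a ^+ 2 + b ^+ 2))%R by rewrite ab1 mulr1.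
by rewrite [X in (- (X + _ - _) / _)%R]E; field.
Qed.

Lemma kern_sym a b x z : b != 0%R -> (a ^+ 2 + b ^+ 2 = 1)%R ->
  kern a b x z = kern a b z x.
Proof.
move=> b0 ab1; rewrite !kernE//; congr (_ * expR _)%R.
by congr (_ / _)%R; ring.
Qed.

Lemma integral_pair_density (a b : R) (h : R * R -> \bar R) : b != 0%R ->
  measurable_fun setT h -> (forall x, 0 <= h x) ->
  \int[stdnormal]_x \int[stdnormal]_v h (x, (a * x + b * v)%R) =
  \int[mu]_x \int[mu]_z (h (x, z) * (kern a b x z)%:E).
Proof.
move=> b0 mh h0.
have mh2 : measurable_fun setT (fun xv : R * R => h (xv.1, (a * xv.1 + b * xv.2)%R)).
  apply: (measurableT_comp mh); apply: measurable_fun_pair => //.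
  by apply: measurable_funD; exact: measurable_funM.
rewrite integral_stdnormal; last 2 first.
- exact: (@measurable_fun_fubini_tonelli_F _ _ _ _ _ stdnormal _ mh2).
- by move=> x; exact: integral_ge0.
apply: eq_integral => x _.
have mhx : measurable_fun setT (fun z => h (x, z)).
  exact: measurableT_comp mh _.
rewrite integral_stdnormal//; last first.
  by apply: (measurableT_comp mhx); apply: measurable_funD => //.
rewrite [RHS](@ge0_integral_affine _ b (a * x))//; last 2 first.
- apply: emeasurable_funM => //; apply/measurable_EFinP.
  exact: measurable_kern.
- by move=> z; rewrite mule_ge0// lee_fin kern_ge0.
rewrite muleC -ge0_integralZl_EFin//; last 3 first.
- by move=> v _; rewrite mule_ge0// lee_fin phi_ge0.
- apply: emeasurable_funM.
    apply: (measurableT_comp mhx); exact: measurable_funD.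
  by apply/measurable_EFinP; exact: measurable_phi.
- exact: phi_ge0.
rewrite -ge0_integralZl_EFin//; last 2 first.
- by move=> v _; rewrite mule_ge0// lee_fin kern_ge0.
- apply: emeasurable_funM.
    apply: (measurableT_comp mhx); exact: measurable_funD.
  apply/measurable_EFinP; apply: measurable_kern => //.
  by apply: measurable_funD => //; exact: measurable_funM.
apply: eq_integral => v _.
rewrite [(b * v + _)%R]addrC muleCA [RHS]muleCA; congr (_ * _).
rewrite -!EFinM; congr (_%:E); rewrite /kern addrAC subrr add0r [(b * v)%R]mulrC mulfK//.
by rewrite mulrCA mulfV ?mulr1// normr_eq0.
Qed.

(** The map [(x, y) -> (a x + b y, b x - a y)] is an orthogonal reflection. No planar change of
    variables is used: both sides are integrals of one function against the joint density
    [kern a b], with the two variables exchanged, and this density is symmetric. *)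
Lemma integral_normal_reflect (a b : R) (h : R * R -> \bar R) :
  (a ^+ 2 + b ^+ 2 = 1)%R ->
  measurable_fun setT h -> (forall x, 0 <= h x) ->
  \int[stdnormal]_x \int[stdnormal]_y h ((a * x + b * y)%R, (b * x - a * y)%R) =
  \int[stdnormal]_x \int[stdnormal]_y h (x, y).
Proof.
(* For [b = 0] the pair [(x, a x + b v)] has no density; then [a] is 1 or -1 and the symmetry of the
   normal law suffices. *)
move=> ab1 mh h0; have [b0|b0] := eqVneq b 0%R.
  have stdN (f : R -> \bar R) : measurable_fun setT f -> (forall x, 0 <= f x) ->
      \int[stdnormal]_x f (- x)%R = \int[stdnormal]_x f x.
    move=> mf f0; rewrite !integral_stdnormal//; last first.
      by apply: (measurableT_comp mf); exact: oppr_measurable.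
    apply/esym; etransitivity.
      apply: (@ge0_integral_oppr _ (fun x => f x * (phi x)%:E)).
        by apply: emeasurable_funM => //; apply/measurable_EFinP; exact: measurable_phi.
      by move=> x; rewrite mule_ge0// lee_fin phi_ge0.
    by apply: eq_integral => x _; rewrite /= phiN.
  have mhx x : measurable_fun setT (fun z => h (x, z)) by exact: measurableT_comp mh _.
  have mhy z : measurable_fun setT (fun x => h (x, z)) by exact: measurableT_comp mh _.
  have : (a == 1)%R || (a == -1)%R.
    by rewrite -eqf_sqr expr1n -ab1 b0 expr0n addr0.
  case/orP => /eqP ->; rewrite b0.
    apply: eq_integral => x _; rewrite -[RHS]stdN//.
    by apply: eq_integral => y _; rewrite !mul1r !mul0r addr0 sub0r.
  rewrite -[RHS]stdN//.
  - by apply: eq_integral => x _; apply: eq_integral => y _; rewrite !mulN1r !mul0r addr0 sub0r opprK.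
  - exact: (@measurable_fun_fubini_tonelli_F _ _ _ _ _ stdnormal _ mh).
  - by move=> x; exact: integral_ge0.
pose h1 (xz : R * R) := h (xz.2, ((xz.1 - a * xz.2) / b)%R).
pose h2 (xz : R * R) := h (xz.1, ((xz.2 - a * xz.1) / b)%R).
have mh1 : measurable_fun setT h1.
  apply: (measurableT_comp mh); apply: measurable_fun_pair => //.
  apply: measurable_funM => //; apply: measurable_funB => //; exact: measurable_funM.
have mh2 : measurable_fun setT h2.
  apply: (measurableT_comp mh); apply: measurable_fun_pair => //.
  apply: measurable_funM => //; apply: measurable_funB => //; exact: measurable_funM.
transitivity (\int[stdnormal]_x \int[stdnormal]_v h1 (x, (a * x + b * v)%R)).
  apply: eq_integral => x _; apply: eq_integral => y _; rewrite /h1/=.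
  have -> : (b * x - a * y = (x - a * (a * x + b * y)) / b)%R.
    have E : (x = (a ^+ 2 + b ^+ 2) * x)%R by rewrite ab1 mul1r.
    by rewrite [X in ((X - _) / _)%R]E; field.
  by [].
rewrite integral_pair_density//; last by move=> x; exact: h0.
transitivity (\int[mu]_z \int[mu]_x (h2 (z, x) * (kern a b z x)%:E)).
  etransitivity.
    apply: (@fubini_tonelli _ _ _ _ R mu mu
      (fun xz : R * R => h1 xz * (kern a b xz.1 xz.2)%:E)).
      by apply: emeasurable_funM => //; apply/measurable_EFinP; exact: measurable_kern.
    by move=> x; rewrite mule_ge0 ?h0// lee_fin kern_ge0.
  by apply: eq_integral => z _; apply: eq_integral => x _; rewrite /= kern_sym.
etransitivity; first (apply/esym; apply: (@integral_pair_density a b h2) => //).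
  by move=> x; exact: h0.
apply: eq_integral => x _; apply: eq_integral => y _; rewrite /h2/=.
by rewrite addrAC subrr add0r [(b * y)%R]mulrC mulfK.
Qed.
End normal_pair.

(** * Monotone transport of Gaussian-weighted densities *)

Section transport.
Context {R : realType}.

Let prim (g : R -> R) (x : R) : R := \int[mu]_(t in `]-oo, x]) g t.

Let prim_is_derive (g : R -> R) (x : R) : continuous g ->
  mu.-integrable setT (EFin \o g) -> is_derive x 1 (prim g) (g x).
Proof.
move=> cg ig.
have [||//|//|d1 d2] := @continuous_FTC1 R g -oo%O x (x + 1).
- by rewrite ltrDl.
- exact: integrableS ig.
- by rewrite ltNye.
- exact: cg.
by apply: DeriveDef => //; rewrite -derive1E.
Qed.

(** [T] is the monotone rearrangement carrying [c phi] to [F phi]: it solves [H (T s) = P s] for the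
    primitives [H] and [P] of these two densities. Since [F] is constant far out, with value its own
    Gaussian mean, the primitives agree there and [T] is the identity there. So [T - id] has compact
    support. *)
Lemma gaussian_transport (F : R -> R) (eps M c b : R) : 0 < eps -> 0 < b ->
  continuous F -> (forall x, eps <= F x) -> (forall x, F x <= M) ->
  (forall x, b <= `|x| -> F x = c) -> \int[mu]_x (F x * phi x) = c ->
  exists T : R -> R, [/\ {homo T : x y / x < y}, (forall x, derivable T x 1),
    continuous T^`()%classic /\ (forall s, 0 < T^`()%classic s), (forall s, b <= `|s| -> T s = s)
    & forall s, F (T s) * phi (T s) * T^`()%classic s = c * phi s].
Proof.
move=> eps0 b0 cF eF FM Fc Fint.
have c0 : 0 < c.
  have <- : F b = c by apply: Fc; rewrite ger0_norm// ltW.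
  exact: lt_le_trans (eF b).
have F0 x : 0 < F x by exact: lt_le_trans (eF x).
pose g (x : R) := F x * phi x; pose p (x : R) := c * phi x.
have cg : continuous g by move=> x; apply: cvgM; [exact: cF|exact: continuous_phi].
have cp : continuous p by move=> x; apply: cvgM; [exact: cvg_cst|exact: continuous_phi].
have iphi : mu.-integrable setT (EFin \o @phi R) by exact: integrable_normal_pdf.
have ip : mu.-integrable setT (EFin \o p).
  by have := integrableZl measurableT c iphi.
have ig : mu.-integrable setT (EFin \o g).
  apply: (le_integrable measurableT _ _ (integrableZl measurableT M iphi)) => //.
  - by apply/measurable_EFinP; exact: continuous_measurable_fun.
  - move=> x _; rewrite /= lee_fin !normrM ler_wpM2r//.
    by rewrite (ger0_norm (ltW (F0 x))) ger0_norm ?FM// (le_trans _ (FM x))// ltW.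
have dH (x : R) : is_derive x 1 (prim g) (g x) by exact: prim_is_derive.
have dP (x : R) : is_derive x 1 (prim p) (p x) by exact: prim_is_derive.
have g0 x : 0 < g x by rewrite mulr_gt0 ?phi_gt0.
have p0 x : 0 < p x by rewrite mulr_gt0 ?phi_gt0.
have incr (h k : R -> R) : (forall x : R, is_derive x 1 h (k x)) ->
    (forall x, 0 < k x) -> {homo h : x y / x < y}.
  move=> dh k0 x y xy.
  apply: (@gtr0_derive1_lt_cc _ h x y) => //; rewrite ?in_itv/= ?lexx ?ltW//.
  - by move=> z _; rewrite derive1E (@derive_val _ _ _ _ _ _ _ (dh z)).
  - by apply: derivable_within_continuous => z _.
have iH := incr _ _ dH g0; have iP := incr _ _ dP p0.
have cH : continuous (prim g).
  by move=> x; apply/differentiable_continuous/derivable1_diffP.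
have cP : continuous (prim p).
  by move=> x; apply/differentiable_continuous/derivable1_diffP.
(* On the left the integrands agree up to [s]; on the right the tails agree, and so do the total
   masses. *)
have HPout s : b <= `|s| -> prim g s = prim p s.
  move=> bs; have [sge|sle] := leP 0 s.
    have tot (h : R -> R) : mu.-integrable setT (EFin \o h) ->
        \int[mu]_x h x = prim h s + \int[mu]_(x in `]s, +oo[) h x.
      move=> ih; rewrite (_ : setT = `]-oo, s] `|` `]s, +oo[); last first.
        apply/seteqP; split => // x _ /=; rewrite !in_itv/= andbT.
        by case: (leP x s); [left|right].
      rewrite Rintegral_setU//.
      - by apply: (integrableS measurableT _ _ ih) => //; exact: measurableU.
      - by apply/disj_setPS => x [/=]; rewrite !in_itv/= andbT => h1; rewrite ltNge h1.
    have tail : \int[mu]_(x in `]s, +oo[) g x = \int[mu]_(x in `]s, +oo[) p x.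
      apply: eq_Rintegral => x; rewrite inE/= in_itv/= andbT => sx; rewrite /g Fc//.
      by rewrite ger0_norm ?(le_trans sge (ltW sx))// (le_trans bs)// ger0_norm// ltW.
    apply: (@addIr _ (\int[mu]_(x in `]s, +oo[) g x)); rewrite -(tot _ ig) tail -(tot _ ip).
    rewrite /g Fint /p /Rintegral.
    under eq_integral do rewrite EFinM.
    by rewrite integralZl//= integral_normal_pdf mule1.
  apply: eq_Rintegral => x; rewrite inE/= in_itv/= => xs.
  rewrite /g Fc// (le_trans bs)// !ltr0_norm ?lerN2// (le_lt_trans xs)//.
have ex s : exists x, prim g x = prim p s.
  have [sb|sb] := lerP b `|s|; first by exists s; exact: HPout.
  have [|||x _ <-] := @IVT _ (prim g) (- b) b (prim p s); last by exists x.
  - by rewrite ge0_cp// ltW.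
  - by apply: continuous_subspaceT.
  - rewrite !HPout ?normrN ?gtr0_norm//.
    move: sb; rewrite ltr_norml => /andP[sb1 sb2].
    have bb : prim p (- b) < prim p b by apply: iP; exact: lt_trans sb2.
    by rewrite min_l ?max_r ?(ltW bb)//; apply/andP; split; apply/ltW/iP.
pose T s := projT1 (cid (ex s)).
have TE s : prim g (T s) = prim p s by rewrite /T; case: cid.
have injH : injective (prim g).
  move=> x y; case: (ltgtP x y) => // /iH; first by move=> /[swap] ->; rewrite ltxx.
  by move=> /[swap] ->; rewrite ltxx.
(* An inverse of [prim g], with the dummy value 0 off its range; writing [T] through it makes the
   derivative of an inverse function applicable. *)
pose Hi (y : R) : R := if pselect (exists x, prim g x = y) is left e then projT1 (cid e) else 0.
have HiK : cancel (prim g) Hi.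
  move=> x; rewrite /Hi; case: pselect => [e|[]]; last by exists x.
  by case: cid => z /= /injH.
have TEH : T = Hi \o prim p by apply/funext => s /=; rewrite -TE HiK.
have dT (s : R) : is_derive s 1 T ((g (T s))^-1 * p s).
  rewrite TEH; apply: is_derive1_comp => /=.
  rewrite -(TE s); apply: (@is_derive_inverse _ (prim g) Hi).
  - by near=> z; exact: HiK.
  - by near=> z; exact: cH.
  - by rewrite HiK; exact: dH.
  - by rewrite HiK gt_eqF.
have T'E s : T^`()%classic s = (g (T s))^-1 * p s.
  by rewrite derive1E (@derive_val _ _ _ _ _ _ _ (dT s)).
have cT : continuous T.
  by move=> x; apply/differentiable_continuous/derivable1_diffP.
exists T; split.
- apply: (incr T (fun s => (g (T s))^-1 * p s)) => // s.
  by rewrite mulr_gt0 ?invr_gt0.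
- by move=> x.
- split; last by move=> s; rewrite T'E mulr_gt0 ?invr_gt0.
  rewrite (_ : T^`()%classic = fun s => (g (T s))^-1 * p s); last exact/funext.
  move=> s; apply: cvgM; last exact: cp.
  apply: cvgV; first by rewrite gt_eqF.
  by apply: (cvg_comp T g); [exact: cT|exact: cg].
- by move=> s bs; apply: injH; rewrite TE HPout.
- by move=> s; rewrite T'E -/(g (T s)) mulrA mulfV ?mul1r// gt_eqF.
Unshelve. all: by end_near. Qed.
End transport.

Lemma integral_prob_cst d (T : measurableType d) (R : realType) (P : probability T R)
  (c : \bar R) : (\int[P]_x c = c)%E.
Proof.
rewrite integral_cst//; transitivity (c * 1)%E; last exact: mule1.
by congr (_ * _)%E; exact: probability_setT.
Qed.

(** * Moments of the normal law and Stein's identity *)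

Section normal_moments.
Context {R : realType}.
Local Notation stdnormal := (@stdnormal R).
Local Notation phi := (@phi R).
Local Open Scope ereal_scope.

Lemma integral_stdnormal_signed (f : R -> \bar R) : measurable_fun setT f ->
  \int[stdnormal]_x f x = \int[mu]_x (f x * (phi x)%:E).
Proof.
move=> mf; rewrite integralE [RHS]integralE; congr (_ - _).
  rewrite integral_stdnormal; [|exact: measurable_funepos|by move=> x; exact: funepos_ge0].
  apply: eq_integral => x _; rewrite !funeposE.
  by rewrite maxe_pMl ?lee_fin ?phi_ge0// mul0e.
rewrite integral_stdnormal; [|exact: measurable_funeneg|by move=> x; exact: funeneg_ge0].
apply: eq_integral => x _; rewrite !funenegE.
by rewrite maxe_pMl ?lee_fin ?phi_ge0// mul0e mulNe.
Qed.

Lemma normal_mgf (t : R) : \int[stdnormal]_x (expR (t * x))%:E = (expR (t ^+ 2 / 2))%:E.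
Proof.
have me (s : R) : measurable_fun setT (fun x : R => (expR (s * x))%:E).
  by apply/measurable_EFinP; apply: measurableT_comp => //; exact: measurable_funM.
have mphi : measurable_fun setT (fun x => (phi x)%:E).
  by apply/measurable_EFinP; exact: measurable_phi.
rewrite integral_stdnormal//.
transitivity (\int[mu]_x ((expR (t ^+ 2 / 2))%:E * (phi (1 * x - t))%:E)).
  apply: eq_integral => x _; rewrite -!EFinM !phiE; congr (_%:E).
  rewrite mulrCA [RHS]mulrCA -!expRD; congr (_ * expR _)%R; by field.
etransitivity.
  apply: (@ge0_integralZl_EFin _ _ _ mu setT measurableT (fun x => (phi (1 * x - t))%:E)).
  - by move=> x _; rewrite lee_fin phi_ge0.
  - by apply: (measurableT_comp mphi); exact: measurable_funB.
  - exact: expR_ge0.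
have := @ge0_integral_affine R 1 (- t)%R (fun x => (phi x)%:E) (oner_neq0 _) mphi.
rewrite normr1 mul1e => <-; last by move=> x; rewrite lee_fin phi_ge0.
by rewrite integral_normal_pdf mule1.
Qed.

Lemma integrable_normal_id : stdnormal.-integrable setT (fun x : R => x%:E).
Proof.
have ie (s : R) : stdnormal.-integrable setT (fun x : R => (expR (s * x))%:E).
  apply/integrableP; split.
    by apply/measurable_EFinP; apply: measurableT_comp => //; exact: measurable_funM.
  under eq_integral do rewrite gee0_abs ?lee_fin ?expR_ge0//.
  by rewrite normal_mgf ltry.
(* The identity is dominated by the sum of the exponentials of [x] and [- x], which have finite
   mean. *)
apply: (le_integrable measurableT _ _ (integrableD measurableT (ie 1%R) (ie (-1)%R))).
  exact/measurable_EFinP.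
move=> x _ /=; rewrite lee_fin [leRHS]ger0_norm ?addr_ge0 ?expR_ge0//.
rewrite ler_norml; have e1 := expR_ge1Dx (1 * x); have e2 := expR_ge1Dx (-1 * x).
have p1 := expR_ge0 (1 * x); have p2 := expR_ge0 (-1 * x).
by apply/andP; split; lra.
Qed.

Lemma normal_opp (f : R -> \bar R) : measurable_fun setT f -> (forall x, 0 <= f x) ->
  \int[stdnormal]_x f (- x)%R = \int[stdnormal]_x f x.
Proof.
move=> mf f0; have := @integral_normal_reflect R (-1)%R 0%R (fun xy => f xy.1).
rewrite sqrrN expr1n expr0n addr0 => /(_ erefl (measurableT_comp mf measurable_fst)).
move=> /(_ (fun x => f0 x.1)).
rewrite /=; under eq_integral => x _.
  under eq_integral => y _ do rewrite mul0r addr0 mulN1r.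
  rewrite integral_prob_cst; over.
by move=> ->; apply: eq_integral => x _; rewrite integral_prob_cst.
Qed.

Lemma normal_mean : \int[stdnormal]_x x%:E = 0.
Proof.
have -> : \int[stdnormal]_x x%:E =
    \int[stdnormal]_x (EFin^\+ x) - \int[stdnormal]_x (EFin^\- x) by rewrite integralE.
have -> : \int[stdnormal]_x (EFin^\- x) = \int[stdnormal]_x (EFin^\+ (- x)%R).
  by apply: eq_integral => x _; rewrite funeposE funenegE EFinN.
rewrite normal_opp; last 2 first.
- by apply: measurable_funepos; exact/measurable_EFinP.
- by move=> x; exact: funepos_ge0.
rewrite subee// fin_num_abs gee0_abs ?integral_ge0//.
exact: integral_funepos_lt_pinfty integrable_normal_id.
Qed.

(** Integration by parts: [- tau phi] is a primitive of [(x tau - tau') phi] and vanishes at both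
    ends of an interval that contains the support of [tau]. *)
Lemma normal_stein (tau tau' : R -> R) (b : R) : (0 < b)%R ->
  (forall x : R, is_derive x 1%R tau (tau' x)) -> continuous tau' ->
  (forall x, (b <= `|x|)%R -> tau x = 0%R) ->
  \int[stdnormal]_x (x * tau x - tau' x)%:E = 0.
Proof.
move=> b0 dtau ct' t0.
have t'E : tau^`()%classic = tau'.
  by apply/funext => x; rewrite derive1E (@derive_val _ _ _ _ _ _ _ (dtau x)).
have ctau : continuous tau.
  by move=> x; apply/differentiable_continuous/derivable1_diffP; case: (dtau x).
have t'0 (x : R) : (b < `|x|)%R -> tau' x = 0%R.
  move=> bx; rewrite -t'E derive1E.
  rewrite (@near_eq_derive _ _ _ _ (cst 0%R)) ?derive_cst// ?oner_neq0//.
  near=> y; rewrite t0// ltW//; near: y.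
  apply: (@norm_continuous R R^o x [set z | b < z]%R).
  by apply: open_nbhs_nbhs; split => //; exact: open_gt.
pose G x := (- (tau x * phi x))%R.
have dphi (x : R) : is_derive x 1%R phi (- x * phi x)%R.
  have -> : phi = (fun x => normal_peak 1 * expR (- (x ^+ 2 / 2)))%R.
    by apply/funext => y; rewrite phiE.
  apply: is_derive_eq.
  rewrite /GRing.scale/=.
  by field.
have dG (x : R) : is_derive x 1%R G ((x * tau x - tau' x) * phi x)%R.
  by rewrite /G; apply: is_derive_eq; rewrite /GRing.scale/=; ring.
rewrite integral_stdnormal_signed; last first.
  apply/measurable_EFinP; apply: continuous_measurable_fun => x.
  by apply: cvgB; [apply: cvgM; [exact: cvg_id|exact: ctau]|exact: ct'].
rewrite (_ : \int[mu]_x _ = \int[mu]_(x in `[(- (b + 1))%R, (b + 1)%R])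
    ((x * tau x - tau' x) * phi x)%:E); last first.
  rewrite [RHS]integral_mkcond; apply: eq_integral => x _.
  rewrite patchE; case: ifPn => //; rewrite notin_setE/= in_itv/= -ler_norml => /negP.
  rewrite -ltNge => bx; rewrite t0 ?t'0 ?mulr0 ?subrr ?mul0e//.
    by rewrite (lt_trans _ bx)// ltrDl.
  by rewrite ltW// (lt_trans _ bx)// ltrDl.
rewrite (@continuous_FTC2 _ _ G).
- have hb : (b <= `|b + 1|)%R by rewrite ger0_norm ?addr_ge0 ?(ltW b0)// lerDl.
  by rewrite /G (t0 _ hb) t0 ?normrN// !mul0r oppr0 -EFinB subrr.
- by rewrite gtrN// addr_gt0.
- apply: continuous_subspaceT => x; apply: cvgM; last exact: continuous_phi.
  by apply: cvgB; [apply: cvgM; [exact: cvg_id|exact: ctau]|exact: ct'].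
- have cG : continuous G.
    by move=> x; apply/differentiable_continuous/derivable1_diffP; case: (dG x).
  split=> [x _||]; first by case: (dG x).
  + by apply: cvg_at_right_filter; exact: cG.
  + by apply: cvg_at_left_filter; exact: cG.
- by move=> x _; rewrite derive1E (@derive_val _ _ _ _ _ _ _ (dG x)).
Unshelve. all: by end_near. Qed.
End normal_moments.

(** * Reverse hypercontractivity on the line for regular functions *)

Section rh_nice.
Context {R : realType}.
Local Notation stdnormal := (@stdnormal R).
Local Notation phi := (@phi R).

Definition is_transport (T : R -> R) (b : R) :=
  [/\ {homo T : x y / x < y}, (forall x, derivable T x 1),
    continuous T^`()%classic, (forall s, 0 < T^`()%classic s) &
    (forall s, b <= `|s| -> T s = s)].

Lemma transport_subst (T : R -> R) (b : R) (G : R -> R) : is_transport T b ->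
  continuous G -> (forall x, 0 <= G x) ->
  (\int[mu]_x (G x)%:E = \int[mu]_s (G (T s) * T^`()%classic s)%:E)%E.
Proof.
move=> [iT dT cT' T'0 Tid] cG G0.
have T'1 (s : R) : b < `|s| -> T^`()%classic s = 1.
  move=> bs; rewrite derive1E (@near_eq_derive _ _ _ _ id) ?derive_id//.
  near=> y; rewrite Tid// ltW//; near: y.
  apply: (@norm_continuous R R^o s [set z | b < z]).
  by apply: open_nbhs_nbhs; split => //; exact: open_gt.
apply: (increasing_ge0_integration_by_substitutionT iT cT') => //.
- apply/cvg_ex; exists 1; apply: cvg_near_cst; near=> x; apply: T'1.
  by rewrite ltr_normr; apply/orP; right; rewrite ltrNr; near: x; apply: nbhs_ninfty_lt; exact: num_real.
- apply/cvg_ex; exists 1; apply: cvg_near_cst; near=> x; apply: T'1.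
  by rewrite ltr_normr; apply/orP; left; near: x; apply: nbhs_pinfty_gt; exact: num_real.
- apply: (@near_eq_cvg _ _ _ _ id).
  near=> x; rewrite Tid// ler_normr; apply/orP; right; rewrite lerNr.
  by near: x; apply: nbhs_ninfty_le; exact: num_real.
- apply: (@near_eq_cvg _ _ _ _ id).
  near=> x; rewrite Tid// ler_normr; apply/orP; left.
  by near: x; apply: nbhs_pinfty_ge; exact: num_real.
Unshelve. all: by end_near. Qed.

Lemma ln_le_subr1 (p : R) : 0 < p -> ln p <= p - 1.
Proof.
move=> p0; rewrite -ler_expR lnK ?posrE//; apply: le_trans (expR_ge1Dx _).
by rewrite addrC subrK.
Qed.

(** After the substitutions [x = T1 s] and [y = T2 t] the integrand equals [(c1 c2)^K kern] times
    [expR Z], and [expR Z >= 1 + Z]. The terms of [Z] are then linearized in [T1 - id], [T2 - id]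
    and their derivatives, so that they can be integrated by Stein's identity. The kernel has
    correlation [- w] because of the sign in the second argument of the inequality aimed at. *)
Lemma rh_pointwise (K : nat) (F1 F2 T1 T2 : R -> R) (c1 c2 b1 b2 s t : R) :
  (0 < K)%N -> is_transport T1 b1 -> is_transport T2 b2 ->
  let w := 1 - K%:R^-1 in let b := Num.sqrt (1 - w ^+ 2) in
  0 <= c1 -> 0 <= c2 ->
  F1 (T1 s) * phi (T1 s) * T1^`()%classic s = c1 * phi s ->
  F2 (T2 t) * phi (T2 t) * T2^`()%classic t = c2 * phi t ->
  (c1 * c2) ^+ K * kern (- w) b s t *
    (1 - (K%:R - 1) * (T1^`()%classic s - 1 + (T2^`()%classic t - 1)) +
     w / b ^+ 2 * (s - t) * (T1 s - s - (T2 t - t)))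
  <= F1 (T1 s) ^+ K * F2 (T2 t) ^+ K * kern (- w) b (T1 s) (T2 t) *
     T1^`()%classic s * T2^`()%classic t.
Proof.
move=> K0 [_ _ _ T1'0 _] [_ _ _ T2'0 _] w b c10 c20.
set x := T1 s; set y := T2 t; set p := T1^`()%classic s; set q := T2^`()%classic t.
have p0 : 0 < p by exact: T1'0.
have q0 : 0 < q by exact: T2'0.
have Kr : 0 < K%:R :> R by rewrite ltr0n.
have w0 : 0 <= w by rewrite subr_ge0 invf_le1// ler1n.
have w1 : w < 1 by rewrite gtrBl invr_gt0.
have w2 : 0 < 1 - w ^+ 2 by rewrite subr_gt0 expr_lt1.
have bb2 : b ^+ 2 = 1 - w ^+ 2 by rewrite sqr_sqrtr// ltW.
have b0 : b != 0 by rewrite gt_eqF// sqrtr_gt0.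
have ab1 : (- w) ^+ 2 + b ^+ 2 = 1 by rewrite bb2 sqrrN; ring.
have Kw : K%:R = (1 - w)^-1 by rewrite /w opprB addrC subrK invrK.
(* The transport equation solved for [F] and raised to the power [K]; one Jacobian factor [r]
   remains, hence the coefficient [K - 1] of [ln r]. *)
have key (F c u z r : R) : 0 < r -> F * phi z * r = c * phi u ->
    F ^+ K * r = c ^+ K * expR (K%:R * ((z ^+ 2 - u ^+ 2) / 2) - (K%:R - 1) * ln r).
  move=> r0; rewrite !phiE => E.
  have np : normal_peak 1 != 0 :> R by rewrite gt_eqF// normal_peak_gt0// oner_neq0.
  have {}E : F * r = c * expR ((z ^+ 2 - u ^+ 2) / 2).
    apply: (mulIf np); apply: (mulIf (lt0r_neq0 (expR_gt0 (- (z ^+ 2 / 2))))).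
    transitivity (F * (normal_peak 1 * expR (- (z ^+ 2 / 2))) * r); first by ring.
    rewrite E; transitivity (c * normal_peak 1 *
      (expR ((z ^+ 2 - u ^+ 2) / 2) * expR (- (z ^+ 2 / 2)))); last by ring.
    by rewrite -expRD mulrA; congr (_ * expR _); field.
  have rK : r ^+ K != 0 by rewrite expf_neq0// gt_eqF.
  transitivity ((F * r) ^+ K * (r / r ^+ K)); first by rewrite exprMn; field.
  rewrite E exprMn -mulrA -expRM_natl; congr (_ * _).
  rewrite (_ : K%:R * ((z ^+ 2 - u ^+ 2) / 2) - (K%:R - 1) * ln r =
    K%:R * ((z ^+ 2 - u ^+ 2) / 2) + (ln r - K%:R * ln r)); last by ring.
  by rewrite expRD [expR (ln r - _)]expRD expRN !expRM_natl lnK ?posrE.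
move=> /(key _ _ _ _ _ p0) E1 /(key _ _ _ _ _ q0) E2.
rewrite [leRHS](_ : _ = (F1 x ^+ K * p) * (F2 y ^+ K * q) * kern (- w) b x y);
  last by ring.
rewrite E1 E2 !kernE// exprMn.
set C := _ / `|b|.
(* The quadratic terms collapse to a difference of two squares because [K = 1 / (1 - w)]: this is
   where the exponent fits the correlation. *)
pose Z := - ((K%:R - 1) * (ln p + ln q)) + w / (2 * b ^+ 2) * ((x - y) ^+ 2 - (s - t) ^+ 2).
rewrite [leRHS](_ : _ = c1 ^+ K * c2 ^+ K * (C *
    expR (- (s ^+ 2 + t ^+ 2 - 2 * - w * s * t) / (2 * b ^+ 2))) * expR Z); last first.
  rewrite -[RHS]mulrA -[C * _ * _]mulrA -expRD.
  set A1 := _ - (K%:R - 1) * ln p; set A2 := _ - (K%:R - 1) * ln q.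
  set A3 := _ / (2 * b ^+ 2).
  rewrite (_ : _ + Z = A1 + A2 + A3).
    rewrite (expRD (A1 + A2) A3) (expRD A1 A2).
    by move: (expR A1) (expR A2) (expR A3) (c1 ^+ K) (c2 ^+ K) => *; ring.
  rewrite /A1 /A2 /A3.
  rewrite /Z Kw bb2; field.
  by apply/andP; split; apply: lt0r_neq0; rewrite // subr_gt0.
apply: ler_wpM2l.
  by rewrite !mulr_ge0 ?exprn_ge0 ?expR_ge0 ?normal_peak_ge0.
apply: le_trans (expR_ge1Dx Z).
have hp := ln_le_subr1 p0; have hq := ln_le_subr1 q0.
have K1 : 0 <= K%:R - 1 :> R by rewrite subr_ge0 ler1n.
have h1 : (K%:R - 1) * (ln p + ln q) <= (K%:R - 1) * (p - 1 + (q - 1)).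
  by apply: ler_wpM2l => //; exact: lerD.
have d0 : 0 <= w / (2 * b ^+ 2) by rewrite divr_ge0// mulr_ge0// sqr_ge0.
(* The square lies above its tangent; the defect is a multiple of the square of
   [x - s - (y - t)]. *)
have h2 : w / b ^+ 2 * (s - t) * (x - s - (y - t)) <=
    w / (2 * b ^+ 2) * ((x - y) ^+ 2 - (s - t) ^+ 2).
  rewrite -subr_ge0 [leRHS](_ : _ = w / (2 * b ^+ 2) * (x - s - (y - t)) ^+ 2); last by field.
  by rewrite mulr_ge0// sqr_ge0.
rewrite /Z -addrA lerD2l; apply: lerD => //; first by rewrite lerN2.
Qed.
End rh_nice.

Section integrable_domination.
Context d (T : measurableType d) {R : realType} (m : {measure set T -> \bar R}).
Local Open Scope ereal_scope.

Lemma integral_le_ge0 (f g : T -> R) : m.-integrable setT (EFin \o f) ->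
  measurable_fun setT g -> (forall x, (0 <= g x)%R) -> (forall x, (f x <= g x)%R) ->
  \int[m]_x (f x)%:E <= \int[m]_x (g x)%:E.
Proof.
move=> fi mg g0 fg; have mgE : measurable_fun setT (EFin \o g) by exact/measurable_EFinP.
have [gy|gy] := ltP (\int[m]_x (g x)%:E) +oo.
  apply: le_integral => //; last by move=> x _; rewrite lee_fin.
  apply/integrableP; split => //.
  by under eq_integral do rewrite gee0_abs ?lee_fin//.
by rewrite (le_trans _ gy)// leey.
Qed.
End integrable_domination.

Section product_normal.
Context {R : realType}.
Local Notation N := (@stdnormal R).
Local Notation phi := (@phi R).
Local Notation P2 := ((@stdnormal R) \x (@stdnormal R))%E.
Local Open Scope ereal_scope.

Definition refl (a b : R) (xy : R * R) : R * R :=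
  ((a * xy.1 + b * xy.2)%R, (b * xy.1 - a * xy.2)%R).

Lemma measurable_refl a b : measurable_fun setT (refl a b).
Proof.
apply: measurable_fun_pair; first by apply: measurable_funD; exact: measurable_funM.
by apply: measurable_funB; exact: measurable_funM.
Qed.

Lemma P2_refl a b (f : R * R -> R) : (a ^+ 2 + b ^+ 2 = 1)%R ->
  P2.-integrable setT (EFin \o f) ->
  P2.-integrable setT (EFin \o (f \o refl a b)) /\
  \int[P2]_x (f (refl a b x))%:E = \int[P2]_x (f x)%:E.
Proof.
move=> ab1 fi; have mr := measurable_refl a b.
have mf : measurable_fun setT f by case/integrableP : fi => /measurable_EFinP.
have E (h : R * R -> \bar R) : measurable_fun setT h -> (forall x, 0 <= h x) ->
    \int[P2]_x h (refl a b x) = \int[P2]_x h x.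
  move=> mh h0; rewrite !fubini_tonelli1//; last exact: measurableT_comp mh mr.
  exact: integral_normal_reflect.
split.
  apply/integrableP; split.
    by apply/measurable_EFinP; exact: measurableT_comp mf mr.
  case/integrableP : fi => _; rewrite -E//.
  by apply: measurableT_comp => //; exact/measurable_EFinP.
have mfE : measurable_fun setT (fun x => (f x)%:E) by exact/measurable_EFinP.
rewrite integralE [RHS]integralE; congr (_ - _).
  rewrite -[RHS](E _ (measurable_funepos mfE))//.
  by apply: eq_integral => x _; rewrite !funeposE.
rewrite -[RHS](E _ (measurable_funeneg mfE))//.
by apply: eq_integral => x _; rewrite !funenegE.
Qed.

Lemma integrable_P2_snd : P2.-integrable setT (fun xy : R * R => (xy.2)%:E).
Proof.
apply/integrableP; split; first exact/measurable_EFinP.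
rewrite fubini_tonelli1//; last first.
  by apply: measurableT_comp => //; exact/measurable_EFinP.
rewrite /fubini_F /= integral_prob_cst.
by have /integrableP[_] := @integrable_normal_id R.
Qed.

(** The second coordinate is centered and independent of the first, so only [g] contributes to the
    mean. *)
Lemma P2_affine (g h : R -> R) (M : R) : measurable_fun setT g -> measurable_fun setT h ->
  (forall x, (`|g x| <= M)%R) -> (forall x, (`|h x| <= M)%R) ->
  \int[N]_x (g x)%:E = 0 ->
  P2.-integrable setT (EFin \o (fun xy => g xy.1 + xy.2 * h xy.1)%R) /\
  \int[P2]_xy (g xy.1 + xy.2 * h xy.1)%:E = 0.
Proof.
move=> mg mh gM hM g0.
have i : P2.-integrable setT (EFin \o (fun xy => g xy.1 + xy.2 * h xy.1)%R).
  apply: (@integrableD _ _ _ P2 setT measurableT (fun xy => (g xy.1)%:E)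
    (fun xy => (xy.2 * h xy.1)%:E)).
    apply: (@measurable_bounded_integrable _ _ _ P2 (fun xy => g xy.1)) => //.
    - by rewrite (le_lt_trans (probability_le1 _ _))// ltry.
    - exact: (measurableT_comp mg).
    - exists M; split; first exact: num_real.
      by move=> x Mx [u v] _ /=; exact: le_trans (gM u) (ltW Mx).
  apply: (le_integrable measurableT _ _ (integrableZl measurableT M integrable_P2_snd)).
    apply/measurable_EFinP; apply: measurable_funM => //.
    exact: (measurableT_comp mh).
  move=> [u v] _ /=; rewrite lee_fin normrM [(M * v)%R]mulrC normrM ler_wpM2l//.
  by rewrite (le_trans (hM u))// ler_norm.
split=> //; rewrite -integral12_prod_meas1//.
rewrite -[RHS]g0; apply: eq_integral => x _; rewrite /fubini_F /=.
have iv : N.-integrable setT (fun v : R => (v * h x)%:E).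
  apply: eq_integrable (integrableZl measurableT (h x) integrable_normal_id) => // v _.
  by rewrite -EFinM mulrC.
rewrite (@integralD_EFin _ _ _ N setT measurableT (cst (g x)) (fun v => v * h x)%R)//; last first.
  by apply: (finite_measure_integrable_cst N).
rewrite [X in X + _](_ : _ = (g x)%:E); last exact: (integral_prob_cst N (g x)%:E).
rewrite [X in _ + X](_ : _ = 0) ?adde0//.
transitivity (\int[N]_v ((h x)%:E * v%:E)).
  by apply: eq_integral => v _; rewrite -EFinM mulrC.
by rewrite integralZl ?normal_mean ?mule0//; exact: integrable_normal_id.
Qed.

Lemma compact_support_bounded (f : R -> R) (B : R) : continuous f ->
  (forall x, (B < `|x|)%R -> f x = 0%R) -> exists M, forall x, (`|f x| <= M)%R.
Proof.
move=> cf f0; pose D := Num.max B 0%R.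
have D0 : (- D <= D)%R by rewrite ge0_cp// le_max lexx orbT.
have [|c _ cM] := @EVT_max R (fun x => `|f x|%R) _ _ D0.
  by apply: continuous_subspaceT => x; apply: cvg_norm; exact: cf.
exists `|f c|%R => x; have [xD|xD] := leP `|x|%R D.
  by apply: cM; rewrite in_itv/= -ler_norml.
by rewrite f0 ?normr0// (le_lt_trans _ xD)// le_max lexx.
Qed.

(** These are the first-order terms left by [rh_pointwise]. Stein's identity for the compactly
    supported [T - id] kills the first one, independence the second. *)
Lemma transport_drift (T : R -> R) (B c k : R) : (0 < B)%R -> is_transport T B ->
  let f (xy : R * R) := (c * (xy.1 * (T xy.1 - xy.1) - (T^`()%classic xy.1 - 1)) +
    xy.2 * (k * (T xy.1 - xy.1)))%R in
  P2.-integrable setT (EFin \o f) /\ \int[P2]_xy (f xy)%:E = 0.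
Proof.
move=> B0 [iT dT cT' T'0 Tid] f.
have cT : continuous T by move=> x; exact/differentiable_continuous/derivable1_diffP.
have T'1 (s : R) : (B < `|s|)%R -> T^`()%classic s = 1%R.
  move=> bs; rewrite derive1E (@near_eq_derive _ _ _ _ id) ?derive_id//.
  near=> y; rewrite Tid// ltW//; near: y.
  apply: (@norm_continuous R R^o s [set z | B < z]%R).
  by apply: open_nbhs_nbhs; split => //; exact: open_gt.
pose tau (x : R) : R := (T x - x)%R; pose tau' (x : R) : R := (T^`()%classic x - 1)%R.
have ctau : continuous tau by move=> x; apply: cvgB; [exact: cT|exact: cvg_id].
have ctau' : continuous tau' by move=> x; apply: cvgB; [exact: cT'|exact: cvg_cst].
have dtau (x : R) : is_derive x 1%R tau (tau' x).
  have dTx : is_derive x 1%R T (T^`()%classic x) by apply: DeriveDef => //; rewrite -derive1E.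
  exact: (is_deriveB dTx (is_derive_id x 1%R)).
have tau0 x : (B <= `|x|)%R -> tau x = 0%R by move=> /Tid; rewrite /tau => ->; rewrite subrr.
pose g (x : R) : R := (x * tau x - tau' x)%R.
have cg : continuous g.
  by move=> x; apply: cvgB; [apply: cvgM; [exact: cvg_id|exact: ctau]|exact: ctau'].
have [M1 M1P] : exists M, forall x, (`|g x| <= M)%R.
  apply: (@compact_support_bounded g B) => // x Bx.
  by rewrite /g /tau' T'1// (tau0 _ (ltW Bx)) mulr0 !subrr.
have [M2 M2P] : exists M, forall x, (`|tau x| <= M)%R.
  by apply: (@compact_support_bounded tau B) => // x Bx; exact/tau0/ltW.
have mg : measurable_fun setT g by exact: continuous_measurable_fun.
have mtau : measurable_fun setT tau by exact: continuous_measurable_fun.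
apply: (@P2_affine (fun x => c * g x)%R (fun x => k * tau x)%R
  (Num.max (`|c| * M1) (`|k| * M2))%R).
- exact: measurable_funM.
- exact: measurable_funM.
- by move=> x; rewrite le_max normrM ler_wpM2l.
- by move=> x; rewrite le_max normrM [X in _ || X]ler_wpM2l ?orbT.
- have ig : N.-integrable setT (EFin \o g).
    apply: (@measurable_bounded_integrable _ _ _ N g) => //.
    - by rewrite (le_lt_trans (probability_le1 _ _))// ltry.
    - exists M1; split; first exact: num_real.
      by move=> x Mx u _ /=; exact: le_trans (M1P u) (ltW Mx).
  under eq_integral do rewrite EFinM.
  by rewrite integralZl//= (@normal_stein _ tau tau' B) ?mule0.
Unshelve. all: by end_near. Qed.

(** Both variables are transported, [rh_pointwise] bounds the new integrand below by
    [(c1 c2)^K kern] times one plus first-order terms, and these terms have mean zero by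
    [transport_drift]. *)
Lemma rh_nice (K : nat) (F1 F2 : R -> R) (e M c1 c2 B w : R) : (0 < K)%N ->
  (0 < e)%R -> (0 < B)%R ->
  continuous F1 -> continuous F2 ->
  (forall x, (e <= F1 x <= M)%R) -> (forall x, (e <= F2 x <= M)%R) ->
  (forall x, (B <= `|x|)%R -> F1 x = c1) -> (forall x, (B <= `|x|)%R -> F2 x = c2) ->
  (\int[mu]_x (F1 x * phi x) = c1)%R -> (\int[mu]_x (F2 x * phi x) = c2)%R ->
  w = (1 - K%:R^-1)%R ->
  (((c1 * c2) ^+ K)%:E <= \int[N]_x \int[N]_v
    (F1 x ^+ K * F2 (- (w * x + Num.sqrt (1 - w ^+ 2) * v)) ^+ K)%:E).
Proof.
move=> K0 e0 B0 cF1 cF2 F1b F2b F1c F2c i1 i2 wE; set b := Num.sqrt _.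
have Kr : (0 < K%:R :> R)%R by rewrite ltr0n.
have w0 : (0 <= w)%R by rewrite wE subr_ge0 invf_le1// ler1n.
have w1 : (w < 1)%R by rewrite wE gtrBl invr_gt0.
have w2 : (0 < 1 - w ^+ 2)%R by rewrite subr_gt0 expr_lt1.
have bb2 : (b ^+ 2 = 1 - w ^+ 2)%R by rewrite sqr_sqrtr// ltW.
have b0 : (b != 0)%R by rewrite gt_eqF// sqrtr_gt0.
have ab1 : ((- w) ^+ 2 + (- b) ^+ 2 = 1)%R by rewrite !sqrrN bb2; ring.
have ab2 : ((- w) ^+ 2 + b ^+ 2 = 1)%R by rewrite -(sqrrN b).
have kN x y : kern (- w) (- b) x y = kern (- w) b x y.
  by rewrite (kernE _ _ b0 ab2) kernE ?oppr_eq0// normrN (sqrrN b).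
have c10 : (0 <= c1)%R.
  have <- : F1 B = c1 by apply: F1c; rewrite ger0_norm// ltW.
  by case/andP: (F1b B) => /(lt_le_trans e0)/ltW.
have c20 : (0 <= c2)%R.
  have <- : F2 B = c2 by apply: F2c; rewrite ger0_norm// ltW.
  by case/andP: (F2b B) => /(lt_le_trans e0)/ltW.
have [T1 [iT1 dT1 [cT1 T1'0] T1id T1E]] : exists T : R -> R, [/\ {homo T : x y / (x < y)%R},
    (forall x, derivable T x 1%R),
    continuous T^`()%classic /\ (forall s, (0 < T^`()%classic s)%R),
    (forall s, (B <= `|s|)%R -> T s = s) &
    forall s, (F1 (T s) * phi (T s) * T^`()%classic s = c1 * phi s)%R].
  by apply: (@gaussian_transport R F1 e M) => // x; case/andP: (F1b x).
have [T2 [iT2 dT2 [cT2 T2'0] T2id T2E]] : exists T : R -> R, [/\ {homo T : x y / (x < y)%R},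
    (forall x, derivable T x 1%R),
    continuous T^`()%classic /\ (forall s, (0 < T^`()%classic s)%R),
    (forall s, (B <= `|s|)%R -> T s = s) &
    forall s, (F2 (T s) * phi (T s) * T^`()%classic s = c2 * phi s)%R].
  by apply: (@gaussian_transport R F2 e M) => // x; case/andP: (F2b x).
have t1 : is_transport T1 B by split.
have t2 : is_transport T2 B by split.
have cN : continuous phi by exact: continuous_phi.
pose H (xz : R * R) : \bar R := (F1 xz.1 ^+ K * F2 xz.2 ^+ K)%:E.
have mF1 : measurable_fun setT F1 by exact: continuous_measurable_fun.
have mF2 : measurable_fun setT F2 by exact: continuous_measurable_fun.
have F10 x : (0 <= F1 x)%R by case/andP: (F1b x) => /(lt_le_trans e0)/ltW.
have F20 x : (0 <= F2 x)%R by case/andP: (F2b x) => /(lt_le_trans e0)/ltW.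
have mH : measurable_fun setT H.
  by apply/measurable_EFinP; apply: measurable_funM; apply: measurable_funX;
    [exact: (measurableT_comp mF1)|exact: (measurableT_comp mF2)].
have H0 xz : 0 <= H xz by rewrite lee_fin mulr_ge0// exprn_ge0.
have mT1 : measurable_fun setT T1.
  by apply: continuous_measurable_fun => x; exact/differentiable_continuous/derivable1_diffP.
have mT2 : measurable_fun setT T2.
  by apply: continuous_measurable_fun => x; exact/differentiable_continuous/derivable1_diffP.
have mT1' : measurable_fun setT (T1^`()%classic) by exact: continuous_measurable_fun.
have mT2' : measurable_fun setT (T2^`()%classic) by exact: continuous_measurable_fun.
have ck (x : R) : continuous (fun z : R => kern (- w) b x z).
  move=> z; apply: cvgMl; apply: cvgMr.
  apply: (cvg_comp (fun z => (z - - w * x) / b)%R phi); last exact: cN.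
  by apply: cvgMl; apply: cvgB; [exact: cvg_id|exact: cvg_cst].
have ck' (z : R) : continuous (fun x : R => kern (- w) b x z).
  rewrite (_ : (fun x => _) = (fun x => kern (- w) b z x)); first exact: ck.
  by apply/funext => x; rewrite kern_sym// sqrrN -(sqrrN b).
have kp (x z : R) : (0 <= kern (- w) b x z)%R by exact: kern_ge0.
pose A (s t : R) : R := (F1 (T1 s) ^+ K * F2 (T2 t) ^+ K * kern (- w) b (T1 s) (T2 t) *
     T1^`()%classic s * T2^`()%classic t)%R.
have ct1' : continuous (fun s => T1^`()%classic s - 1 : R)%R.
  by move=> s; apply: cvgB; [exact: cT1|exact: cvg_cst].
have ct2' : continuous (fun s => T2^`()%classic s - 1 : R)%R.
  by move=> s; apply: cvgB; [exact: cT2|exact: cvg_cst].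
have T1p s : (0 <= T1^`()%classic s)%R by exact: ltW.
have T2p s : (0 <= T2^`()%classic s)%R by exact: ltW.
have A0 s t : (0 <= A s t)%R.
  by rewrite /A; do 4! [apply: mulr_ge0 => //]; exact: exprn_ge0.
have fub (h : R * R -> \bar R) : measurable_fun setT h -> (forall x, 0 <= h x) ->
    \int[mu]_x \int[mu]_y h (x, y) = \int[mu]_y \int[mu]_x h (x, y).
  by move=> mh h0; exact: (@fubini_tonelli _ _ _ _ R mu mu h).
have step : \int[N]_x \int[N]_v H (x, (- w * x + (- b) * v)%R) =
    \int[mu]_s \int[mu]_t (A s t)%:E.
  rewrite integral_pair_density ?oppr_eq0//.
  transitivity (\int[mu]_x \int[mu]_t (F1 x ^+ K * F2 (T2 t) ^+ K *
      kern (- w) b x (T2 t) * T2^`()%classic t)%:E).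
    apply: eq_integral => x _.
    rewrite -(@transport_subst R T2 B (fun z => F1 x ^+ K * F2 z ^+ K * kern (- w) b x z)%R)//.
    - by apply: eq_integral => z _; rewrite kN.
    - move=> z; apply: cvgM; last exact: ck.
      by apply: cvgMr; apply: (cvg_comp F2 (fun y => y ^+ K)%R); [exact: cF2|exact: exprn_continuous].
    - by move=> z; do 2! [apply: mulr_ge0 => //]; exact: exprn_ge0.
  etransitivity.
    apply: (fub (fun xt : R * R => (F1 xt.1 ^+ K * F2 (T2 xt.2) ^+ K *
      kern (- w) b xt.1 (T2 xt.2) * T2^`()%classic xt.2)%:E)).
      apply/measurable_EFinP; apply: measurable_funM; last exact: (measurableT_comp mT2').
      have mT22 : measurable_fun setT (fun xt : R * R => T2 xt.2) by exact: (measurableT_comp mT2).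
      apply: measurable_funM; last by apply: measurable_kern.
      apply: measurable_funM; apply: measurable_funX; first exact: (measurableT_comp mF1).
      exact: (measurableT_comp mF2).
    by move=> x; rewrite lee_fin; do 3! [apply: mulr_ge0 => //]; exact: exprn_ge0.
  etransitivity; last first.
    apply/esym; apply: (fub (fun st : R * R => (A st.1 st.2)%:E)) => //.
    have mT11 : measurable_fun setT (fun xt : R * R => T1 xt.1) by exact: (measurableT_comp mT1).
    have mT22 : measurable_fun setT (fun xt : R * R => T2 xt.2) by exact: (measurableT_comp mT2).
    apply/measurable_EFinP; apply: measurable_funM; last exact: (measurableT_comp mT2').
    apply: measurable_funM; last exact: (measurableT_comp mT1').
    apply: measurable_funM; last by apply: measurable_kern.
    apply: measurable_funM; apply: measurable_funX; first exact: (measurableT_comp mF1).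
    exact: (measurableT_comp mF2).
    by move=> x; rewrite lee_fin.
  apply: eq_integral => t _ /=.
  etransitivity.
    apply: (@transport_subst R T1 B (fun x => F1 x ^+ K * F2 (T2 t) ^+ K *
      kern (- w) b x (T2 t) * T2^`()%classic t)%R) => //; last first.
      by move=> z; do 3! [apply: mulr_ge0 => //]; exact: exprn_ge0.
    move=> z; apply: cvgMl; apply: cvgM; last exact: ck'.
    by apply: cvgMl; apply: (cvg_comp F1 (fun y => y ^+ K)%R); [exact: cF1|exact: exprn_continuous].
  by apply: eq_integral => s _; rewrite /A [in LHS]mulrAC.
have -> : \int[N]_x \int[N]_v (F1 x ^+ K * F2 (- (w * x + b * v)) ^+ K)%:E =
    \int[mu]_s \int[mu]_t (A s t)%:E.
  rewrite -step; apply: eq_integral => x _; apply: eq_integral => v _.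
  by rewrite /H/= !mulNr -opprD.
have c1p : (0 < c1)%R.
  have <- : F1 B = c1 by apply: F1c; rewrite ger0_norm// ltW.
  by case/andP: (F1b B) => /(lt_le_trans e0).
have c2p : (0 < c2)%R.
  have <- : F2 B = c2 by apply: F2c; rewrite ger0_norm// ltW.
  by case/andP: (F2b B) => /(lt_le_trans e0).
pose C : R := ((c1 * c2) ^+ K)%R.
have C0 : (0 < C)%R by rewrite exprn_gt0// mulr_gt0.
have kpos x z : (0 < kern (- w) b x z)%R.
  by rewrite /kern divr_gt0 ?mulr_gt0 ?phi_gt0// normr_gt0.
pose ik (s t : R) : R := ((normal_peak 1 * normal_peak 1 / `|b|)^-1 *
  expR ((s ^+ 2 + t ^+ 2 - 2 * - w * s * t) / (2 * b ^+ 2)))%R.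
have ikE s t : ((kern (- w) b s t)^-1 = ik s t)%R.
  by rewrite kernE// invfM -expRN /ik; congr (_ * expR _)%R; rewrite mulNr opprK.
(* Division by the kernel turns the Lebesgue integral back into an expectation over the correlated
   pair [(s, - w s + b v)]; [ik] is the reciprocal kernel in a form that is visibly measurable. *)
pose g (st : R * R) : R := (A st.1 st.2 * ik st.1 st.2)%R.
have mA : measurable_fun setT (fun st : R * R => A st.1 st.2).
  have mT11 : measurable_fun setT (fun xt : R * R => T1 xt.1) by exact: (measurableT_comp mT1).
  have mT22 : measurable_fun setT (fun xt : R * R => T2 xt.2) by exact: (measurableT_comp mT2).
  apply: measurable_funM; last exact: (measurableT_comp mT2').
  apply: measurable_funM; last exact: (measurableT_comp mT1').
  apply: measurable_funM; last by apply: measurable_kern.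
  apply: measurable_funM; apply: measurable_funX; first exact: (measurableT_comp mF1).
  exact: (measurableT_comp mF2).
have mg : measurable_fun setT g.
  apply: measurable_funM => //; apply: measurable_funM => //.
  apply: measurableT_comp => //; apply: measurable_funM => //; apply: measurable_funB.
    by apply: measurable_funD; exact: measurable_funX.
  by apply: measurable_funM => //; exact: measurable_funM.
have g0 st : (0 <= g st)%R by rewrite /g -ikE divr_ge0.
have -> : \int[mu]_s \int[mu]_t (A s t)%:E =
    \int[N]_s \int[N]_v (g (s, (- w * s + b * v)%R))%:E.
  rewrite (@integral_pair_density R (- w) b (EFin \o g))//.
  - apply: eq_integral => s _; apply: eq_integral => t _.
    by rewrite /g /= -ikE -EFinM divfK// gt_eqF.
  - exact/measurable_EFinP.
(* With [t = - w s + b v] one has [w / b^2 (s - t) = (K - 1) s + k1 v]. So the terms in [T1] form a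
   drift in the independent coordinates [(s, v)], and those in [T2] form one in the reflected
   coordinates [(t, b s + w v)]. *)
pose k1 : R := (- (w / b))%R.
have [d1 i1'] := @transport_drift T1 B (K%:R - 1)%R k1 B0 t1.
have [d2 i2'] := @transport_drift T2 B (K%:R - 1)%R k1 B0 t2.
set f1 := (fun xy : R * R => _) in d1 i1'; set f2 := (fun xy : R * R => _) in d2 i2'.
have [d3] := P2_refl ab2 d2; rewrite i2' => i3.
pose low (sv : R * R) : R := (C * (1 + (f1 sv + f2 (refl (- w) b sv))))%R.
have i1c : P2.-integrable setT (EFin \o cst (1%R : R)).
  apply: (@measurable_bounded_integrable _ _ _ P2 (cst (1%R : R))) => //.
  - by rewrite (le_lt_trans (probability_le1 _ _))// ltry.
  - by exists 1%R; split => // M' M'1 u _ /=; rewrite normr1 ltW.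
have d12 := integrableD measurableT d1 d3.
have d123 := integrableD measurableT i1c d12.
have ilow : P2.-integrable setT (EFin \o low).
  by have := integrableZl measurableT C d123.
have Elow : \int[P2]_x (low x)%:E = C%:E.
  transitivity (\int[P2]_x (C%:E * (1 + ((f1 x)%:E + (f2 (refl (- w) b x))%:E)))) => //.
  rewrite integralZl//.
  rewrite (@integralD _ _ _ P2 setT measurableT (EFin \o cst (1%R : R)))//.
  rewrite (@integralD _ _ _ P2 setT measurableT (EFin \o f1))// i1' i3 !adde0.
  by rewrite (integral_prob_cst P2 1%:E) mule1.
have mh : measurable_fun setT (fun sv : R * R => (- w * sv.1 + b * sv.2)%R).
  by apply: measurable_funD; exact: measurable_funM.
have mgg : measurable_fun setT (fun sv : R * R => g (sv.1, (- w * sv.1 + b * sv.2)%R)).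
  by apply: (measurableT_comp mg); exact: measurable_fun_pair.
have -> : \int[N]_s \int[N]_v (g (s, (- w * s + b * v)%R))%:E =
    \int[P2]_sv (g (sv.1, (- w * sv.1 + b * sv.2)%R))%:E.
  apply/esym; etransitivity; last reflexivity.
  apply: (@fubini_tonelli1 _ _ _ _ R N N (fun sv : R * R => (g (sv.1, (- w * sv.1 + b * sv.2)%R))%:E)).
    exact/measurable_EFinP.
  by move=> x; rewrite lee_fin.
apply: (@le_trans _ _ C%:E) => //; rewrite -Elow; apply: integral_le_ge0 => // -[s v].
rewrite /low /g /= -ikE ler_pdivlMr//.
have := @rh_pointwise R K F1 F2 T1 T2 c1 c2 B B s (- w * s + b * v)%R K0 t1 t2.
rewrite /= -wE -/b => /(_ c10 c20 (T1E _) (T2E _)); rewrite -/(A _ _).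
apply: le_trans; rewrite le_eqVlt; apply/orP; left; apply/eqP.
have hK : (K%:R - 1 = w / b ^+ 2 * (1 + w))%R.
  rewrite bb2 (_ : K%:R = (1 - w)^-1)%R; last by rewrite wE opprB addrC subrK invrK.
  by field; apply/andP; split; apply: lt0r_neq0; rewrite // subr_gt0.
have sE : (s = (b ^+ 2 + w ^+ 2) * s)%R by rewrite bb2 subrK mul1r.
have e2 : (w / b ^+ 2 * (1 + w) * (- w * s + b * v) + (b * s - - w * v) * k1 =
    - (w / b ^+ 2) * (s - (- w * s + b * v)))%R.
  by rewrite [X in (- (w / b ^+ 2) * (X - _))%R]sE /k1; field.
rewrite /f1 /f2 /refl /= -/C hK.
move: (T1 s) (T1^`()%classic s) (T2 _) (T2^`()%classic _) (kern _ _ _ _) e2 => x p y q k e2.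
transitivity (C * k * (1 + (w / b ^+ 2 * (1 + w) * (s * (x - s) - (p - 1)) + v * (k1 * (x - s)) -
   w / b ^+ 2 * (1 + w) * (q - 1) + (w / b ^+ 2 * (1 + w) * (- w * s + b * v) + (b * s - - w * v) * k1) *
   (y - (- w * s + b * v)))))%R; first by ring.
by rewrite e2 /k1; field.
Qed.
End product_normal.

(** * Reverse hypercontractivity on the line for bounded measurable functions *)

Section rh1.
Context {R : realType}.
Local Notation N := (@stdnormal R).
Local Notation phi := (@phi R).
Local Open Scope ereal_scope.

(** The same [c] is the value far out and the Gaussian mean, which is what makes the transport map
    of [F] the identity outside a bounded interval. *)
Definition nice (F : R -> R) (e M B c : R) := [/\ continuous F,
  (forall x, (e <= F x <= M)%R), (forall x, (B <= `|x|)%R -> F x = c) &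
  (\int[mu]_x (F x * phi x) = c)%R].

Lemma continuous_clip (a b : R) (f : R -> R) : continuous f ->
  continuous (fun x => Num.max a (Num.min b (f x))).
Proof.
move=> cf x; apply: (@continuous_max _ _ (cst a) (fun x => Num.min b (f x))).
  exact: cvg_cst.
apply: (@continuous_min _ _ (cst b) f); [exact: cvg_cst|exact: cf].
Qed.

Lemma N_bounded_integrable (f : R -> R) C : measurable_fun setT f ->
  (forall x, (`|f x| <= C)%R) -> N.-integrable setT (EFin \o f).
Proof.
move=> mf fC; apply: measurable_bounded_integrable => //.
- by rewrite (le_lt_trans (probability_le1 _ _))// ltry.
- exists C; split; first exact: num_real.
  by move=> C' CC u _ /=; exact: le_trans (fC u) (ltW CC).
Qed.

(** Approximate [F] on [[-n, n]] by a continuous function, clip it to [[0, M]], blend it with a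
    constant [c0] outside by the cutoff [chi], and add [e = eta / 3] for positivity. The three
    errors (shift, approximation, tail) are at most [eta / 3] each. *)
Lemma nice_approx (F : R -> R) (M eta : R) : (0 < eta <= 1)%R -> measurable_fun setT F ->
  (forall x, (0 <= F x <= M)%R) ->
  exists F' e B c, [/\ (0 < e)%R, (0 < B)%R, nice F' e (M + 1) B c &
    \int[N]_x (`|F x - F' x|)%:E <= eta%:E].
Proof.
move=> /andP[eta0 eta1] mF Fb.
have M0 : (0 <= M)%R by case/andP: (Fb 0%R) => /le_trans; apply.
pose m := fine (\int[N]_x (`|x|)%:E).
have mE : \int[N]_x (`|x|)%:E = m%:E.
  rewrite fineK// ge0_fin_numE ?integral_ge0//.
  by have /integrableP[_] := @integrable_normal_id R.
have m0 : (0 <= m)%R by rewrite -lee_fin -mE integral_ge0.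
(* Large enough for two purposes: [m < n] makes the mass [A] of the cutoff positive, and the tail
   error [M m / n] is at most [eta / 3]. *)
pose n : R := (3 * ((M + 1) * (m + 1)) / eta)%R.
have Mm : (0 < (M + 1) * (m + 1))%R by rewrite mulr_gt0// ltr_wpDl.
have n0 : (0 < n)%R by rewrite divr_gt0// mulr_gt0.
pose E := [set` `[(- n)%R, n]].
have mE' : measurable E by exact: measurable_itv.
have Efin : mu E < +oo.
  by rewrite /E lebesgue_measure_itv/=; case: ifP => _; rewrite ?ltry// -EFinD ltry.
have iF : mu.-integrable E (EFin \o F).
  apply: measurable_bounded_integrable => //; first exact: measurable_funTS.
  exists M; split; first exact: num_real.
  move=> x Mx y _ /=; case/andP: (Fb y) => y0 yM.
  by rewrite ger0_norm// (le_trans yM)// ltW.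
have [g_ [cg ig gcv]] := approximation_continuous_integrable mE' Efin iF.
pose pk : R := normal_peak 1.
have pk0 : (0 < pk)%R by rewrite normal_peak_gt0// oner_neq0.
(* Since [pk] bounds the normal density, a Lebesgue error of [eta / (3 pk)] becomes a Gaussian error
   of [eta / 3]. *)
have [g [cgg gsmall]] : exists g : R -> R, continuous g /\
    \int[mu]_(z in E) (`|F z - g z|)%:E <= (eta / (3 * pk))%:E.
  have d0 : (0 < eta / (3 * pk))%R by rewrite divr_gt0// mulr_gt0.
  move/fine_cvgP: gcv => [fin /cvgrPdist_le /(_ _ d0)] near_le.
  have [k [fk lek]] := filter_ex (filterI fin near_le).
  exists (g_ k); split => //; move: lek => /=; rewrite sub0r normrN.
  rewrite ger0_norm ?fine_ge0 ?integral_ge0// => lek.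
  by rewrite -(fineK fk) lee_fin.
pose f1 (x : R) : R := Num.max 0%R (Num.min M (g x)).
have f1b x : (0 <= f1 x <= M)%R.
  by rewrite /f1 le_max lexx/= ge_max M0 ge_min lexx.
have cf1 : continuous f1 by exact: continuous_clip.
have f1g x : (`|F x - f1 x| <= `|F x - g x|)%R.
  rewrite /f1; case/andP: (Fb x) => F0 FM.
  case: (leP M (g x)) => Mg; last first.
    by case: (leP 0%R (g x)) => g0 //; rewrite subr0 !ger0_norm//; lra.
  by rewrite max_r// !ler0_norm; lra.
pose chi (x : R) : R := Num.max 0%R (Num.min 1%R (n + 1 - `|x|)%R).
have cchi : continuous chi.
  apply: continuous_clip => x; apply: cvgB; first exact: cvg_cst.
  exact: norm_continuous.
have chib x : (0 <= chi x <= 1)%R.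
  by rewrite /chi le_max lexx/= ge_max ler01 ge_min lexx.
have chi1 x : (`|x| <= n)%R -> chi x = 1%R.
  by move=> xn; rewrite /chi min_l ?max_r//; lra.
have chi0 x : (n + 1 <= `|x|)%R -> chi x = 0%R.
  by move=> xn; rewrite /chi min_r ?max_l//; lra.
have bint (h : R -> R) C : continuous h -> (forall x, (0 <= h x <= C)%R) ->
    N.-integrable setT (EFin \o h).
  move=> ch hC; apply: (@N_bounded_integrable _ C); first exact: continuous_measurable_fun.
  by move=> x; case/andP: (hC x) => h0 h1; rewrite ger0_norm.
have cf1chi : continuous (fun x => f1 x * chi x : R)%R.
  by move=> x; apply: cvgM; [exact: cf1|exact: cchi].
have f1chib x : (0 <= f1 x * chi x <= M)%R.
  case/andP: (chib x) => ? ?; case/andP: (f1b x) => ? ?.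
  by rewrite mulr_ge0//= -[leRHS]mulr1 ler_pM.
have i1 := bint _ _ cchi chib.
have i2 := bint _ _ cf1chi f1chib.
pose A : R := (\int[N]_x chi x)%R; pose A2 : R := (\int[N]_x (f1 x * chi x))%R.
have iabs : N.-integrable setT (EFin \o (fun x : R => `|x|)%R).
  apply: (le_integrable measurableT _ _ integrable_normal_id).
    by apply/measurable_EFinP; exact: measurableT_comp.
  by move=> x _ /=; rewrite normr_id.
have ione (k : R) : N.-integrable setT (EFin \o cst k).
  by apply: (@N_bounded_integrable (cst k) `|k|%R) => //; exact: measurable_cst.
have A0 : (0 < A)%R.
  have : (1 - n^-1 * m <= A)%R.
    have -> : (1 - n^-1 * m = \int[N]_x (1 - n^-1 * `|x|))%R.
      rewrite (@RintegralB _ _ _ N setT (cst 1%R) (fun x => n^-1 * `|x|)%R)//; last first.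
        by have := integrableZl measurableT n^-1%R iabs.
      congr (_ - _)%R; first by rewrite /Rintegral (integral_prob_cst N 1%:E).
      by rewrite (RintegralZl n^-1%R measurableT iabs)//.
    apply: le_Rintegral => //.
      have := integrableB measurableT (ione 1%R) (integrableZl measurableT n^-1%R iabs).
      by [].
    move=> x _; case: (leP `|x|%R n) => xn.
      by rewrite chi1// gerBl mulr_ge0// invr_ge0 ltW.
    apply: (@le_trans _ _ 0%R); last by case/andP: (chib x).
    by rewrite subr_le0 mulrC ler_pdivlMr// mul1r ltW.
  have mn : (m < n)%R.
    rewrite /n ltr_pdivlMr//; apply: (@le_lt_trans _ _ m); first by rewrite ler_piMr.
    have : (0 <= M * m)%R by rewrite mulr_ge0.
    by move: m0 M0; clear; move=> *; lra.
  by apply: lt_le_trans; rewrite subr_gt0 mulrC ltr_pdivrMr// mul1r.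
(* The solution of [A2 + (1 - A) c0 = c0]: with it the outer value of the blend is also its mean. *)
pose c0 : R := (A2 / A)%R.
have c0b : (0 <= c0 <= M)%R.
  have A20 : (0 <= A2)%R.
    by apply: Rintegral_ge0 => x _; case/andP: (f1chib x).
  apply/andP; split; first by apply: divr_ge0 => //; exact: ltW.
  rewrite /c0 ler_pdivrMr//.
  have -> : (M * A = \int[N]_x (M * chi x))%R by rewrite (RintegralZl M measurableT i1).
  apply: le_Rintegral => //.
    by have := integrableZl measurableT M i1.
  move=> x _; case/andP: (chib x) => ? ?; case/andP: (f1b x) => ? ?.
  exact: ler_wpM2r.
pose e : R := (eta / 3)%R.
have e0 : (0 < e)%R by rewrite divr_gt0.
have e1 : (e <= 1)%R by rewrite /e; move: eta1; clear; move=> *; lra.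
pose F' (x : R) : R := (e + (f1 x * chi x + (1 - chi x) * c0))%R.
have F'mid x : (0 <= f1 x * chi x + (1 - chi x) * c0 <= M)%R.
  case/andP: (chib x) => ? ch1; case/andP: (f1b x) => ? ?; case/andP: c0b => ? ?.
  apply/andP; split; first by apply: addr_ge0; apply: mulr_ge0 => //; rewrite subr_ge0.
  have -> : M = (M * chi x + (1 - chi x) * M)%R by ring.
  by apply: lerD; [exact: ler_wpM2r|apply: ler_wpM2l => //; rewrite subr_ge0].
exists F'; exists e; exists (n + 1)%R; exists (e + c0)%R; split => //.
- by rewrite addr_gt0.
- split.
  + move=> x; apply: cvgD; first exact: cvg_cst.
    apply: cvgD; first exact: cf1chi.
    by apply: cvgMl; apply: cvgB; [exact: cvg_cst|exact: cchi].
  + move=> x; case/andP: (F'mid x); rewrite /F'; move: (f1 x * _ + _)%R => z ? ?.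
    by apply/andP; split; [rewrite lerDl|rewrite addrC lerD].
  + by move=> x nx; rewrite /F' chi0// mulr0 add0r subr0 mul1r.
  + have ic0 : N.-integrable setT (EFin \o (fun x => c0 * chi x)%R).
      by have := integrableZl measurableT c0 i1.
    have -> : (\int[mu]_x (F' x * phi x) = \int[N]_x F' x)%R.
      rewrite /Rintegral integral_stdnormal_signed//; apply/measurable_EFinP.
      apply: continuous_measurable_fun => x; apply: cvgD; first exact: cvg_cst.
      apply: cvgD; first exact: cf1chi.
      by apply: cvgMl; apply: cvgB; [exact: cvg_cst|exact: cchi].
    transitivity (\int[N]_x ((e + c0) + (f1 x * chi x - c0 * chi x)))%R.
      by apply: eq_Rintegral => x _; rewrite /F'; ring.
    have i4 : N.-integrable setT (EFin \o (fun x => f1 x * chi x - c0 * chi x)%R).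
      by have := integrableB measurableT i2 ic0.
    rewrite (RintegralD measurableT (ione (e + c0)%R) i4).
    rewrite (RintegralB measurableT i2 ic0) (RintegralZl c0 measurableT i1).
    rewrite -/A -/A2 /c0 divfK ?gt_eqF// subrr addr0.
    by rewrite /Rintegral (integral_prob_cst N (e + A2 / A)%:E).
pose d1 (x : R) : \bar R := (`|F x - g x| * \1_E x)%:E.
pose d2 (x : R) : \bar R := (M / n * `|x|)%:E.
have mg : measurable_fun setT g by exact: continuous_measurable_fun.
have md1 : measurable_fun setT d1.
  apply/measurable_EFinP; apply: measurable_funM => //.
  by apply: measurableT_comp => //; exact: measurable_funB.
have md2 : measurable_fun setT d2 by apply/measurable_EFinP; apply: measurable_funM.
have d10 x : 0 <= d1 x by rewrite lee_fin mulr_ge0.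
have Mn0 : (0 <= M / n)%R by rewrite divr_ge0// ltW.
have d20 x : 0 <= d2 x by rewrite lee_fin mulr_ge0.
apply: (@le_trans _ _ (\int[N]_x (e%:E + (d1 x + d2 x)))).
  apply: ge0_le_integral => //.
  - apply/measurable_EFinP; apply: measurableT_comp => //; apply: measurable_funB => //.
    apply: continuous_measurable_fun => x; apply: cvgD; first exact: cvg_cst.
    apply: cvgD; first exact: cf1chi.
    by apply: cvgMl; apply: cvgB; [exact: cvg_cst|exact: cchi].
  - by apply: emeasurable_funD => //; exact: emeasurable_funD.
  move=> x _; rewrite /d1 /d2 -!EFinD lee_fin indicE.
  have tri (z : R) : (`|F x - (e + z)| <= e + `|F x - z|)%R.
    have -> : (F x - (e + z) = (F x - z) - e)%R by ring.
    by rewrite (le_trans (ler_normB _ _))// addrC (ger0_norm (ltW e0)).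
  apply: (le_trans (tri _)); rewrite lerD2l.
  have [xE|xE] := boolP (x \in E).
    have xn : (`|x| <= n)%R by move: xE; rewrite inE /E/= in_itv/= -ler_norml.
    rewrite mulr1 chi1// mulr1 subrr mul0r addr0 (le_trans (f1g x))// lerDl.
    by apply: mulr_ge0.
  have xn : (n < `|x|)%R.
    by move: xE; rewrite notin_setE /E/= in_itv/= -ler_norml => /negP; rewrite -ltNge.
  rewrite mulr0 add0r; apply: (@le_trans _ _ M).
    case/andP: (F'mid x); case/andP: (Fb x); move: (f1 x * _ + _)%R => z ? ? ? ?.
    by rewrite ler_norml; apply/andP; split; lra.
  by rewrite mulrAC ler_pdivlMr// ler_wpM2l// ltW.
have me0 : measurable_fun setT (cst e%:E : R -> \bar R) by exact: measurable_cst.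
have e00 (x : R) : setT x -> 0 <= cst e%:E x by rewrite lee_fin ltW.
have d120 (x : R) : setT x -> 0 <= d1 x + d2 x by rewrite adde_ge0.
rewrite (ge0_integralD N measurableT e00 me0 d120 (emeasurable_funD md1 md2)).
rewrite (@ge0_integralD _ _ _ N setT measurableT d1)//.
rewrite (integral_prob_cst N e%:E).
have b1 : \int[N]_x d1 x <= e%:E.
  rewrite integral_stdnormal//.
  apply: (@le_trans _ _ (\int[mu]_x (pk%:E * d1 x))).
    apply: ge0_le_integral => //.
    - by move=> x _; rewrite mule_ge0// lee_fin phi_ge0.
    - by apply: emeasurable_funM => //; apply/measurable_EFinP; exact: measurable_phi.
    - exact: measurable_funeM.
    move=> x _; rewrite muleC lee_wpmul2r// lee_fin.
    by rewrite normal_pdf_ub// oner_neq0.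
  rewrite ge0_integralZl_EFin ?(ltW pk0)//.
  have -> : \int[mu]_x d1 x = \int[mu]_(z in E) (`|F z - g z|)%:E.
    rewrite [RHS]integral_mkcond; apply: eq_integral => x _.
    by rewrite patchE /d1 indicE; case: ifPn => _; rewrite ?mulr1 ?mulr0.
  apply: (@le_trans _ _ (pk%:E * (eta / (3 * pk))%:E)); first by rewrite lee_wpmul2l// lee_fin ltW.
  by rewrite -EFinM lee_fin /e le_eqVlt; apply/orP; left; apply/eqP; field; rewrite gt_eqF.
have b2 : \int[N]_x d2 x <= e%:E.
  rewrite /d2; under eq_integral do rewrite EFinM.
  rewrite ge0_integralZl_EFin//; last exact/measurable_EFinP.
  rewrite mE -EFinM lee_fin mulrAC ler_pdivrMr//.
  have -> : (e * n = (M + 1) * (m + 1))%R.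
    by rewrite /e /n; field; rewrite gt_eqF.
  by move: m0 M0; clear; move=> *; rewrite mulrDl mulrDr !mulr1 mul1r -!addrA lerDl !addr_ge0.
apply: (@le_trans _ _ (e%:E + (e%:E + e%:E))); first by rewrite leeD2l// leeD.
by rewrite -!EFinD lee_fin /e; lra.
Qed.

End rh1.

Section rh1.
Context {R : realType}.
Local Notation N := (@stdnormal R).
Local Notation phi := (@phi R).
Local Notation P2 := ((@stdnormal R) \x (@stdnormal R))%E.
Local Open Scope ereal_scope.

Lemma exprn_lipschitz (M : R) (K : nat) : (0 <= M)%R -> exists2 C : R, (0 <= C)%R &
  forall a b, (0 <= a <= M)%R -> (0 <= b <= M)%R -> (`|a ^+ K - b ^+ K| <= C * `|a - b|)%R.
Proof.
move=> M0; elim: K => [|K [C C0 IH]].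
  by exists 0%R => // a b _ _; rewrite !expr0 subrr normr0 mul0r.
exists (M * C + M ^+ K)%R; first by rewrite addr_ge0 ?mulr_ge0 ?exprn_ge0.
move=> a b ab bb; have := IH a b ab bb; case/andP: ab => a0 aM; case/andP: bb => b0 bM.
move=> h; have -> : (a ^+ K.+1 - b ^+ K.+1 = a * (a ^+ K - b ^+ K) + b ^+ K * (a - b))%R.
  by rewrite !exprS; ring.
apply: (le_trans (ler_normD _ _)); rewrite [leRHS]mulrDl !normrM (ger0_norm a0); apply: lerD.
  by rewrite -mulrA ler_pM.
by rewrite ler_wpM2r// ger0_norm ?exprn_ge0// lerXn2r.
Qed.

(** Makes both sides of the inequality Lipschitz for the L1 norm on bounded functions, so that it
    passes from nice functions to measurable ones. *)
Lemma expr_prod_lipschitz (M : R) (K : nat) : (0 <= M)%R -> exists2 L : R, (0 <= L)%R &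
  forall a b a' b', (0 <= a <= M)%R -> (0 <= b <= M)%R -> (0 <= a' <= M)%R -> (0 <= b' <= M)%R ->
   (a' ^+ K * b' ^+ K <= a ^+ K * b ^+ K + L * (`|a - a'| + `|b - b'|))%R.
Proof.
move=> M0; have [C C0 h] := exprn_lipschitz K M0.
exists (C * M ^+ K)%R; first by rewrite mulr_ge0 ?exprn_ge0.
move=> a b a' b' ha hb ha' hb'; have h1 := h _ _ ha' ha; have h2 := h _ _ hb' hb.
case/andP: ha => a0 aM; case/andP: hb' => b'0 b'M.
have k1 : (b' ^+ K <= M ^+ K)%R by rewrite lerXn2r.
have k2 : (a ^+ K <= M ^+ K)%R by rewrite lerXn2r.
have -> : (a' ^+ K * b' ^+ K =
  a ^+ K * b ^+ K + ((a' ^+ K - a ^+ K) * b' ^+ K + a ^+ K * (b' ^+ K - b ^+ K)))%R by ring.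
rewrite lerD2l [leRHS]mulrDr; apply: lerD.
  apply: (le_trans (ler_norm _)); rewrite normrM (ger0_norm (exprn_ge0 _ b'0)).
  by rewrite [leRHS]mulrAC (distrC a a'); apply: ler_pM => //; exact: exprn_ge0.
apply: (le_trans (ler_norm _)); rewrite normrM (ger0_norm (exprn_ge0 _ a0)).
rewrite [leLHS]mulrC [leRHS]mulrAC (distrC b b').
by apply: ler_pM => //; exact: exprn_ge0.
Qed.

(** Borell's reverse hypercontractivity. For [f = F^K], [g = G^K] and [p = 1/K] it says that
    [E f(x) g(- x')] is at least the product of the [p]-norms of [f] and [g], where [x'] has
    correlation [w = 1 - p] with [x]. The sign is the one that skew-symmetry calls for later. *)
Lemma rh1 (K : nat) (F G : R -> R) (M w : R) : (0 < K)%N ->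
  measurable_fun setT F -> measurable_fun setT G ->
  (forall x, (0 <= F x <= M)%R) -> (forall x, (0 <= G x <= M)%R) ->
  w = (1 - K%:R^-1)%R ->
  (((\int[N]_x F x) * (\int[N]_x G x)) ^+ K)%R%:E <= \int[N]_x \int[N]_v
    (F x ^+ K * G (- (w * x + Num.sqrt (1 - w ^+ 2) * v)) ^+ K)%:E.
Proof.
move=> K0 mF mG Fb Gb wE.
have M0 : (0 <= M)%R by case/andP: (Fb 0%R) => /le_trans; apply.
pose b := Num.sqrt (1 - w ^+ 2).
have w01 : (0 <= w < 1)%R.
  by rewrite wE subr_ge0 ltrBlDr ltrDl invr_gt0 ltr0n K0 invf_le1 ?ltr0n// ler1n K0.
have wb : (w ^+ 2 + b ^+ 2 = 1)%R.
  rewrite sqr_sqrtr ?subrKC// subr_ge0; case/andP: w01 => w0 w1.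
  by rewrite expr_le1// ltW.
have M1 : (0 <= M + 1)%R by rewrite addr_ge0.
have [L L0 lip] := expr_prod_lipschitz K M1.
pose r2 (xy : R * R) : R := (- (w * xy.1 + b * xy.2))%R.
have mr2 : measurable_fun setT r2.
  by apply: measurableT_comp => //; apply: measurable_funD; exact: measurable_funM.
pose I (f g : R -> R) (xy : R * R) : R := (f xy.1 ^+ K * g (r2 xy) ^+ K)%R.
have mI f g : measurable_fun setT f -> measurable_fun setT g -> measurable_fun setT (I f g).
  move=> mf mg; apply: measurable_funM; apply: measurable_funX.
    exact: (measurableT_comp mf).
  exact: (measurableT_comp mg).
have IE (f g : R -> R) : measurable_fun setT f -> measurable_fun setT g ->
    (forall x, 0 <= f x)%R -> (forall x, 0 <= g x)%R ->
    \int[N]_x \int[N]_v (f x ^+ K * g (- (w * x + b * v)) ^+ K)%:E =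
    \int[P2]_xy (I f g xy)%:E.
  move=> mf mg f0 g0; rewrite (@fubini_tonelli1 _ _ _ _ _ N N (EFin \o I f g))//.
    by apply/measurable_EFinP; exact: mI.
  by move=> x; rewrite lee_fin mulr_ge0// exprn_ge0.
have r2E (h : R -> R) : measurable_fun setT h -> (forall x, 0 <= h x)%R ->
    \int[P2]_xy (h (r2 xy))%:E = \int[N]_x (h x)%:E.
  move=> mh h0; rewrite (@fubini_tonelli1 _ _ _ _ _ N N (EFin \o (h \o r2)))//; last 2 first.
  - by apply/measurable_EFinP; exact: (measurableT_comp mh).
  - by move=> x; rewrite lee_fin /=.
  have mhN : measurable_fun setT (fun x : R => (h (- x))%:E).
    by apply/measurable_EFinP; apply: (measurableT_comp mh).
  transitivity (\int[N]_x \int[N]_y ((h (- x)%R)%:E)).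
    apply: (@integral_normal_reflect R w b (fun xy => (h (- xy.1)%R)%:E) wb).
      exact: (measurableT_comp mhN).
    by move=> x; rewrite lee_fin.
  under eq_integral do rewrite integral_prob_cst.
  apply: (@normal_opp R (EFin \o h)); first exact/measurable_EFinP.
  by move=> x; rewrite lee_fin /=.
have Fg0 x : (0 <= F x)%R by case/andP: (Fb x).
have Gg0 x : (0 <= G x)%R by case/andP: (Gb x).
rewrite -/b IE//; apply/lee_addgt0Pr => e e0.
(* Replacing [F] and [G] by nice functions costs [L (eta + eta)] twice, once in the means and once
   in the double integral. *)
pose eta := Num.min 1%R (e / (4 * L + 1))%R.
have L1 : (0 < 4 * L + 1)%R by rewrite ltr_wpDl// mulr_ge0.
have eta0 : (0 < eta)%R by rewrite lt_min ltr01 divr_gt0.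
have eta01 : (0 < eta <= 1)%R by rewrite eta0 ge_min lexx.
have etaL : (4 * L * eta <= e)%R.
  apply: (@le_trans _ _ ((4 * L + 1) * eta)%R); first by rewrite ler_wpM2r ?lerDl// ltW.
  by rewrite mulrC -ler_pdivlMr// ge_min lexx orbT.
have [F' [e1 [B1 [c1 [e10 B10 [cF' F'b F'c F'i] dF]]]]] := nice_approx eta01 mF Fb.
have [G' [e2 [B2 [c2 [e20 B20 [cG' G'b G'c G'i] dG]]]]] := nice_approx eta01 mG Gb.
have mF' : measurable_fun setT F' by exact: continuous_measurable_fun.
have mG' : measurable_fun setT G' by exact: continuous_measurable_fun.
pose e' := Num.min e1 e2; pose B := Num.max B1 B2.
have mean (f : R -> R) (c e3 : R) : continuous f -> (forall x, (e3 <= f x <= M + 1)%R) -> (0 < e3)%R ->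
    (\int[mu]_x (f x * phi x) = c)%R -> (\int[N]_x f x = c)%R.
  move=> cf fb e30 <-; rewrite /Rintegral integral_stdnormal_signed//.
  by apply/measurable_EFinP; exact: continuous_measurable_fun.
have RH : (((c1 * c2) ^+ K)%:E <= \int[P2]_xy (I F' G' xy)%:E)%E.
  rewrite -IE//; last 2 first.
  - by move=> x; case/andP: (F'b x) => h _; apply: le_trans h; exact: ltW.
  - by move=> x; case/andP: (G'b x) => h _; apply: le_trans h; exact: ltW.
  apply: (@rh_nice R K F' G' e' (M + 1)%R c1 c2 B w) => //.
  - by rewrite lt_min e10 e20.
  - by rewrite lt_max B10.
  - by move=> x; case/andP: (F'b x) => h ->; rewrite ge_min h.
  - by move=> x; case/andP: (G'b x) => h ->; rewrite ge_min h orbT.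
  - by move=> x; rewrite ge_max => /andP[h _]; exact: F'c.
  - by move=> x; rewrite ge_max => /andP[_ h]; exact: G'c.
have Fb' x : (0 <= F x <= M + 1)%R by case/andP: (Fb x) => -> /= /le_trans; apply; rewrite lerDl.
have Gb' x : (0 <= G x <= M + 1)%R by case/andP: (Gb x) => -> /= /le_trans; apply; rewrite lerDl.
have F'b' x : (0 <= F' x <= M + 1)%R by case/andP: (F'b x) => h ->; rewrite (le_trans _ h)// ltW.
have G'b' x : (0 <= G' x <= M + 1)%R by case/andP: (G'b x) => h ->; rewrite (le_trans _ h)// ltW.
have bi (f : R -> R) : measurable_fun setT f -> (forall x, (0 <= f x <= M + 1)%R) ->
    N.-integrable setT (EFin \o f).
  move=> mf fb; apply: (@N_bounded_integrable R f (M + 1)%R) => // x.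
  by case/andP: (fb x) => h0 h1; rewrite ger0_norm.
have mb (f : R -> R) : measurable_fun setT f -> (forall x, (0 <= f x <= M + 1)%R) ->
    (0 <= \int[N]_x f x <= M + 1)%R.
  move=> mf fb; apply/andP; split; first by apply: Rintegral_ge0 => x _; case/andP: (fb x).
  have -> : (M + 1 = \int[N]_x (cst (M + 1)%R x))%R.
    by rewrite /Rintegral (integral_prob_cst N (M + 1)%:E).
  apply: le_Rintegral => //; first exact: bi.
    by apply: (@N_bounded_integrable R _ `|M + 1|%R) => //; exact: measurable_cst.
  by move=> x _; case/andP: (fb x).
have close (f g : R -> R) : measurable_fun setT f -> measurable_fun setT g ->
    (forall x, (0 <= f x <= M + 1)%R) -> (forall x, (0 <= g x <= M + 1)%R) ->
    (\int[N]_x (`|f x - g x|)%:E <= eta%:E)%E ->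
    (`|(\int[N]_x f x) - (\int[N]_x g x)| <= eta)%R.
  move=> mf mg fb gb h; rewrite -RintegralB//; [|exact: bi|exact: bi].
  have ifg : N.-integrable setT (EFin \o (fun x => f x - g x)%R).
    by have := integrableB measurableT (bi _ mf fb) (bi _ mg gb).
  have := le_normr_Rintegral measurableT ifg => /le_trans; apply.
  rewrite -lee_fin /Rintegral fineK//.
  by apply: integrable_fin_num => //; exact: integrable_norm.
have EF : (`|c1 - (\int[N]_x F x)| <= eta)%R.
  rewrite -(mean F' c1 e1)//; apply: close => //.
  by under eq_integral do rewrite distrC.
have EG : (`|c2 - (\int[N]_x G x)| <= eta)%R.
  rewrite -(mean G' c2 e2)//; apply: close => //.
  by under eq_integral do rewrite distrC.
have c1b : (0 <= c1 <= M + 1)%R by rewrite -(mean F' c1 e1)//; apply: mb.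
have c2b : (0 <= c2 <= M + 1)%R by rewrite -(mean G' c2 e2)//; apply: mb.
have step1 : (((\int[N]_x F x) * (\int[N]_x G x)) ^+ K <= (c1 * c2) ^+ K + L * (eta + eta))%R.
  rewrite !exprMn; apply: le_trans (lip c1 c2 _ _ c1b c2b (mb _ mF Fb') (mb _ mG Gb')) _.
  by rewrite lerD2l ler_wpM2l// lerD.
have mdF : measurable_fun setT (fun x => `|F x - F' x|)%R.
  by apply: measurableT_comp => //; exact: measurable_funB.
have mdG : measurable_fun setT (fun x => `|G x - G' x|)%R.
  by apply: measurableT_comp => //; exact: measurable_funB.
have step2 : \int[P2]_xy (I F' G' xy)%:E <= \int[P2]_xy (I F G xy)%:E + (L * (eta + eta))%:E.
  have m1 : measurable_fun setT (fun xy : R * R => (`|F xy.1 - F' xy.1|)%:E).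
    by apply/measurable_EFinP; apply: (measurableT_comp mdF).
  have m2 : measurable_fun setT (fun xy : R * R => (`|G (r2 xy) - G' (r2 xy)|)%:E).
    by apply/measurable_EFinP; apply: (measurableT_comp mdG).
  have m12 := emeasurable_funD m1 m2.
  have mL : measurable_fun setT (fun xy : R * R =>
      L%:E * ((`|F xy.1 - F' xy.1|)%:E + (`|G (r2 xy) - G' (r2 xy)|)%:E)).
    exact: measurable_funeM.
  have mIFG : measurable_fun setT (EFin \o I F G) by apply/measurable_EFinP; exact: mI.
  apply: (@le_trans _ _ (\int[P2]_xy ((I F G xy)%:E + L%:E * ((`|F xy.1 - F' xy.1|)%:E +
      (`|G (r2 xy) - G' (r2 xy)|)%:E)))).
    apply: ge0_le_integral => //.
    - move=> x _; rewrite lee_fin mulr_ge0// exprn_ge0//.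
        by case/andP: (F'b' x.1).
      by case/andP: (G'b' (r2 x)).
    - by apply/measurable_EFinP; exact: mI.
    - exact: emeasurable_funD.
    move=> x _; have := lip (F x.1) (G (r2 x)) (F' x.1) (G' (r2 x)) (Fb' _) (Gb' _) (F'b' _) (G'b' _).
    by rewrite -lee_fin; apply.
  have IFG0 (x : R * R) : setT x -> 0 <= (I F G x)%:E by rewrite lee_fin mulr_ge0// exprn_ge0.
  have s0 (x : R * R) : setT x -> 0 <= (`|F x.1 - F' x.1|)%:E + (`|G (r2 x) - G' (r2 x)|)%:E.
    by move=> _; rewrite -EFinD lee_fin addr_ge0.
  have Ls0 (x : R * R) : setT x -> 0 <= L%:E * ((`|F x.1 - F' x.1|)%:E + (`|G (r2 x) - G' (r2 x)|)%:E).
    by move=> _; rewrite mule_ge0// s0.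
  rewrite (ge0_integralD P2 measurableT IFG0 mIFG Ls0 mL) leeD2l//.
  rewrite ge0_integralZl_EFin// [leRHS]EFinM lee_wpmul2l//.
  rewrite (@ge0_integralD _ _ _ P2 _ measurableT _ _ _ m1 _ m2)//.
  rewrite EFinD leeD//; last by rewrite (r2E (fun x => `|G x - G' x|)%R).
  rewrite (@fubini_tonelli1 _ _ _ _ _ N N _ m1)//.
  apply: le_trans dF; rewrite le_eqVlt; apply/orP; left; apply/eqP.
  by apply: eq_integral => x _; rewrite /fubini_F /=; exact: integral_prob_cst.
apply: (@le_trans _ _ ((c1 * c2) ^+ K + L * (eta + eta))%:E); first by rewrite lee_fin.
rewrite EFinD; apply: (le_trans (leeD2r _ RH)); apply: (le_trans (leeD2r _ step2)).
rewrite -addeA leeD2l// -EFinD lee_fin; apply: le_trans etaL.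
by rewrite le_eqVlt; apply/orP; left; apply/eqP; ring.
Qed.
End rh1.

(** * From the line to Gaussian vectors, one coordinate at a time *)

Section double_integrals.
Context d1 d2 (X : measurableType d1) (Y : measurableType d2) (R : realType)
  (P : probability X R) (Q : probability Y R).
Local Open Scope ereal_scope.

Lemma measurable_integral2 d' (Z : measurableType d') (f : Z -> Y -> \bar R) :
  measurable_fun setT (fun zy : Z * Y => f zy.1 zy.2) -> (forall z y, 0 <= f z y) ->
  measurable_fun setT (fun z => \int[Q]_y f z y).
Proof.
move=> mf f0; apply: (@measurable_fun_fubini_tonelli_F _ _ Z Y R Q (fun zy => f zy.1 zy.2)) => // z; exact: f0.
Qed.

Lemma integral_swap (f : X -> Y -> \bar R) :
  measurable_fun setT (fun xy : X * Y => f xy.1 xy.2) -> (forall x y, 0 <= f x y) ->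
  \int[P]_x \int[Q]_y f x y = \int[Q]_y \int[P]_x f x y.
Proof.
move=> mf f0; apply: (@fubini_tonelli _ _ X Y R P Q (fun xy => f xy.1 xy.2)) => // z; exact: f0.
Qed.

Lemma bounded_integrable (f : X -> R) (M : R) : measurable_fun setT f ->
  (forall x, (0 <= f x <= M)%R) -> P.-integrable setT (EFin \o f).
Proof.
move=> mf fM; apply: measurable_bounded_integrable => //.
- by rewrite (le_lt_trans (probability_le1 _ _))// ltry.
- exists M; split; first exact: num_real.
  move=> M' MM' x _ /=; case/andP: (fM x) => f0 f1.
  by rewrite ger0_norm// (le_trans f1)// ltW.
Qed.

Lemma bounded_integral (f : X -> R) (M : R) : measurable_fun setT f ->
  (forall x, (0 <= f x <= M)%R) ->
  \int[P]_x (f x)%:E = (\int[P]_x f x)%R%:E /\ (0 <= \int[P]_x f x <= M)%R.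
Proof.
move=> mf fM; have i := bounded_integrable mf fM.
have E : \int[P]_x (f x)%:E = (\int[P]_x f x)%R%:E.
  by rewrite /Rintegral fineK//; exact: integrable_fin_num.
split => //; rewrite -!lee_fin -E; apply/andP; split.
  by apply: integral_ge0 => x _; case/andP: (fM x); rewrite lee_fin.
rewrite -[leRHS](integral_prob_cst P); apply: ge0_le_integral => //.
- by move=> x _; case/andP: (fM x); rewrite lee_fin.
- exact/measurable_EFinP.
- by move=> x _; case/andP: (fM x); rewrite lee_fin.
Qed.

End double_integrals.

Section gauss_cons.
Context {R : realType}.
Local Notation N := (@stdnormal R).
Local Notation RR := (measurableTypeR R).
Local Notation U n := ('rV[RR]_n).
Local Open Scope ereal_scope.

Definition cons_row n (x : R) (u : 'rV[R]_n) : 'rV[R]_n.+1 :=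
  \row_i (if unlift ord0 i is Some j then u ord0 j else x).

Lemma cons_row0 n x (u : 'rV[R]_n) : cons_row x u ord0 ord0 = x.
Proof. by rewrite mxE unlift_none. Qed.

Lemma cons_rowS n x (u : 'rV[R]_n) i : cons_row x u ord0 (lift ord0 i) = u ord0 i.
Proof. by rewrite mxE liftK. Qed.

Lemma cons_rowD n a b x y (u v : 'rV[R]_n) :
  (a *: cons_row x u + b *: cons_row y v = cons_row (a * x + b * y) (a *: u + b *: v))%R.
Proof.
apply/rowP => i; rewrite !mxE.
by case: (unlift _ _) => [j|//]; rewrite !mxE.
Qed.

Lemma cons_rowB n a b x y (u v : 'rV[R]_n) :
  (a *: cons_row x u - b *: cons_row y v = cons_row (a * x - b * y) (a *: u - b *: v))%R.
Proof. by rewrite -scaleNr cons_rowD mulNr scaleNr. Qed.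

Lemma cons_rowN n x (u : 'rV[R]_n) : (- cons_row x u = cons_row (- x) (- u))%R.
Proof. by apply/rowP => i; rewrite !mxE; case: (unlift _ _) => [j|//]; rewrite mxE. Qed.

Lemma dot_cons_row n x y (u v : 'rV[R]_n) :
  (dot (cons_row x u) (cons_row y v) = x * y + dot u v)%R.
Proof.
rewrite /dot big_ord_recl !cons_row0; congr (_ + _)%R.
by apply: eq_bigr => i _; rewrite !cons_rowS.
Qed.

Lemma cons_row_ind n (v : 'rV[R]_n.+1) : exists x u, v = cons_row x u.
Proof.
exists (v ord0 ord0), (\row_i v ord0 (lift ord0 i))%R.
by apply/rowP => i; rewrite mxE; case: unliftP => [j ->|->]; rewrite ?mxE.
Qed.

Lemma measurable_cons_row n d' (X : measurableType d') (f : X -> R) (g : X -> 'rV[R]_n) :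
  measurable_fun setT f -> measurable_fun setT g ->
  measurable_fun setT (fun x => cons_row (f x) (g x)).
Proof.
move=> mf mg; apply: measurable_fun_rVP => i.
case: (unliftP ord0 i) => [j ->|->].
  under eq_fun do rewrite cons_rowS.
  exact: (measurableT_comp (measurable_rV_coord j) mg).
by under eq_fun do rewrite cons_row0.
Qed.

Lemma integral_gauss n (f : 'rV[R]_n -> \bar R) : measurable_fun setT f ->
  (forall u, 0 <= f u) ->
  \int[gauss n]_u f u = \int[iprod (fun _ : 'I_n => N)]_t f (row_of_tuple t).
Proof.
move=> mf f0; rewrite /gauss /distribution ge0_integral_pushforward//.
Qed.

Lemma integral_gauss0 (f : 'rV[R]_0 -> \bar R) : \int[gauss 0]_u f u = f 0%R.
Proof.
transitivity (\int[@gauss R 0]_u (f 0%R)); last exact: integral_prob_cst.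
by apply: eq_integral => u _; rewrite (thinmx0 u).
Qed.

(** The first coordinate is independent of the remaining ones; this form supports all inductions on
    the dimension below. *)
Lemma integral_gaussS n (f : 'rV[R]_n.+1 -> \bar R) : measurable_fun setT f ->
  (forall u, 0 <= f u) ->
  \int[gauss n.+1]_u f u = \int[N]_x \int[gauss n]_u f (cons_row x u).
Proof.
move=> mf f0; rewrite integral_gauss//=.
have mrow k := @measurable_row_of_tuple R k.
have mft : measurable_fun setT (f \o @row_of_tuple R n.+1) by exact: measurableT_comp.
have mftc : measurable_fun setT (f \o @row_of_tuple R n.+1 \o @tuple_cons _ RR n).
  by apply: (measurableT_comp mft); exact: measurable_tuple_cons.
rewrite /distribution ge0_integral_pushforward//=.
rewrite preimage_setT.
rewrite (@fubini_tonelli1 _ _ _ _ _ N (iprod (fun _ : 'I_n => N)) (f \o @row_of_tuple R n.+1 \o @tuple_cons _ RR n)) => //; last by move=> x; exact: f0.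
apply: eq_integral => x _; rewrite /fubini_F integral_gauss//; last first.
  apply: (measurableT_comp mf).
  exact: (@measurable_cons_row n _ _ (cst x) id (measurable_cst _) (@measurable_id _ _ _)).
apply: eq_integral => t _ /=; congr f; apply/rowP => i; rewrite !mxE.
by case: unliftP => [j ->|->]; rewrite ?mxE ?tnthS.
Qed.

End gauss_cons.

Lemma measurable_fun2 d d1 d2 d3 (X : measurableType d) (Y : measurableType d1)
  (Z : measurableType d2) (W : measurableType d3) (h : Y -> Z -> W) (f : X -> Y) (k : X -> Z) :
  measurable_fun setT (fun yz : Y * Z => h yz.1 yz.2) ->
  measurable_fun setT f -> measurable_fun setT k ->
  measurable_fun setT (fun x => h (f x) (k x)).
Proof. by move=> mh mf mk; apply: (measurableT_comp mh (measurable_fun_pair mf mk)). Qed.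

Section gauss_facts.
Context {R : realType}.
Local Notation N := (@stdnormal R).
Local Notation g := (@gauss R).
Local Open Scope ereal_scope.

Lemma measurable_rV_lin n d' (X : measurableType d') (a b : R) (f h : X -> 'rV[R]_n) :
  measurable_fun setT f -> measurable_fun setT h ->
  measurable_fun setT (fun x => a *: f x + b *: h x)%R.
Proof.
move=> mf mh; apply: measurable_fun_rVP => i.
under eq_fun do rewrite !mxE.
by apply: measurable_funD; apply: measurable_funM => //;
  apply: (measurableT_comp (measurable_rV_coord i)).
Qed.

Lemma measurable_rV_opp n d' (X : measurableType d') (f : X -> 'rV[R]_n) :
  measurable_fun setT f -> measurable_fun setT (fun x => - f x)%R.
Proof.
move=> mf; apply: measurable_fun_rVP => i.
under eq_fun do rewrite !mxE.
by apply: measurableT_comp => //; apply: (measurableT_comp (measurable_rV_coord i)).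
Qed.

Lemma integral_gaussS2 n (h : 'rV[R]_n.+1 -> 'rV[R]_n.+1 -> \bar R) :
  measurable_fun setT (fun xy : 'rV[R]_n.+1 * 'rV[R]_n.+1 => h xy.1 xy.2) ->
  (forall u v, 0 <= h u v) ->
  \int[g n.+1]_u \int[g n.+1]_v h u v =
  \int[N]_x \int[N]_y \int[g n]_u \int[g n]_v h (cons_row x u) (cons_row y v).
Proof.
move=> mh h0.
have mhu u : measurable_fun setT (h u).
  exact: (measurableT_comp mh (pair1_measurable u)).
have mcons : measurable_fun setT (fun z : R * ('rV[R]_n * (R * 'rV[R]_n)) =>
    h (cons_row z.1 z.2.1) (cons_row z.2.2.1 z.2.2.2)).
  apply: (@measurable_fun2 _ _ _ _ _ _ _ _ h) => //; apply: measurable_cons_row => //.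
  - exact: measurableT_comp measurable_fst measurable_snd.
  - by do 2 apply: measurableT_comp => //.
  - by do 2 apply: measurableT_comp => //.
have mx x : measurable_fun setT (fun z : 'rV[R]_n * (R * 'rV[R]_n) =>
    h (cons_row x z.1) (cons_row z.2.1 z.2.2)).
  exact: (measurableT_comp mcons (pair1_measurable x)).
have mxu x u : measurable_fun setT (fun z : R * 'rV[R]_n =>
    h (cons_row x u) (cons_row z.1 z.2)).
  exact: (measurableT_comp (mx x) (pair1_measurable u)).
rewrite integral_gaussS; last 2 first.
- by apply: (@measurable_integral2 _ _ _ (g n.+1)).
- by move=> u; apply: integral_ge0.
apply: eq_integral => x _.
transitivity (\int[g n]_u \int[N]_y \int[g n]_v h (cons_row x u) (cons_row y v)).
  by apply: eq_integral => u _; rewrite integral_gaussS.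
apply: (@integral_swap _ _ _ _ R (g n) N (fun u y => \int[g n]_v h (cons_row x u) (cons_row y v))).
  apply: (@measurable_integral2 _ _ R (g n) _ _ (fun (z : 'rV[R]_n * R) v =>
     h (cons_row x z.1) (cons_row z.2 v))) => // .
  apply: (@measurable_fun2 _ _ _ _ _ _ _ _ h) => //.
    exact: (measurable_cons_row (measurable_cst x) (measurableT_comp measurable_fst measurable_fst)).
  exact: (measurable_cons_row (measurableT_comp measurable_snd measurable_fst) measurable_snd).
by move=> u y; apply: integral_ge0.
Qed.

(** The planar reflection acts on each coordinate separately. The symmetry of the law, the
    exchangeability of correlated pairs and the semigroup law of the noise are all instances, for
    suitable [(a, b)]. *)
Lemma gauss_reflect n (a b : R) (h : 'rV[R]_n -> 'rV[R]_n -> \bar R) :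
  (a ^+ 2 + b ^+ 2 = 1)%R ->
  measurable_fun setT (fun xy : 'rV[R]_n * 'rV[R]_n => h xy.1 xy.2) ->
  (forall u v, 0 <= h u v) ->
  \int[g n]_u \int[g n]_v h (a *: u + b *: v)%R (b *: u - a *: v)%R =
  \int[g n]_u \int[g n]_v h u v.
Proof.
move=> ab1; elim: n h => [|n IH] h mh h0.
  rewrite !integral_gauss0; congr (h _ _); exact: thinmx0.
have mab : measurable_fun setT (fun uv : 'rV[R]_n.+1 * 'rV[R]_n.+1 =>
    h (a *: uv.1 + b *: uv.2)%R (b *: uv.1 - a *: uv.2)%R).
  apply: (@measurable_fun2 _ _ _ _ _ _ _ _ h) => //; first exact: measurable_rV_lin.
  by under eq_fun do rewrite -scaleNr; exact: measurable_rV_lin.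
have mc (x y : R) : measurable_fun setT (fun uv : 'rV[R]_n * 'rV[R]_n =>
    h (cons_row x uv.1) (cons_row y uv.2)).
  by apply: (@measurable_fun2 _ _ _ _ _ _ _ _ h) => //; apply: measurable_cons_row.
have mall : measurable_fun setT (fun xy : R * R => \int[g n]_u \int[g n]_v h (cons_row xy.1 u) (cons_row xy.2 v)).
  apply: (@measurable_integral2 _ _ R (g n) _ _ (fun (z : R * R) u =>
     \int[g n]_v h (cons_row z.1 u) (cons_row z.2 v))); last by move=> *; exact: integral_ge0.
  apply: (@measurable_integral2 _ _ R (g n) _ _ (fun (z : (R * R) * 'rV[R]_n) v =>
     h (cons_row z.1.1 z.2) (cons_row z.1.2 v))) => //.
  by apply: (@measurable_fun2 _ _ _ _ _ _ _ _ h) => //; apply: measurable_cons_row => //;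
    do ?apply: measurableT_comp => //; do ?apply: measurableT_comp.
transitivity (\int[N]_x \int[N]_y \int[g n]_u \int[g n]_v
    h (a *: cons_row x u + b *: cons_row y v)%R (b *: cons_row x u - a *: cons_row y v)%R).
  exact: (@integral_gaussS2 n (fun u v => h (a *: u + b *: v)%R (b *: u - a *: v)%R)).
transitivity (\int[N]_x \int[N]_y \int[g n]_u \int[g n]_v h (cons_row x u) (cons_row y v)); last first.
  exact/esym/integral_gaussS2.
transitivity (\int[N]_x \int[N]_y \int[g n]_u \int[g n]_v
    h (cons_row (a * x + b * y) u)%R (cons_row (b * x - a * y) v)%R).
  apply: eq_integral => x _; apply: eq_integral => y _.
  rewrite -(IH (fun u v => h (cons_row (a * x + b * y)%R u) (cons_row (b * x - a * y)%R v)))//.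
  apply: eq_integral => u _; apply: eq_integral => v _.
  by rewrite cons_rowD cons_rowB.
apply: (@integral_normal_reflect R a b (fun xy => \int[g n]_u \int[g n]_v h (cons_row xy.1 u) (cons_row xy.2 v))) => //.
by move=> xy; apply: integral_ge0 => u _; exact: integral_ge0.
Qed.

Lemma gauss_mgf n (v : 'rV[R]_n) :
  \int[g n]_u (expR (dot v u))%:E = (expR (sqnorm v / 2))%:E.
Proof.
have me k (w : 'rV[R]_k) : measurable_fun setT (fun u => (expR (dot w u))%:E).
  apply/measurable_EFinP; apply: measurableT_comp => //; exact: measurable_dot.
elim: n v => [|n IH] v.
  by rewrite integral_gauss0 /sqnorm /dot !big_ord0 mul0r.
have [x [u ->]] := cons_row_ind v.
rewrite integral_gaussS//.
transitivity (\int[N]_y ((expR (sqnorm u / 2))%:E * (expR (x * y))%:E)).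
  apply: eq_integral => y _; rewrite -IH muleC -ge0_integralZl_EFin ?expR_ge0//; last exact: me.
  by apply: eq_integral => w _; rewrite dot_cons_row expRD EFinM.
rewrite ge0_integralZl_EFin ?expR_ge0//; last first.
  by apply/measurable_EFinP; apply: measurableT_comp => //; exact: measurable_funM.
rewrite normal_mgf -EFinM -expRD; congr (expR _)%:E.
by rewrite /sqnorm dot_cons_row -expr2 addrC mulrDl.
Qed.

(** Tensorization: [rh1] is applied to the partial means over all coordinates but the first, then
    the induction hypothesis to the sections of [F] and [G] at the two correlated first
    coordinates. *)
Lemma gauss_rh n (K : nat) (F G : 'rV[R]_n -> R) (M w : R) : (0 < K)%N ->
  measurable_fun setT F -> measurable_fun setT G ->
  (forall x, (0 <= F x <= M)%R) -> (forall x, (0 <= G x <= M)%R) ->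
  w = (1 - K%:R^-1)%R ->
  (((\int[g n]_x F x) * (\int[g n]_x G x)) ^+ K)%R%:E <= \int[g n]_x \int[g n]_v
    (F x ^+ K * G (- correlate w x v) ^+ K)%:E.
Proof.
move=> K0; elim: n F G => [|n IH] F G mF mG Fb Gb wE.
  by rewrite /Rintegral !integral_gauss0 /= exprMn (thinmx0 (- _)%R).
have mFc x : measurable_fun setT (fun u => F (cons_row x u)).
  by apply: (measurableT_comp mF); exact: (@measurable_cons_row _ _ _ _ (cst x) id).
have mGc x : measurable_fun setT (fun u => G (cons_row x u)).
  by apply: (measurableT_comp mG); exact: (@measurable_cons_row _ _ _ _ (cst x) id).
pose bar (f : 'rV[R]_n.+1 -> R) (x : R) : R := (\int[g n]_u f (cons_row x u))%R.
have barP (f : 'rV[R]_n.+1 -> R) : measurable_fun setT f -> (forall x, (0 <= f x <= M)%R) ->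
    [/\ measurable_fun setT (bar f), (forall x, (0 <= bar f x <= M)%R) &
        (\int[g n.+1]_u f u = \int[N]_x bar f x)%R].
  move=> mf fb.
  have mfc x : measurable_fun setT (fun u => f (cons_row x u)).
    by apply: (measurableT_comp mf); exact: (@measurable_cons_row _ _ _ _ (cst x) id).
  have BE x := bounded_integral (g n) (mfc x) (fun u => fb (cons_row x u)).
  split.
  - apply/measurable_EFinP.
    rewrite (_ : EFin \o bar f = fun x => \int[g n]_u (f (cons_row x u))%:E); last first.
      by apply/funext => x; rewrite (BE x).1.
    apply: (@measurable_integral2 _ _ R (g n) _ _ (fun x u => (f (cons_row x u))%:E)).
      apply/measurable_EFinP; apply: (measurableT_comp mf).
      exact: measurable_cons_row.
    by move=> x u; case/andP: (fb (cons_row x u)); rewrite lee_fin.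
  - by move=> x; exact: (BE x).2.
  rewrite /Rintegral integral_gaussS//.
  - by congr fine; apply: eq_integral => x _; rewrite (BE x).1.
  - exact/measurable_EFinP.
  - by move=> x; rewrite lee_fin; case/andP: (fb x).
have [mbF Fbb ->] := barP _ mF Fb; have [mbG Gbb ->] := barP _ mG Gb.
apply: (le_trans (rh1 K0 mbF mbG Fbb Gbb wE)).
have F0 x : (0 <= F x)%R by case/andP: (Fb x).
have G0 x : (0 <= G x)%R by case/andP: (Gb x).
have ml : measurable_fun setT (fun uv : 'rV[R]_n.+1 * 'rV[R]_n.+1 =>
   (F uv.1 ^+ K * G (- correlate w uv.1 uv.2) ^+ K)%:E).
  apply/measurable_EFinP; apply: measurable_funM; apply: measurable_funX.
    exact: (measurableT_comp mF).
  apply: (measurableT_comp mG); apply: measurable_rV_opp.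
  exact: measurable_correlate.
have l0 (u v : 'rV[R]_n.+1) : 0 <= (F u ^+ K * G (- correlate w u v) ^+ K)%:E.
  by rewrite lee_fin mulr_ge0 ?exprn_ge0.
apply: (@le_trans _ _ (\int[N]_x \int[N]_y \int[g n]_u \int[g n]_v
  (F (cons_row x u) ^+ K * G (- correlate w (cons_row x u) (cons_row y v)) ^+ K)%:E)); last first.
  rewrite le_eqVlt; apply/orP; left; apply/eqP/esym.
  exact: (@integral_gaussS2 n (fun u v => (F u ^+ K * G (- correlate w u v) ^+ K)%:E)).
have mr : measurable_fun setT (fun xy : R * R =>
    (bar F xy.1 ^+ K * bar G (- (w * xy.1 + Num.sqrt (1 - w ^+ 2) * xy.2)) ^+ K)%:E).
  apply/measurable_EFinP; apply: measurable_funM; apply: measurable_funX.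
    exact: (measurableT_comp mbF).
  apply: (measurableT_comp mbG); apply: measurableT_comp => //.
  by apply: measurable_funD; exact: measurable_funM.
have r0 x y : 0 <= (bar F x ^+ K * bar G y ^+ K)%:E.
  by rewrite lee_fin mulr_ge0// exprn_ge0//; [case/andP: (Fbb x)|case/andP: (Gbb y)].
have mfull : measurable_fun setT (fun z : R * R => \int[g n]_u \int[g n]_v
   (F (cons_row z.1 u) ^+ K * G (- correlate w (cons_row z.1 u) (cons_row z.2 v)) ^+ K)%:E).
  apply: (@measurable_integral2 _ _ R (g n) _ _ (fun (z : R * R) u =>
     \int[g n]_v (F (cons_row z.1 u) ^+ K * G (- correlate w (cons_row z.1 u) (cons_row z.2 v)) ^+ K)%:E)); last first.
    by move=> z u; apply: integral_ge0 => v _; rewrite lee_fin mulr_ge0 ?exprn_ge0.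
  apply: (@measurable_integral2 _ _ R (g n) _ _ (fun (z : (R * R) * 'rV[R]_n) v =>
    (F (cons_row z.1.1 z.2) ^+ K * G (- correlate w (cons_row z.1.1 z.2) (cons_row z.1.2 v)) ^+ K)%:E)); last first.
    by move=> z u; rewrite lee_fin mulr_ge0 ?exprn_ge0.
  by apply: (@measurable_fun2 _ _ _ _ _ _ _ _ (fun u v => (F u ^+ K * G (- correlate w u v) ^+ K)%:E)) => //;
    apply: measurable_cons_row => //; do ?apply: measurableT_comp => //; do ?apply: measurableT_comp.
apply: ge0_le_integral => //.
- by move=> x _; apply: integral_ge0.
- apply: (@measurable_integral2 _ _ R N _ _ (fun x y =>
   (bar F x ^+ K * bar G (- (w * x + Num.sqrt (1 - w ^+ 2) * y)) ^+ K)%:E)) => //.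
- apply: (@measurable_integral2 _ _ R N _ _ (fun x y => \int[g n]_u \int[g n]_v
   (F (cons_row x u) ^+ K * G (- correlate w (cons_row x u) (cons_row y v)) ^+ K)%:E)) => //.
  by move=> x y; apply: integral_ge0 => u _; apply: integral_ge0 => v _; rewrite lee_fin mulr_ge0 ?exprn_ge0.
move=> x _; apply: ge0_le_integral => //.
- exact: (measurableT_comp mr (pair1_measurable x)).
- exact: (measurableT_comp mfull (pair1_measurable x)).
move=> y _; rewrite -exprMn.
set z := (- _)%R; apply: le_trans (IH (fun u => F (cons_row x u)) (fun u => G (cons_row z u)) (mFc x) (mGc z) _ _ wE) _ => //.
rewrite le_eqVlt; apply/orP; left; apply/eqP.
apply: eq_integral => u _; apply: eq_integral => v _.
by rewrite /correlate cons_rowD cons_rowN.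
Qed.

End gauss_facts.

(** * Bounded measurable functions and their expectations *)

Section bounded_measurable.
Context d (X : measurableType d) {R : realType}.
Implicit Types f h : X -> R.

(** An algebra of functions on which the real-valued integral against a probability is linear and
    monotone, so that most arguments below stay clear of extended reals. *)
Definition bm f := measurable_fun [set: X] f /\ exists M, forall x, `|f x| <= M.

Lemma bm_measurable f : bm f -> measurable_fun setT f. Proof. by case. Qed.

Lemma bm_cst c : bm (fun=> c).
Proof. by split; [exact: measurable_cst|exists `|c|]. Qed.

Lemma bmD f h : bm f -> bm h -> bm (fun x => f x + h x).
Proof.
move=> [mf [M fM]] [mh [M' hM']]; split; first exact: measurable_funD.
by exists (M + M') => x; rewrite (le_trans (ler_normD _ _))// lerD.
Qed.

Lemma bmM f h : bm f -> bm h -> bm (fun x => f x * h x).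
Proof.
move=> [mf [M fM]] [mh [M' hM']]; split; first exact: measurable_funM.
by exists (M * M') => x; rewrite normrM ler_pM.
Qed.

Lemma bmZ c f : bm f -> bm (fun x => c * f x).
Proof. by move=> bf; apply: bmM => //; exact: bm_cst. Qed.

Lemma bmN f : bm f -> bm (fun x => - f x).
Proof.
move=> [mf [M fM]]; split; first exact: measurableT_comp.
by exists M => x; rewrite normrN.
Qed.

Lemma bmB f h : bm f -> bm h -> bm (fun x => f x - h x).
Proof. by move=> bf bh; apply: bmD => //; exact: bmN. Qed.

Lemma bm_sum (I : Type) (s : seq I) (P : pred I) (F : I -> X -> R) :
  (forall i, bm (F i)) -> bm (fun x => \sum_(i <- s | P i) F i x).
Proof.
move=> bF; elim: s => [|i s IH].
  by under eq_fun do rewrite big_nil; exact: bm_cst.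
under eq_fun do rewrite big_cons.
by case: (P i) => //; exact: bmD.
Qed.

Lemma bm_ge0 f M : measurable_fun setT f -> (forall x, 0 <= f x <= M) -> bm f.
Proof.
move=> mf fM; split => //; exists M => x.
by case/andP: (fM x) => f0 f1; rewrite ger0_norm.
Qed.

Lemma bm_comp d' (Y : measurableType d') (f : X -> R) (k : Y -> X) :
  bm f -> measurable_fun setT k ->
  (measurable_fun setT (fun y => f (k y)) /\ exists M, forall y, `|f (k y)| <= M).
Proof.
move=> [mf [M fM]] mk; split; first exact: (measurableT_comp mf mk).
by exists M.
Qed.

End bounded_measurable.

Section expectation.
Context d (X : measurableType d) {R : realType} (P : probability X R).
Implicit Types f h : X -> R.
Local Notation E f := (\int[P]_x f x)%R.

Lemma bm_integrable f : bm f -> P.-integrable setT (EFin \o f).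
Proof.
move=> [mf [M fM]]; apply: measurable_bounded_integrable => //.
- by rewrite (le_lt_trans (probability_le1 _ _))// ltry.
- exists M; split; first exact: num_real.
  by move=> M' MM' x _ /=; exact: le_trans (fM x) (ltW MM').
Qed.

Lemma EFin_E f : bm f -> (\int[P]_x (f x)%:E)%E = (E f)%:E.
Proof. by move=> /bm_integrable i; rewrite /Rintegral fineK//; exact: integrable_fin_num. Qed.

Lemma E_cst c : E (fun=> c) = c.
Proof. by rewrite /Rintegral (integral_prob_cst P c%:E). Qed.

Lemma E_D f h : bm f -> bm h -> E (fun x => f x + h x) = E f + E h.
Proof. by move=> /bm_integrable i /bm_integrable j; exact: (RintegralD measurableT i j). Qed.

Lemma E_B f h : bm f -> bm h -> E (fun x => f x - h x) = E f - E h.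
Proof. by move=> /bm_integrable i /bm_integrable j; exact: (RintegralB measurableT i j). Qed.

Lemma E_Z c f : bm f -> E (fun x => c * f x) = c * E f.
Proof. by move=> /bm_integrable i; exact: (RintegralZl c measurableT i). Qed.

Lemma E_N f : bm f -> E (fun x => - f x) = - E f.
Proof.
move=> bf; rewrite -[RHS]mulN1r -E_Z//.
by apply: eq_Rintegral => x _; rewrite mulN1r.
Qed.

Lemma E_sum (I : Type) (s : seq I) (Q : pred I) (F : I -> X -> R) : (forall i, bm (F i)) ->
  E (fun x => \sum_(i <- s | Q i) F i x) = \sum_(i <- s | Q i) E (F i).
Proof.
move=> bF; elim: s => [|i s IH].
  by rewrite big_nil -[RHS](E_cst 0); apply: eq_Rintegral => x _; rewrite big_nil.
rewrite big_cons -IH; case: ifPn => Qi.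
  rewrite -E_D//; last exact: bm_sum.
  by apply: eq_Rintegral => x _; rewrite big_cons Qi.
by apply: eq_Rintegral => x _; rewrite big_cons (negbTE Qi).
Qed.

Lemma E_le f h : bm f -> bm h -> (forall x, f x <= h x) -> E f <= E h.
Proof. by move=> /bm_integrable i /bm_integrable j fh; apply: le_Rintegral. Qed.

Lemma E_ge0 f : (forall x, 0 <= f x) -> 0 <= E f.
Proof. by move=> f0; apply: Rintegral_ge0. Qed.

Lemma E_eq f h : (forall x, f x = h x) -> E f = E h.
Proof. by move=> fh; apply: eq_Rintegral => x _. Qed.

Lemma E_bound f M : bm f -> (forall x, `|f x| <= M) -> `|E f| <= M.
Proof.
move=> bf fM; have fl x : - M <= f x <= M by rewrite -ler_norml.
rewrite ler_norml; apply/andP; split.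
- by rewrite -[leLHS]E_cst; apply: E_le => // [|x]; [exact: bm_cst|case/andP: (fl x)].
- by rewrite -[leRHS]E_cst; apply: E_le => // [|x]; [exact: bm_cst|case/andP: (fl x)].
Qed.

End expectation.

Section double_expectation.
Context d1 d2 (X : measurableType d1) (Y : measurableType d2) {R : realType}
  (P : probability X R) (Q : probability Y R).
Implicit Types f : X -> Y -> R.

Let shift f M : (forall x y, `|f x y| <= M) -> forall x y, 0 <= f x y + M <= M + M.
Proof.
move=> fM x y; rewrite lerD2r -lerBlDr sub0r.
by have := fM x y; rewrite ler_norml.
Qed.

Lemma bm_section f x : bm (fun xy : X * Y => f xy.1 xy.2) -> bm (f x).
Proof.
move=> [mf [M fM]]; split; first exact: (measurableT_comp mf (pair1_measurable x)).
by exists M => y; exact: (fM (x, y)).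
Qed.

Lemma bm_E f : bm (fun xy : X * Y => f xy.1 xy.2) -> bm (fun x => \int[Q]_y f x y)%R.
Proof.
move=> bf; have [mf [M fM]] := bf.
have fM' x y : `|f x y| <= M by exact: (fM (x, y)).
split; last by exists M => x; apply: E_bound; [exact: bm_section|exact: fM'].
(* Adding the bound [M] makes the integrand nonnegative, as Tonelli's theorem requires. *)
have -> : (fun x => \int[Q]_y f x y)%R = fun x => fine (\int[Q]_y (f x y + M)%:E)%E - M.
  apply/funext => x; rewrite EFin_E; last by apply: bmD; [exact: bm_section|exact: bm_cst].
  by rewrite /= E_D ?E_cst ?addrK//; [exact: bm_section|exact: bm_cst].
apply: measurable_funB => //; apply: measurableT_comp => //.
apply: (@measurable_integral2 _ _ R Q _ _ (fun x y => (f x y + M)%:E)).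
  by apply/measurable_EFinP; apply: measurable_funD.
by move=> x y; rewrite lee_fin; case/andP: (shift fM' x y).
Qed.

Lemma integral2_E f : bm (fun xy : X * Y => f xy.1 xy.2) ->
  (\int[P]_x \int[Q]_y (f x y)%:E)%E = ((\int[P]_x \int[Q]_y f x y)%R)%:E.
Proof.
move=> bf; rewrite -EFin_E; last exact: bm_E.
by apply: eq_integral => x _; rewrite EFin_E//; exact: bm_section.
Qed.

End double_expectation.

(** * The Gaussian noise operator *)

Section noise_operator.
Context {R : realType} (d : nat).
Local Notation U := 'rV[R]_d.
Local Notation g := (@gauss R d).
Local Notation E f := (\int[g]_u f u)%R.
Implicit Types (f h : U -> R) (w : R) (u v : U).

(** Mehler's formula for the Ornstein-Uhlenbeck semigroup, parametrized by the correlation [w]. *)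
Definition noise w f u : R := \int[g]_v f (correlate w u v).

Lemma bm_correlate w f : bm f -> bm (fun uv : U * U => f (correlate w uv.1 uv.2)).
Proof. by move=> bf; apply: (bm_comp bf); exact: measurable_correlate. Qed.

Lemma bm_correlate1 w f u : bm f -> bm (fun v => f (correlate w u v)).
Proof. by move=> bf; apply: (@bm_section _ _ _ _ _ (fun u v => f (correlate w u v))); exact: bm_correlate. Qed.

Lemma bm_noise w f : bm f -> bm (noise w f).
Proof. by move=> bf; apply: (bm_E g); exact: bm_correlate. Qed.

Lemma bm_opp f : bm f -> bm (fun u => f (- u)).
Proof. by move=> bf; apply: (bm_comp bf); exact: measurable_rV_opp. Qed.

Lemma noise_ge0 w f u : (forall v, 0 <= f v) -> 0 <= noise w f u.
Proof. by move=> f0; apply: E_ge0. Qed.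

Lemma noise_le w f h u : bm f -> bm h -> (forall v, f v <= h v) -> noise w f u <= noise w h u.
Proof. by move=> bf bh fh; apply: E_le => //; exact: bm_correlate1. Qed.

Lemma noise_cst w c u : noise w (fun=> c) u = c.
Proof. exact: E_cst. Qed.

Lemma noiseD w f h u : bm f -> bm h -> noise w (fun v => f v + h v) u = noise w f u + noise w h u.
Proof.
move=> bf bh; exact: (E_D g (bm_correlate1 w u bf) (bm_correlate1 w u bh)).
Qed.

Lemma noiseZ w c f u : bm f -> noise w (fun v => c * f v) u = c * noise w f u.
Proof. by move=> bf; exact: (E_Z g c (bm_correlate1 w u bf)). Qed.

Lemma noise_sum (I : Type) (s : seq I) (Q : pred I) (F : I -> U -> R) w u : (forall i, bm (F i)) ->
  noise w (fun v => \sum_(i <- s | Q i) F i v) u = \sum_(i <- s | Q i) noise w (F i) u.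
Proof. by move=> bF; exact: (E_sum g s Q (fun i => bm_correlate1 w u (bF i))). Qed.

Lemma gauss_opp f : bm f -> (forall u, 0 <= f u) -> E (fun u => f (- u)) = E f.
Proof.
move=> bf f0.
have ab : ((-1) ^+ 2 + 0 ^+ 2 = 1 :> R) by rewrite sqrrN expr1n expr0n addr0.
have := @gauss_reflect R d (-1) 0 (fun u _ => (f u)%:E) ab.
have mf : measurable_fun setT (fun xy : U * U => (f xy.1)%:E).
  apply/measurable_EFinP; apply: (measurableT_comp _ measurable_fst).
  exact: bm_measurable bf.
move=> /(_ mf); have f0' : forall u v : U, (0 <= (f u)%:E)%E by move=> u v; rewrite lee_fin.
move=> /(_ f0').
rewrite /Rintegral => h; congr fine.
transitivity (\int[g]_u \int[g]_v (f u)%:E)%E; last first.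
  by apply: eq_integral => u _; exact: integral_prob_cst.
rewrite -h; apply: eq_integral => u _.
transitivity (\int[g]_v (f (- u)%R)%:E)%E; first by rewrite integral_prob_cst.
by apply: eq_integral => v _; rewrite scaleN1r scale0r addr0.
Qed.

Lemma noise_opp w f u : bm f -> (forall v, 0 <= f v) ->
  noise w (fun v => f (- v)) u = noise w f (- u).
Proof.
move=> bf f0; rewrite /noise.
rewrite -[RHS](@gauss_opp (fun v => f (correlate w (- u) v))) => [||v]//; last exact: bm_correlate1.
by apply: E_eq => v; rewrite /correlate !scalerN opprD.
Qed.

Section adjoint.
Variable w : R.
Hypothesis w1 : 0 <= w <= 1.

Let wb : w ^+ 2 + Num.sqrt (1 - w ^+ 2) ^+ 2 = 1.
Proof.
case/andP: w1 => w0 wl; rewrite sqr_sqrtr ?subrKC// subr_ge0 expr_le1//.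
Qed.

(** Self-adjointness: the reflection with coefficients [w] and [sqrt (1 - w^2)] swaps [u] and
    [correlate w u v]. *)
Lemma noise_adjoint f h : bm f -> bm h -> (forall u, 0 <= f u) -> (forall u, 0 <= h u) ->
  E (fun u => f u * noise w h u) = E (fun u => noise w f u * h u).
Proof.
move=> bf bh f0 h0.
have b1 : bm (fun uv : U * U => f uv.1 * h uv.2).
  by apply: bmM; [apply: (bm_comp bf)|apply: (bm_comp bh)].
have b2 : bm (fun uv : U * U => f uv.1 * h (correlate w uv.1 uv.2)).
  by apply: bmM; [apply: (bm_comp bf)|apply: bm_correlate].
have b3 : bm (fun uv : U * U => f (correlate w uv.1 uv.2) * h uv.1).
  by apply: bmM; [apply: bm_correlate|apply: (bm_comp bh)].
have L k1 k2 : bm k1 -> bm k2 -> E (fun u => k1 u * noise w k2 u) =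
     (\int[g]_u \int[g]_v (k1 u * k2 (correlate w u v)))%R.
  by move=> bk1 bk2; apply: E_eq => u; rewrite -E_Z//; exact: bm_correlate1.
rewrite L//.
transitivity (\int[g]_u \int[g]_v (f (correlate w u v) * h u))%R; last first.
  apply: E_eq => u; rewrite [RHS]mulrC -E_Z; last exact: bm_correlate1.
  by apply: E_eq => v; rewrite mulrC.
apply: EFin_inj; rewrite -!(@integral2_E _ _ _ _ _ _ _ (fun u v => _))//.
have m2 : measurable_fun setT (fun uv : U * U => (f uv.1 * h (correlate w uv.1 uv.2))%:E).
  by apply/measurable_EFinP; case: b2.
rewrite -(@gauss_reflect R d _ _ (fun u v => (f u * h (correlate w u v))%:E) wb m2); last first.
  by move=> u v; rewrite lee_fin mulr_ge0.
apply: eq_integral => u _; apply: eq_integral => v _; rewrite /correlate.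
congr (f _ * h _)%:E.
move: wb; set b := Num.sqrt _ => ab; apply/rowP => i; rewrite !mxE -[RHS]mul1r -ab; ring.
Qed.

Lemma E_noise f : bm f -> (forall u, 0 <= f u) -> E (noise w f) = E f.
Proof.
move=> bf f0; transitivity (E (fun u => 1 * noise w f u)).
  by apply: E_eq => u; rewrite mul1r.
rewrite (@noise_adjoint (fun=> 1))//; last exact: bm_cst.
by apply: E_eq => u; rewrite noise_cst mul1r.
Qed.

End adjoint.

(** Semigroup law: the two independent noises add up to one Gaussian of scale [B], by a reflection
    whose coefficients are their relative weights. *)
Lemma correlate_comp r w u (k : U -> \bar R) : 0 <= w <= 1 -> 0 <= r <= 1 ->
  measurable_fun setT k -> (forall v, (0 <= k v)%E) ->
  (\int[g]_v \int[g]_v' k (correlate r (correlate w u v) v') =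
   \int[g]_v k (correlate (r * w) u v))%E.
Proof.
move=> w1 r1 mk k0.
have sq1 (x : R) : 0 <= x <= 1 -> 0 <= 1 - x ^+ 2.
  by case/andP=> x0 xl; rewrite subr_ge0 expr_le1.
have rw1 : 0 <= r * w <= 1.
  by case/andP: w1 => w0 wl; case/andP: r1 => r0 rl; rewrite mulr_ge0//= mulr_ile1.
move: (sqr_sqrtr (sq1 _ w1)) (sqr_sqrtr (sq1 _ r1)) (sqr_sqrtr (sq1 _ rw1)).
rewrite /correlate.
set bw := Num.sqrt (1 - w ^+ 2); set br := Num.sqrt (1 - r ^+ 2).
set B := Num.sqrt (1 - (r * w) ^+ 2) => bw2 br2 B2.
have lin v v' : r *: (w *: u + bw *: v) + br *: v' = (r * w) *: u + (r * bw *: v + br *: v').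
  by apply/rowP => i; rewrite !mxE; ring.
(* When [B = 0] both noise coefficients vanish, and there is nothing to normalize. *)
have [B0|B0] := eqVneq B 0.
  have BB : (r * bw) ^+ 2 + br ^+ 2 = 0.
    have -> : (r * bw) ^+ 2 + br ^+ 2 = B ^+ 2 by rewrite exprMn bw2 br2 B2; ring.
    by rewrite B0 expr0n.
  have rbw : r * bw = 0.
    by apply/eqP; rewrite -sqrf_eq0 eq_le sqr_ge0 andbT -BB lerDl sqr_ge0.
  have br0 : br = 0.
    by apply/eqP; rewrite -sqrf_eq0 eq_le sqr_ge0 andbT -BB lerDr sqr_ge0.
  apply: eq_integral => v _; transitivity (\int[g]_v' k ((r * w) *: u))%E.
    by apply: eq_integral => v' _; rewrite lin rbw br0 !scale0r !addr0.
  by rewrite integral_prob_cst B0 scale0r addr0.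
have ab : (r * bw / B) ^+ 2 + (br / B) ^+ 2 = 1.
  rewrite !expr_div_n -mulrDl exprMn bw2 br2 B2.
  have B20 : B ^+ 2 != 0 by rewrite sqrf_eq0.
  by rewrite B2 in B20; rewrite -[RHS](mulfV B20); congr (_ / _); ring.
have mk1 : measurable_fun setT (fun v => k ((r * w) *: u + B *: v)%R).
  by apply: (measurableT_comp mk); apply: measurable_rV_lin.
have mk2 : measurable_fun setT (fun xy : U * U => k ((r * w) *: u + B *: xy.1)%R).
  exact: (measurableT_comp mk1 measurable_fst).
transitivity (\int[g]_v \int[g]_v' k ((r * w) *: u + B *: v)%R)%E; last first.
  by apply: eq_integral => v _; rewrite integral_prob_cst.
have k20 (v v' : U) : (0 <= k ((r * w) *: u + B *: v)%R)%E by [].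
have refl := gauss_reflect ab mk2 k20.
transitivity (\int[g]_v \int[g]_v' k ((r * w) *: u + B *: ((r * bw / B) *: v + (br / B) *: v'))%R)%E;
  last exact: refl.
apply: eq_integral => v _; apply: eq_integral => v' _; rewrite lin; congr k; congr (_ + _).
by rewrite scalerDr !scalerA ![B * _]mulrC !divfK.
Qed.

End noise_operator.

(** * Entropy form of reverse hypercontractivity *)

Section log_rh.
Context {R : realType}.

Lemma xlnx_bound (x : R) : 0 <= x <= 1 -> -1 <= x * ln x <= 0.
Proof.
move=> /andP[x0 x1]; have [->|xn0] := eqVneq x 0; first by rewrite mul0r lexx oppr_le0 ler01.
have xp : 0 < x by rewrite lt_neqAle eq_sym xn0.
apply/andP; split; last by rewrite mulr_ge0_le0// ln_le0.
have := ln_le_subr1 (_ : 0 < x^-1); rewrite invr_gt0 lnV ?posrE// => /(_ xp) h.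
have : x * - ln x <= x * (x^-1 - 1) by rewrite ler_wpM2l.
by rewrite mulrBr mulfV ?gt_eqF//; move: x0 x1; clear; lra.
Qed.

Context d (X : measurableType d) (P : probability X R).
Local Notation E f := (\int[P]_u f u)%R.

(** Nonnegativity of the relative entropy of [e / E e] with respect to [f / E f], from
    [ln t <= t - 1] at [t = f E e / (e E f)]. *)
Lemma gibbs (e f : X -> R) : bm e -> bm f -> (forall x, 0 <= e x) -> (forall x, 0 <= f x) ->
  (forall x, 0 < e x -> 0 < f x) -> bm (fun x => e x * ln (e x)) -> bm (fun x => e x * ln (f x)) ->
  0 < E e -> 0 < E f ->
  E (fun x => e x * ln (f x)) <=
  E (fun x => e x * ln (e x)) - E e * ln (E e) + E e * ln (E f).
Proof.
move=> be bf e0 f0 ef bel befl; move Ea : (E e) => a; move Ec : (E f) => c a0 c0.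
have pt x : e x * ln (f x) - e x * ln (e x) <= (ln c - ln a - 1) * e x + a / c * f x.
  have [->|en0] := eqVneq (e x) 0.
    by rewrite !mul0r subrr mulr0 add0r mulr_ge0// divr_ge0// ltW.
  have ep : 0 < e x by rewrite lt_neqAle eq_sym en0 e0.
  have fp := ef _ ep.
  have := ln_le_subr1 (_ : 0 < f x * a / (e x * c)).
  rewrite divr_gt0 ?mulr_gt0// => /(_ isT).
  rewrite ln_div ?posrE ?mulr_gt0// !lnM ?posrE// => h.
  have := ler_wpM2l (ltW ep) h.
  have -> : e x * (f x * a / (e x * c) - 1) = a / c * f x - e x by field; rewrite !gt_eqF.
  by lra.
have b1 := bmZ (ln c - ln a - 1) be; have b2 := bmZ (a / c) bf.
have := E_le P (bmB befl bel) (bmD b1 b2) pt.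
rewrite E_B// E_D// !E_Z// Ea Ec divfK ?gt_eqF//; lra.
Qed.

End log_rh.

Section log_rh.
Context {R : realType} (d : nat).
Local Notation U := 'rV[R]_d.
Local Notation g := (@gauss R d).
Local Notation E f := (\int[g]_u f u)%R.

Lemma measurable_lnf d' (X : measurableType d') (f : X -> R) : measurable_fun setT f ->
  measurable_fun setT (fun x => ln (f x)).
Proof. by move=> mf; apply: measurableT_comp => //; exact: measurable_ln. Qed.

Lemma measurable_expRf d' (X : measurableType d') (f : X -> R) : measurable_fun setT f ->
  measurable_fun setT (fun x => expR (f x)).
Proof. by move=> mf; apply: measurableT_comp. Qed.

(** Where [f] is small so is [e], and [x ln x] stays bounded near 0; this keeps the logarithms below
    integrable although [f] may vanish. *)
Lemma bm_eln d' (X : measurableType d') (e f : X -> R) (eps M : R) : 0 < eps -> bm e -> measurable_fun setT f ->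
  (forall x, 0 <= e x <= 1) -> (forall x, eps * e x <= f x <= M) ->
  bm (fun x => e x * ln (f x)).
Proof.
move=> eps0 [me _] mf eb fb; split.
  by apply: measurable_funM => //; exact: measurable_lnf.
exists (`|ln eps| + 1 + `|ln (Num.max 1 M)|) => x.
have := eb x => /andP[e0 e1]; have [->|en0] := eqVneq (e x) 0.
  by rewrite mul0r normr0 !addr_ge0.
have ep : 0 < e x by rewrite lt_neqAle eq_sym en0.
case/andP: (fb x) => fl fu; have fp : 0 < f x by apply: lt_le_trans fl; rewrite mulr_gt0.
have lo : ln eps + ln (e x) <= ln (f x).
  by rewrite -lnM ?posrE// ler_ln ?posrE// mulr_gt0.
have up : ln (f x) <= ln (Num.max 1 M).
  have m1 : 0 < Num.max 1 M by rewrite lt_max ltr01.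
  by rewrite ler_ln ?posrE// le_max fu orbT.
have := xlnx_bound (eb x) => /andP[x1 x2].
have h1 : e x * (ln eps + ln (e x)) <= e x * ln (f x) by rewrite ler_wpM2l.
have h2 : e x * ln (f x) <= e x * ln (Num.max 1 M) by rewrite ler_wpM2l.
have h3 : `|e x * ln eps| <= `|ln eps| by rewrite normrM ger0_norm// ler_piMl.
have h4 : `|e x * ln (Num.max 1 M)| <= `|ln (Num.max 1 M)| by rewrite normrM ger0_norm// ler_piMl.
move: h3 h4; rewrite !ler_norml => /andP[h3 _] /andP[_ h4].
have n1 := normr_ge0 (ln eps); have n2 := normr_ge0 (ln (Num.max 1 M)).
rewrite mulrDr in h1; apply/andP; split; move: h1 h2 h3 h4 n1 n2 x1 x2; clear; lra.
Qed.

Lemma bm_xlnx d' (X : measurableType d') (e : X -> R) : bm e -> (forall x, 0 <= e x <= 1) ->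
  bm (fun x => e x * ln (e x)).
Proof.
move=> be eb; apply: (@bm_eln _ _ e e 1 1) => //; first by case: be.
by move=> x; rewrite mul1r lexx; case/andP: (eb x).
Qed.

Lemma E_eq0 d' (X : measurableType d') (P : probability X R) (e f : X -> R) : bm e -> bm (fun x => e x * f x) ->
  (forall x, 0 <= e x) -> (\int[P]_x e x = 0)%R -> (\int[P]_x (e x * f x) = 0)%R.
Proof.
move=> be bef e0 Ee.
have ae0 : ae_eq P setT (EFin \o e) (cst 0%E).
  apply/ae_eq_integral_abs => //; first by apply/measurable_EFinP; case: be.
  rewrite -[RHS](_ : (\int[P]_x e x)%R%:E = 0%E); last by rewrite Ee.
  by rewrite -EFin_E//; apply: eq_integral => x _; rewrite gee0_abs ?lee_fin.
rewrite /Rintegral (_ : (\int[P]_x (e x * f x)%:E = 0)%E)//.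
transitivity (\int[P]_x (cst 0 x))%E; last by rewrite integral_cst// mul0e.
apply: ae_eq_integral => //; first by apply/measurable_EFinP; case: bef.
apply: filterS ae0 => x /= h _; have := h Logic.I => /= -[->].
by rewrite mul0r.
Qed.

(** Apply [gauss_rh] to [F = W^(-1/(K-1))] and [G = f^(1/K)], where [W] is the noised [f] at [- u]
    plus [eps]. Since [F^K W = F], it yields [(E F E G)^K <= E F]. Taking logarithms and estimating
    the [e]-means of [ln F] and [ln G] by [gibbs], with weights [K - 1] and [K], produces the factor
    [2K - 1]. *)
Lemma log_rh (K : nat) (w eps : R) (e f : U -> R) : (1 < K)%N -> w = 1 - K%:R^-1 ->
  bm e -> bm f -> (forall u, 0 <= e u <= 1) -> 0 < eps <= 1 -> (forall u, eps * e u <= f u) ->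
  E (fun u => e u * ln (f u)) - E (fun u => e u * ln (noise w f (- u) + eps)) <=
  (2 * K%:R - 1) * (E (fun u => e u * ln (e u)) - E e * ln (E e)).
Proof.
move=> K1 wE be bf eb /andP[eps0 eps1] ef.
have K0 : (0 < K)%N by exact: ltn_trans K1.
have e0 u : 0 <= e u by case/andP: (eb u).
have f0 u : 0 <= f u by apply: le_trans (ef u); rewrite mulr_ge0// ltW.
have [mf [M fM]] := bf; have {}fM u : f u <= M by apply: le_trans (ler_norm _) (fM u).
pose W u := noise w f (- u) + eps.
have W0 u : eps <= W u by rewrite lerDr noise_ge0.
have bW : bm W by apply: bmD; [apply: bm_opp; exact: bm_noise|exact: bm_cst].
have WM u : W u <= M + eps.
  rewrite lerD2r -[leRHS](noise_cst w M (- u)); apply: noise_le => //; exact: bm_cst.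
have Wp u : 0 < W u by exact: lt_le_trans (W0 u).
have bl1 : bm (fun u => e u * ln (f u)).
  by apply: (@bm_eln _ _ e f eps M) => // u; rewrite ef fM.
have bl2 : bm (fun u => e u * ln (W u)).
  apply: (@bm_eln _ _ e W eps (M + eps)) => //; first by case: bW.
  move=> u; rewrite WM andbT; apply: le_trans (W0 u).
  by rewrite ler_piMr ?(ltW eps0)//; case/andP: (eb u).
have bl3 := bm_xlnx be eb.
have [Ee0|Een0] := eqVneq (E e) 0.
  by rewrite !(E_eq0 be)// Ee0 mul0r !subrr mulr0.
have Ee : 0 < E e by rewrite lt_neqAle eq_sym Een0 E_ge0.
pose q : R := K%:R - 1.
have q0 : 0 < q by rewrite subr_gt0 ltr1n.
pose F u := expR (- (ln (W u) / q)); pose G u := f u `^ K%:R^-1.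
have KR : 0 < K%:R :> R by rewrite ltr0n.
have lW u : ln eps <= ln (W u) by rewrite ler_ln ?posrE.
have F0 u : 0 < F u by exact: expR_gt0.
have FM u : F u <= expR (- (ln eps / q)).
  by rewrite ler_expR lerN2 ler_wpM2r// invr_ge0 ltW.
have G0 u : 0 <= G u by exact: powR_ge0.
have GM u : G u <= M `^ K%:R^-1.
  by rewrite ge0_ler_powR ?nnegrE ?invr_ge0 ?(ltW KR)// (le_trans (f0 u)).
have mF : measurable_fun setT F.
  apply: measurable_expRf; apply: measurableT_comp => //; apply: measurable_funM => //.
  by apply: measurable_lnf; case: bW.
have mG : measurable_fun setT G by exact: (measurableT_comp (measurable_powR _) mf).
have bF : bm F by apply: (@bm_ge0 _ _ _ _ (expR (- (ln eps / q)))) => // u; rewrite FM ltW.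
have bG : bm G by apply: (@bm_ge0 _ _ _ _ (M `^ K%:R^-1)) => // u; rewrite GM G0.
pose M2 := Num.max (expR (- (ln eps / q))) (M `^ K%:R^-1).
have RH := @gauss_rh R d K F G M2 w K0 mF mG _ _ wE.
have {RH} RH : (E F * E G) ^+ K <= E F.
  rewrite -lee_fin; apply: (le_trans (RH _ _)).
  - by move=> u; rewrite ltW//= le_max FM.
  - by move=> u; rewrite G0//= le_max GM orbT.
  rewrite -EFin_E//.
  have bc u : bm (fun v => f (- correlate w u v)) by exact: (bm_correlate1 w u (bm_opp bf)).
  have GK v : G v ^+ K = f v.
    by rewrite -powR_mulrn ?powR_ge0// -powRrM mulVf ?gt_eqF// powRr1.
  have bcc : bm (fun uv : U * U => F uv.1 ^+ K * f (- correlate w uv.1 uv.2)).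
    apply: bmM; last by have := bm_correlate w (bm_opp bf).
    apply: (@bm_ge0 _ _ _ _ (expR (- (ln eps / q)) ^+ K)).
      by apply: measurable_funX; apply: (measurableT_comp mF).
    by move=> u; rewrite exprn_ge0 ?(ltW (F0 _))//= lerXn2r ?nnegrE ?expR_ge0.
  have inner u : (\int[g]_v (F u ^+ K * G (- correlate w u v) ^+ K)%:E = (F u ^+ K * noise w f (- u))%:E)%E.
    transitivity (\int[g]_v (F u ^+ K * f (- correlate w u v))%:E)%E.
      by apply: eq_integral => v _; rewrite GK.
    rewrite EFin_E; last exact: bmZ.
    rewrite E_Z//; congr ((_ * _)%:E).
    exact: (noise_opp w u bf f0).
  under eq_integral do rewrite inner.
  apply: ge0_le_integral => //.
  - by move=> u _; rewrite lee_fin mulr_ge0 ?exprn_ge0 ?noise_ge0// ltW.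
  - apply/measurable_EFinP; apply: measurable_funM; first exact: measurable_funX.
    by case: (bm_opp (bm_noise w bf)).
  - exact/measurable_EFinP.
  move=> u _; rewrite lee_fin.
  (* This identity dictates the exponent [-1/(K-1)] in [F]. *)
  have FE : F u = F u ^+ K * W u.
    rewrite -[W u in RHS]lnK ?posrE// /F -expRM_natl -expRD; congr expR.
    by rewrite /q; field; rewrite -/q gt_eqF.
  by rewrite [leRHS]FE ler_wpM2l ?exprn_ge0 ?(ltW (F0 _))// lerDl ltW.
have EF : 0 < E F.
  apply: (@lt_le_trans _ _ (expR (- (ln (M + eps) / q)))); first exact: expR_gt0.
  rewrite -[leLHS](E_cst g); apply: E_le => //; first exact: bm_cst.
  move=> u; rewrite ler_expR lerN2 ler_wpM2r ?invr_ge0 ?(ltW q0)// ler_ln ?posrE//.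
  exact: lt_le_trans (Wp u) (WM u).
have EG : 0 < E G.
  apply: (@lt_le_trans _ _ (eps * E e)); first by rewrite mulr_gt0.
  rewrite -E_Z//; apply: E_le => //; first exact: bmZ.
  move=> u; apply: (@le_trans _ _ ((eps * e u) `^ K%:R^-1)); last first.
    by rewrite ge0_ler_powR ?nnegrE ?invr_ge0 ?(ltW KR)// mulr_ge0// ltW.
  have x0 : 0 <= eps * e u by rewrite mulr_ge0// ltW.
  have x1 : eps * e u <= 1 by rewrite mulr_ile1// ?(ltW eps0)//; case/andP: (eb u).
  have [->|xn0] := eqVneq (eps * e u) 0; first exact: powR_ge0.
  rewrite -[leLHS]powRr1//; apply: ger_powR; last by rewrite invf_le1// ler1n.
  by rewrite x1 andbT lt_neqAle eq_sym xn0.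
have lnRH : q * ln (E F) + K%:R * ln (E G) <= 0.
  have : ln ((E F * E G) ^+ K) <= ln (E F) by rewrite ler_ln ?posrE// exprn_gt0// mulr_gt0.
  rewrite -powR_mulrn ?mulr_ge0 ?(ltW EF) ?(ltW EG)// ln_powR lnM ?posrE// /q; lra.
have lnF u : ln (F u) = - q^-1 * ln (W u) by rewrite expRK mulNr mulrC.
have lnG u : ln (G u) = K%:R^-1 * ln (f u) by rewrite ln_powR.
have bFl : bm (fun u => e u * ln (F u)).
  by under eq_fun do rewrite lnF mulrCA; exact: bmZ.
have bGl : bm (fun u => e u * ln (G u)).
  by under eq_fun do rewrite lnG mulrCA; exact: bmZ.
have g1 := gibbs be bF e0 (fun u => ltW (F0 u)) (fun u _ => F0 u) bl3 bFl Ee EF.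
have eG u : 0 < e u -> 0 < G u.
  by move=> eu; apply: powR_gt0; apply: lt_le_trans (ef u); rewrite mulr_gt0.
have g2 := gibbs be bG e0 G0 eG bl3 bGl Ee EG.
have E1 : E (fun u => e u * ln (F u)) = - q^-1 * E (fun u => e u * ln (W u)).
  by rewrite -E_Z//; apply: E_eq => u; rewrite lnF mulrCA.
have E2 : E (fun u => e u * ln (G u)) = K%:R^-1 * E (fun u => e u * ln (f u)).
  by rewrite -E_Z//; apply: E_eq => u; rewrite lnG mulrCA.
move: g1 g2; rewrite E1 E2 -/W.
move: (E (fun u => e u * ln (W u))) (E (fun u => e u * ln (f u))) => w1 f1.
move: (E (fun u => _)) (E e) (ln (E e)) Ee lnRH => D a la a0.
move: (ln (E F)) (ln (E G)) => lF lG lnRH.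
move=> /(ler_wpM2l (ltW q0)) + /(ler_wpM2l (ltW KR)).
rewrite mulrA mulrN mulfV ?gt_eqF// mulrA mulfV ?gt_eqF//.
move=> h1 h2; have := ler_wpM2l (ltW a0) lnRH.
by move: h1 h2; rewrite /q; clear; lra.
Qed.

End log_rh.

(** * Lower bound on the number of walks *)

Section chain_count.
Context {R : realType} (d : nat) (X : finType).
Local Notation U := 'rV[R]_d.
Local Notation g := (@gauss R d).
Local Notation E f := (\int[g]_u f u)%R.
Variables (N : X -> X -> U -> R) (K : nat) (w : R).
Hypotheses (bN : forall x y, bm (N x y)) (N0 : forall x y u, 0 <= N x y u)
  (N1 : forall x u, \sum_y N x y u <= 1) (Nskew : forall x y u, N x y u = N y x (- u))
  (K1 : (1 < K)%N) (wE : w = 1 - K%:R^-1).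

Lemma E_opp (f : U -> R) : bm f -> E (fun u => f (- u)) = E f.
Proof.
move=> bf; have [mf [M fM]] := bf.
have bfM := bmD bf (@bm_cst _ U _ M).
have f0 u : 0 <= f u + M by rewrite -lerBlDr sub0r; have := fM u; rewrite ler_norml => /andP[].
have := gauss_opp bfM f0; rewrite !E_D//; first by move/addIr.
- exact: bm_cst.
- exact: bm_opp.
- exact: bm_cst.
Qed.

(** For [eps = 0]: the expected number of walks from [x] with [m + 1] hops, given that the first
    direction is [u]. A positive [eps] after each noise step keeps the logarithms of the
    continuations bounded. *)
Fixpoint count_eps (eps : R) (m : nat) (x : X) (u : U) : R :=
  if m is j.+1 then \sum_y N x y u * (noise w (count_eps eps j y) u + eps)
  else \sum_y N x y u.

Let e x u : R := \sum_y N x y u.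

Lemma bm_count eps m x : bm (count_eps eps m x).
Proof.
elim: m x => [|m IH] x /=; first by apply: bm_sum => y; exact: bN.
apply: bm_sum => y; apply: bmM; first exact: bN.
by apply: bmD; [exact: bm_noise|exact: bm_cst].
Qed.

Let be x : bm (e x). Proof. exact: (bm_count 0 0). Qed.
Let e01 x u : 0 <= e x u <= 1. Proof. by rewrite N1 sumr_ge0. Qed.

Lemma count_ge0 eps m x u : 0 <= eps -> 0 <= count_eps eps m x u.
Proof.
move=> eps0; elim: m x u => [|m IH] x u /=; first exact: sumr_ge0.
apply: sumr_ge0 => y _; rewrite mulr_ge0// addr_ge0//.
by apply: noise_ge0.
Qed.

Lemma count_ge eps m x u : 0 < eps <= 1 -> eps * e x u <= count_eps eps m x u.
Proof.
move=> /andP[eps0 eps1]; case: m => [|m] /=.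
  by rewrite ler_piMl//; case/andP: (e01 x u).
rewrite /e mulr_sumr; apply: ler_sum => y _; rewrite mulrC ler_wpM2l//.
by rewrite lerDr noise_ge0// => v; exact: count_ge0 (ltW eps0).
Qed.

Lemma count_eps_le eps m x u : 0 <= eps -> count_eps eps m x u <= count_eps 0 m x u + m%:R * eps.
Proof.
move=> eps0; elim: m x u => [|m IH] x u /=; first by rewrite mul0r addr0.
apply: (@le_trans _ _ (\sum_y N x y u * (noise w (count_eps 0 m y) u + 0 + m.+1%:R * eps))).
  apply: ler_sum => y _; rewrite ler_wpM2l// addr0 -natr1 mulrDl mul1r addrA lerD2r.
  rewrite -[X in _ + X](noise_cst w _ u) -noiseD; [|exact: bm_count|exact: bm_cst].
  by apply: noise_le => //; [exact: bm_count|apply: bmD; [exact: bm_count|exact: bm_cst]].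
have -> : \sum_y N x y u * (noise w (count_eps 0 m y) u + 0 + m.+1%:R * eps) =
    \sum_y N x y u * (noise w (count_eps 0 m y) u + 0) + (\sum_y N x y u) * (m.+1%:R * eps).
  by rewrite mulr_suml -big_split/=; apply: eq_bigr => y _; rewrite mulrDr.
by rewrite lerD2l ler_piMl// mulr_ge0.
Qed.

(** The potential: the mean logarithm of the number of continuations, weighted by the outgoing mass
    [e]. *)
Let L eps m := \sum_x E (fun u => e x u * ln (count_eps eps m x u)).

Let bm_ecount eps m x : 0 < eps <= 1 -> bm (fun u => e x u * ln (count_eps eps m x u)).
Proof.
move=> heps; have [mc [M cM]] := bm_count eps m x.
apply: (@bm_eln _ _ _ (e x) (count_eps eps m x) eps M) => //; first by case/andP: heps.
by move=> u; rewrite count_ge//= (le_trans (ler_norm _))// cM.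
Qed.

Let entropy := - \sum_x E (e x) * ln (E (e x)).

(** Concavity of the logarithm with the weights [N x y u / e x u], multiplied through by [e x u] so
    that vertices without outgoing mass need no division. *)
Let jensen_count eps m x u : 0 < eps <= 1 ->
  e x u * ln (e x u) + \sum_y N x y u * ln (noise w (count_eps eps m y) u + eps) <=
  e x u * ln (count_eps eps m.+1 x u).
Proof.
move=> heps; have /andP[eps0 eps1] := heps.
pose c y := noise w (count_eps eps m y) u + eps.
have c0 y : 0 < c y.
  by rewrite ltr_wpDl// noise_ge0// => v; exact: count_ge0 (ltW eps0).
have [ex0|exn0] := eqVneq (e x u) 0.
  rewrite ex0 !mul0r add0r big1// => y _.
  have := psumr_eq0P (fun y _ => N0 x y u) ex0 => /(_ y isT) ->.
  by rewrite mul0r.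
have ep : 0 < e x u by rewrite lt_neqAle eq_sym exn0; case/andP: (e01 x u).
have cp : 0 < count_eps eps m.+1 x u.
  by apply: lt_le_trans (count_ge _ _ _ heps); rewrite mulr_gt0.
have sE : \sum_y N x y u * c y = count_eps eps m.+1 x u by [].
move: (count_eps eps m.+1 x u) cp sE => t tp sE.
have sp : 0 < t / e x u by rewrite divr_gt0.
apply: (@le_trans _ _ (e x u * ln (e x u) +
    \sum_y (N x y u * (ln (t / e x u) - 1) + N x y u * c y * (e x u / t)))).
  rewrite lerD2l; apply: ler_sum => y _; rewrite -mulrA -mulrDr ler_wpM2l//.
  have := ln_le_subr1 (_ : 0 < c y / (t / e x u)); rewrite divr_gt0// => /(_ isT).
  rewrite lnM ?posrE ?invr_gt0// lnV ?posrE// invf_div -/(c y).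
  by lra.
rewrite big_split/= -!mulr_suml sE -/(e x u) ln_div ?posrE//.
have -> : t * (e x u / t) = e x u by field; rewrite gt_eqF.
by rewrite le_eqVlt; apply/orP; left; apply/eqP; ring.
Qed.

(** After Jensen the sum is regrouped by the arrival vertex [y]. By skew-symmetry the mass entering
    [y] in direction [u] is [e y (- u)], so the substitution [u -> - u] brings the sum into the form
    treated by [log_rh]. *)
Let L_step eps m : 0 < eps <= 1 ->
  L eps m - (2 * K%:R - 1) * entropy <= L eps m.+1.
Proof.
move=> heps; have /andP[eps0 eps1] := heps.
pose c y u := noise w (count_eps eps m y) u + eps.
have bc y : bm (c y) by apply: bmD; [apply: bm_noise; exact: bm_count|exact: bm_cst].
have clo y u : eps <= c y u.
  by rewrite lerDr noise_ge0// => v; exact: count_ge0 (ltW eps0).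
have bNc x y : bm (fun u => N x y u * ln (c y u)).
  have [mc [M cM]] := bc y.
  apply: (@bm_eln _ _ _ (N x y) (c y) eps M) => //.
    move=> u; rewrite N0/=; apply: le_trans (N1 x u); rewrite (bigD1 y)//= lerDl.
    exact: sumr_ge0.
  move=> u; apply/andP; split; last exact: le_trans (ler_norm _) (cM u).
  apply: le_trans (clo y u); rewrite ler_piMr ?(ltW eps0)//; apply: le_trans (N1 x u); rewrite (bigD1 y)//= lerDl.
  exact: sumr_ge0.
have bel x := bm_xlnx (be x) (e01 x).
have s1 : \sum_x E (fun u => e x u * ln (e x u)) + \sum_x \sum_y E (fun u => N x y u * ln (c y u))
    <= L eps m.+1.
  rewrite -big_split/=; apply: ler_sum => x _.
  rewrite -E_sum// -E_D//; last exact: bm_sum.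
  apply: E_le; first by apply: bmD => //; exact: bm_sum.
    exact: bm_ecount.
  by move=> u; exact: jensen_count.
apply: le_trans s1; rewrite exchange_big/=.
have -> : \sum_y \sum_x E (fun u => N x y u * ln (c y u)) =
    \sum_y E (fun u => e y u * ln (c y (- u))).
  apply: eq_bigr => y _; rewrite -E_sum// -E_opp; last exact: bm_sum.
  apply: E_eq => u; rewrite -mulr_suml; congr (_ * _).
  by apply: eq_bigr => x _; rewrite Nskew opprK.
have s2 y : E (fun u => e y u * ln (count_eps eps m y u)) - (2 * K%:R - 1) *
    (E (fun u => e y u * ln (e y u)) - E (e y) * ln (E (e y))) <= E (fun u => e y u * ln (c y (- u))).
  rewrite lerBlDr -lerBlDl; apply: (log_rh K1 wE (be y) (bm_count eps m y) (e01 y) heps).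
  by move=> u; exact: count_ge.
rewrite -lerBlDl; apply: le_trans (ler_sum _ (fun y _ => s2 y)).
rewrite [leRHS]big_split/= -/(L eps m) sumrN -mulr_sumr big_split/= sumrN -/entropy -/(entropy).
(* This term enters once from Jensen and [2K - 1] times negatively from [log_rh]; being nonpositive,
   it only helps and is dropped. *)
have : \sum_x E (fun u => e x u * ln (e x u)) <= 0.
  apply: sumr_le0 => x _; rewrite -[leRHS](E_cst g 0); apply: E_le => //; first exact: bm_cst.
  by move=> u; case/andP: (xlnx_bound (e01 x u)).
rewrite /entropy; move: (\sum_x E (fun u => e x u * ln (e x u))) (\sum_x E (e x) * ln (E (e x))) => s t.
have : 1 <= K%:R :> R by rewrite ler1n ltnW.
move=> kk h2; have h1 : 0 <= 2 * K%:R - 2 :> R by lra.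
have := mulr_ge0_le0 h1 h2; lra.
Qed.

(** The entropy of the vertex masses is largest when they are equal, so each hop lowers the
    potential by at most [- (2K - 1) A ln a] with [a = A / n]. The bound on the mean logarithm is
    turned into one on the mean, and [eps] tends to 0. *)
Theorem chain_lower m : (0 < #|X|)%N ->
  (\sum_x E (e x)) * ((\sum_x E (e x)) / #|X|%:R) ^+ (m * (2 * K - 1)) <= \sum_x E (count_eps 0 m x).
Proof.
move=> X0; set A := \sum_x E (e x); have A0 : 0 <= A by apply: sumr_ge0 => x _; apply: E_ge0 => u; case/andP: (e01 x u).
have [->|An0] := eqVneq A 0.
  by rewrite mul0r; apply: sumr_ge0 => x _; apply: E_ge0 => u; exact: count_ge0.
have Ap : 0 < A by rewrite lt_neqAle eq_sym An0.
have nR : 0 < #|X|%:R :> R by rewrite ltr0n.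
pose a := A / #|X|%:R; have a0 : 0 < a by rewrite divr_gt0.
have Hle : entropy <= - (A * ln a).
  rewrite lerN2.
  have -> : A * ln a = \sum_x (E (e x) * ln a + E (e x) - a).
    rewrite sumrB big_split/= -mulr_suml -/A sumr_const -mulr_natr /a divfK ?gt_eqF//.
    by rewrite addrK.
  apply: ler_sum => x _; have Ee : 0 <= E (e x) by apply: E_ge0 => u; case/andP: (e01 x u).
  have [->|En0] := eqVneq (E (e x)) 0; first by rewrite !mul0r !add0r lerNl oppr0 ltW.
  have Ep : 0 < E (e x) by rewrite lt_neqAle eq_sym En0.
  have := ln_le_subr1 (_ : 0 < a / E (e x)); rewrite divr_gt0// => /(_ isT).
  rewrite ln_div ?posrE// => h; have := ler_wpM2l Ee h.
  have -> : E (e x) * (a / E (e x) - 1) = a - E (e x) by field; rewrite gt_eqF.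
  by lra.
have kk : 1 <= K%:R :> R by rewrite ler1n ltnW.
have K2 : 0 <= 2 * K%:R - 1 :> R by lra.
have Lm eps : 0 < eps <= 1 -> \sum_x E (fun u => e x u * ln (e x u)) + m%:R * ((2 * K%:R - 1) * (A * ln a)) <= L eps m.
  move=> heps; elim: (m) => [|j IH]; first by rewrite mul0r addr0.
  apply: le_trans (L_step _ heps); rewrite -natr1 mulrDl mul1r addrA lerD// -mulrN.
  by rewrite ler_wpM2l// lerNr.
have lower eps : 0 < eps <= 1 -> A * a ^+ (m * (2 * K - 1)) <= \sum_x E (count_eps eps m x).
  move=> heps; have /andP[eps0 eps1] := heps.
  pose s := (m * (2 * K - 1))%:R * ln a.
  have sE : a ^+ (m * (2 * K - 1)) = expR s by rewrite /s expRM_natl lnK.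
  rewrite sE.
  (* The tangent of [ln] at [e x u * expR s]; summed over [x] and integrated, the left side is at
     least [A * expR s] by the choice of [s]. *)
  have pt x u : expR s * ((1 - s) * e x u + (e x u * ln (count_eps eps m x u) - e x u * ln (e x u))) <=
      count_eps eps m x u.
    have [->|en0] := eqVneq (e x u) 0.
      by rewrite !mul0r mulr0 subrr addr0 mulr0 count_ge0// ltW.
    have ep : 0 < e x u by rewrite lt_neqAle eq_sym en0; case/andP: (e01 x u).
    have cp : 0 < count_eps eps m x u.
      by apply: lt_le_trans (count_ge _ _ _ heps); rewrite mulr_gt0.
    move: (count_eps _ _ _ _) cp => t tp.
    have sp := expR_gt0 s.
    have := ln_le_subr1 (_ : 0 < t / (e x u * expR s)); rewrite divr_gt0 ?mulr_gt0// => /(_ isT).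
    rewrite ln_div ?posrE ?mulr_gt0// lnM ?posrE// expRK => h.
    have := ler_wpM2l (ltW (mulr_gt0 ep sp)) h.
    have -> : e x u * expR s * (t / (e x u * expR s) - 1) = t - e x u * expR s by field; rewrite !gt_eqF.
    by lra.
  have bel x := bm_xlnx (be x) (e01 x).
  have b1 x := bmB (bm_ecount m x heps) (bel x).
  have b2 x := bmD (bmZ (1 - s) (be x)) (b1 x).
  have Ept x := E_le g (bmZ (expR s) (b2 x)) (bm_count eps m x) (pt x).
  apply: le_trans (ler_sum _ (fun x _ => Ept x)).
  have -> : \sum_x E (fun u => expR s * ((1 - s) * e x u +
        (e x u * ln (count_eps eps m x u) - e x u * ln (e x u)))) =
      expR s * ((1 - s) * A + (L eps m - \sum_x E (fun u => e x u * ln (e x u)))).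
    rewrite mulrDr mulrBr !mulr_sumr -sumrB -big_split/=; apply: eq_bigr => x _.
    rewrite E_Z// E_D//; last exact: bmZ.
    by rewrite E_Z// E_B//; [rewrite mulrDr mulrBr|exact: bm_ecount].
  rewrite mulrC ler_wpM2l ?expR_ge0//.
  have := Lm _ heps.
  have -> : m%:R * ((2 * K%:R - 1) * (A * ln a)) = A * s.
    rewrite /s natrM natrB ?natrM; last by rewrite muln_gt0/= ltnW.
    by ring.
  by lra.
apply/ler_addgt0Pr => del del0.
pose c : R := #|X|%:R * m%:R + 1.
have c0 : 0 < c by rewrite ltr_wpDl// mulr_ge0.
pose eps := Num.min 1 (del / c).
have eps0 : 0 < eps by rewrite lt_min ltr01 divr_gt0.
have heps : 0 < eps <= 1 by rewrite eps0 ge_min lexx.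
have epsc : #|X|%:R * m%:R * eps <= del.
  apply: (@le_trans _ _ (c * eps)); first by rewrite ler_wpM2r ?(ltW eps0)// lerDl.
  by rewrite mulrC -ler_pdivlMr// ge_min lexx orbT.
apply: (le_trans (lower _ heps)).
apply: (@le_trans _ _ (\sum_x (E (count_eps 0 m x) + m%:R * eps))).
  apply: ler_sum => x _; rewrite -[X in _ + X](E_cst g) -E_D; last first.
  - exact: bm_cst.
  - exact: bm_count.
  apply: E_le; [exact: bm_count|apply: bmD; [exact: bm_count|exact: bm_cst]|].
  by move=> u; apply: count_eps_le; exact: ltW.
rewrite big_split/= lerD2l; apply: le_trans epsc.
by rewrite sumr_const -mulrA -[leLHS]mulr_natl.
Qed.

End chain_count.

(** * Walks as tuples, and products along a Gaussian chain *)

Section tuple_sums.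
Variables (R : nmodType) (X : finType).

Lemma sum_tupleS n (F : n.+1.-tuple X -> R) :
  \sum_(t : n.+1.-tuple X) F t = \sum_x \sum_(t : n.-tuple X) F [tuple of x :: t].
Proof.
rewrite pair_big/= (reindex (fun xt : X * n.-tuple X => [tuple of xt.1 :: xt.2]))//=.
exists (fun t => (thead t, [tuple of behead t])) => [[x t] _|t _] /=.
  by congr pair; apply: val_inj.
by rewrite [RHS]tuple_eta; apply: val_inj.
Qed.

Lemma sum_tuple0 (F : 0.-tuple X -> R) : \sum_(t : 0.-tuple X) F t = F [tuple].
Proof. by rewrite (big_pred1 [tuple])// => t; rewrite (tuple0 t); apply/esym/eqP/val_inj. Qed.

End tuple_sums.

Section hops.
Variables (X T : Type).

(** Applied both to hop probabilities and to the events that a hop is sampled, so that weights and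
    events of a path share one description. *)
Definition hops (f : X -> X -> T) (p : seq X) : seq T :=
  if p is x :: s then pairmap f x s else [::].

Lemma hops_rcons2 f p x y : hops f (rcons (rcons p x) y) = rcons (hops f (rcons p x)) (f x y).
Proof.
case: p => [//|z p] /=; elim: p z => [//|a p IH] z /=.
by rewrite IH.
Qed.

Lemma rev_hops f p : rev (hops f p) = hops (fun x y => f y x) (rev p).
Proof.
case: p => [//|x p]; elim: p x => [//|y p IH] x.
rewrite [hops _ _]/= rev_cons -[pairmap f y p]/(hops f (y :: p)) IH.
by rewrite [in RHS]rev_cons [rev (y :: p)]rev_cons hops_rcons2.
Qed.

Lemma size_hops f p : size (hops f p) = (size p).-1.
Proof. by case: p => [//|x p] /=; rewrite size_pairmap. Qed.

End hops.

Lemma map_hops (X T T' : Type) (f : X -> X -> T) (k : T -> T') p : map k (hops f p) = hops (fun x y => k (f x y)) p.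
Proof. by case: p => [//|x p] /=; elim: p x => [//|y p IH] x /=; rewrite IH. Qed.

Section chain_functional.
Context {R : realType} (d : nat).
Local Notation U := 'rV[R]_d.
Local Notation g := (@gauss R d).
Local Notation E f := (\int[g]_u f u)%R.
Variable w : R.
Hypothesis w01 : 0 <= w <= 1.
Implicit Types (fs gs : seq (U -> R)) (h : U -> R).

(** The conditional expectation of [f_1(u_1) ... f_k(u_k) h(u_k)] given [u_1 = u], for nonempty
    [fs]. *)
Fixpoint chain h fs (u : U) : R := if fs is f :: fs' then
  f u * (if fs' is [::] then h u else noise w (chain h fs') u) else 1.

Definition good_fun (f : U -> R) := bm f /\ forall u, 0 <= f u.

Fixpoint good_funs fs : Prop := if fs is f :: fs' then good_fun f /\ good_funs fs' else True.

Lemma good_chain h fs : good_fun h -> good_funs fs -> good_fun (chain h fs).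
Proof.
move=> [bh h0]; elim: fs => [|f fs IH] /=; first by split; [exact: bm_cst|].
move=> [[bf f0] gfs]; have [bc c0] := IH gfs.
case: fs IH gfs bc c0 => [|f' fs] IH gfs bc c0.
  by split; [exact: bmM|move=> u; exact: mulr_ge0].
split; first by apply: bmM => //; exact: bm_noise.
by move=> u; apply: mulr_ge0 => //; apply: noise_ge0.
Qed.

Let one : U -> R := fun=> 1.
Let good1 : good_fun one. Proof. by split => // ; exact: bm_cst. Qed.

Lemma chain_cons f fs u : chain one (f :: fs) u = f u * noise w (chain one fs) u.
Proof. by case: fs => [|f' fs] //=; rewrite noise_cst. Qed.

Lemma chain_rcons h fs f : chain h (rcons fs f) = chain one (rcons fs (fun u => f u * h u)).
Proof.
elim: fs => [|f' fs IH] /=; first by apply/funext => u; rewrite mulr1.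
by apply/funext => u; case: fs IH => [|f2 fs] /= IH; rewrite IH.
Qed.

(** Self-adjointness of the noise moves one function at a time from the front of [fs] to the front
    of [gs]; iterated, this is the reversibility of the chain. *)
Lemma chain_catrev fs gs : good_funs fs -> good_funs gs ->
  E (fun u => chain one fs u * noise w (chain one gs) u) = E (chain one (catrev fs gs)).
Proof.
elim: fs gs => [|f fs IH] gs gfs ggs.
  rewrite /=; have [bc c0] := good_chain good1 ggs.
  by rewrite -(E_noise w01 bc c0); apply: E_eq => u; rewrite mul1r.
case: gfs => gf gfs; rewrite -[catrev _ _]/(catrev fs (f :: gs)) -(IH (f :: gs))//.
have [bc c0] := good_chain good1 gfs.
have gfg : good_funs (f :: gs) by [].
have [bc' c0'] := good_chain good1 gfg.
rewrite (noise_adjoint w01 bc bc' c0 c0').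
by apply: E_eq => u; rewrite !chain_cons mulrAC mulrC mulrA.
Qed.

Lemma chain_rev fs : good_funs fs -> E (chain one (rev fs)) = E (chain one fs).
Proof.
move=> gfs; rewrite /rev -chain_catrev//.
by apply: E_eq => u; rewrite noise_cst mulr1.
Qed.

Lemma chain_opp fs u : good_funs fs ->
  chain one [seq (fun u => f (- u)) | f <- fs] u = chain one fs (- u).
Proof.
elim: fs u => [//|f fs IH] u [gf gfs].
have [bc c0] := good_chain good1 gfs.
rewrite map_cons !chain_cons -(noise_opp w u bc c0); congr (_ * noise w _ u).
by apply/funext => v; exact: IH.
Qed.

Lemma E_chain_opp fs : good_funs fs ->
  E (chain one [seq (fun u => f (- u)) | f <- fs]) = E (chain one fs).
Proof.
move=> gfs; have [bc c0] := good_chain good1 gfs; rewrite -(gauss_opp bc c0).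
by apply: E_eq => u; exact: chain_opp.
Qed.

Lemma good_funs_cat fs gs : good_funs (fs ++ gs) <-> good_funs fs /\ good_funs gs.
Proof. by elim: fs => [|f fs IH] /=; [split=> [//|[]]|rewrite IH; tauto]. Qed.

(** Reversing the chain and negating all directions carries a weight on the first direction to one
    on the last, which is the only position the exponential moment bound treats. *)
Lemma E_chain_first h f fs : good_fun h -> good_fun f -> good_funs fs ->
  E (fun u => h u * chain one (f :: fs) u) =
  E (chain (fun u => h (- u)) (rev [seq (fun u => f (- u)) | f <- f :: fs])).
Proof.
move=> [bh h0] [bf f0] gfs.
have goppf k : good_fun k -> good_fun (fun u => k (- u)).
  by case=> bk k0; split => [|u //]; exact: bm_opp.
rewrite map_cons rev_cons chain_rcons -(@chain_rev (rcons _ _)); last first.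
  rewrite -cats1; apply/good_funs_cat; split; last first.
    by split => //; split; [apply: bmM; apply: bm_opp|move=> u; exact: mulr_ge0].
  elim: fs gfs => [//|f' fs IH] [gf' gfs] /=.
  by rewrite rev_cons -cats1; apply/good_funs_cat; split; [exact: IH|split => //; exact: goppf].
rewrite rev_rcons revK.
transitivity (E (chain one [seq (fun u => k (- u)) | k <- (fun u => f u * h u) :: fs])); last by [].
rewrite E_chain_opp; last first.
  by split => //; split; [exact: bmM|move=> u; exact: mulr_ge0].
by apply: E_eq => u; rewrite !chain_cons mulrA [h u * _]mulrC.
Qed.

End chain_functional.

Section count_paths.
Context {R : realType} (d : nat) (X : finType).
Local Notation U := 'rV[R]_d.
Variables (N : X -> X -> U -> R) (w : R).
Hypotheses (bN : forall x y, bm (N x y)) (N0 : forall x y u, 0 <= N x y u).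

Lemma good_hops p : good_funs (hops N p).
Proof.
case: p => [//|x p] /=; elim: p x => [//|y p IH] x /=; split; last exact: IH.
by split => // u; exact: N0.
Qed.

Lemma count_eps0E m x u : count_eps N w 0 m x u =
  \sum_(t : m.+1.-tuple X) chain w (fun=> 1) (hops N (x :: t)) u.
Proof.
have g1 : good_fun ((fun=> 1) : U -> R) by split => //; exact: bm_cst.
elim: m x u => [|m IH] x u.
  rewrite sum_tupleS /=; apply: eq_bigr => y _.
  by rewrite sum_tuple0/= mulr1.
rewrite [LHS]/= sum_tupleS; apply: eq_bigr => y _.
rewrite addr0; have -> : count_eps N w 0 m y = fun u =>
    \sum_(t : m.+1.-tuple X) chain w (fun=> 1) (hops N (y :: t)) u.
  by apply/funext => v; exact: IH.
rewrite noise_sum; last by move=> t; case: (good_chain w g1 (good_hops (y :: t))).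
rewrite mulr_sumr; apply: eq_bigr => t _.
by rewrite -chain_cons.
Qed.

End count_paths.

Section dot_facts.
Context {R : realType} (d : nat).
Implicit Types u v z : 'rV[R]_d.

Lemma dotDl u v z : dot (u + v) z = dot u z + dot v z.
Proof. by rewrite /dot -big_split/=; apply: eq_bigr => i _; rewrite mxE mulrDl. Qed.

Lemma dotZl a u z : dot (a *: u) z = a * dot u z.
Proof. by rewrite /dot mulr_sumr; apply: eq_bigr => i _; rewrite mxE mulrA. Qed.

Lemma dotC u v : dot u v = dot v u.
Proof. by apply: eq_bigr => i _; rewrite mulrC. Qed.

Lemma dotNl u z : dot (- u) z = - dot u z.
Proof. by rewrite -scaleN1r dotZl mulN1r. Qed.

Lemma dotNN u v : dot (- u) (- v) = dot u v.
Proof. by rewrite dotNl dotC dotNl opprK dotC. Qed.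

Lemma sqnormZ a u : sqnorm (a *: u) = a ^+ 2 * sqnorm u.
Proof. by rewrite /sqnorm dotZl dotC dotZl mulrA. Qed.

Lemma sqnormN u : sqnorm (- u) = sqnorm u.
Proof. exact: dotNN. Qed.

Lemma noise_exp w (f : 'rV[R]_d -> R) C z u : 0 <= w <= 1 -> bm f -> (forall v, 0 <= f v) -> 0 <= C ->
  (forall v, f v <= C * expR (dot z v)) ->
  noise w f u <= C * expR (w * dot z u + (1 - w ^+ 2) * sqnorm z / 2).
Proof.
move=> /andP[w0 w1] bf f0 C0 fC; rewrite -lee_fin /noise -EFin_E; last exact: bm_correlate1.
set b := Num.sqrt (1 - w ^+ 2).
have b2 : b ^+ 2 = 1 - w ^+ 2 by rewrite sqr_sqrtr// subr_ge0 expr_le1.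
apply: (@le_trans _ _ (\int[gauss d]_v ((C * expR (w * dot z u))%:E * (expR (dot (b *: z) v))%:E)))%E.
  have me : measurable_fun setT (fun v : 'rV[R]_d => (expR (dot (b *: z) v))%:E).
    by apply/measurable_EFinP; apply: measurable_expRf; exact: measurable_dot.
  apply: ge0_le_integral => //.
  - by move=> v _; rewrite lee_fin.
  - by apply/measurable_EFinP; case: (bm_correlate1 w u bf).
  - exact: emeasurable_funM.
  move=> v _; rewrite -EFinM lee_fin -mulrA -expRD (le_trans (fC _))//.
  rewrite ler_wpM2l// ler_expR le_eqVlt; apply/orP; left; apply/eqP.
  by rewrite /correlate dotC dotDl !dotZl (dotC u) (dotC v).
rewrite ge0_integralZl_EFin; last 4 first.
- by [].
- by move=> v _; rewrite lee_fin expR_ge0.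
- by apply/measurable_EFinP; apply: measurable_expRf; exact: measurable_dot.
- by rewrite mulr_ge0// expR_ge0.
by rewrite gauss_mgf sqnormZ b2 -EFinM lee_fin; rewrite expRD mulrA.
Qed.

End dot_facts.

(** * Upper bound on the number of short walks *)

Section chernoff.
Context {R : realType} (d : nat) (X : finType).
Local Notation U := 'rV[R]_d.
Local Notation g := (@gauss R d).
Local Notation E f := (\int[g]_u f u)%R.
Variables (N : X -> X -> U -> R) (w : R) (pos : X -> U) (sigma Delta : R) (n_ : nat -> R).
Hypotheses (bN : forall x y, bm (N x y)) (N0 : forall x y u, 0 <= N x y u)
  (N1 : forall x u, \sum_y N x y u <= 1) (w01 : 0 <= w <= 1)
  (Nst : forall x y u, N x y u != 0 -> sigma <= dot (pos y - pos x) u).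

Fixpoint near (x0 : X) (i : nat) (s : seq X) : bool :=
  if s is y :: s' then (sqnorm (pos y - pos x0) <= n_ i * Delta) && near x0 i.+1 s' else true.

Definition short (s : R) (x y : X) (u : U) : R := (dot (pos y - pos x) u < s)%R%:R.

Lemma good_short s x y : good_fun (short s x y).
Proof.
split; last by move=> u; rewrite ler0n.
apply: (@bm_ge0 _ _ _ _ 1) => [|u]; last by rewrite ler0n lern1 leq_b1.
rewrite (_ : short s x y = \1_[set u | dot (pos y - pos x) u < s]); last first.
  apply/funext => u; rewrite indicE /short; case: ltP => h; first by rewrite mem_set.
  by rewrite memNset//=; apply/negP; rewrite -leNgt.
apply: measurable_indic; rewrite -[X in measurable X]setTI.
apply: (@measurable_fun_ltr _ _ _ _ (dot (pos y - pos x)) (cst s)) => //.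
exact: measurable_dot.
Qed.

(** A noise step with [k] further ones after it acts on an exponential tilt damped by [w^k], so its
    variance is weighted by [w^(2k)]; [n_ i] bounds the squared distance from the start, in units of
    [Delta]. *)
Fixpoint varsum (i j : nat) : R :=
  if j is k.+1 then varsum i.+1 k + w ^+ (2 * k) * n_ i else 0.

(** Here [x0] is the start of the whole walk and [x] the current vertex, whose successor is [i] hops
    from [x0]; keeping both apart allows induction on the remaining hops. *)
Let Y s x0 i j x (u : U) : R := \sum_(t : j.+1.-tuple X)
  (near x0 i t)%:R * chain w (short s x0 (last x t)) (hops N (x :: t)) u.

Let good_Y s x0 i j x : good_fun (Y s x0 i j x).
Proof.
have gt t := good_chain w (good_short s x0 (last x t)) (good_hops bN N0 (x :: t)).
split; last by move=> u; apply: sumr_ge0 => t _; apply: mulr_ge0 => //; exact: (gt t).2.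
by apply: bm_sum => t; apply: bmZ; exact: (gt t).1.
Qed.

Let Y0 s x0 i x u : Y s x0 i 0 x u =
  \sum_y N x y u * ((sqnorm (pos y - pos x0) <= n_ i * Delta)%R%:R * short s x0 y u).
Proof.
rewrite /Y sum_tupleS; apply: eq_bigr => y _; rewrite sum_tuple0/= andbT.
by rewrite mulrCA.
Qed.

Let YS s x0 i j x u : Y s x0 i j.+1 x u =
  \sum_y N x y u * ((sqnorm (pos y - pos x0) <= n_ i * Delta)%R%:R * noise w (Y s x0 i.+1 j y) u).
Proof.
rewrite /Y sum_tupleS; apply: eq_bigr => y _.
rewrite noise_sum; last first.
  by move=> t; apply: bmZ; exact: (good_chain w (good_short s x0 (last y t)) (good_hops bN N0 (y :: t))).1.
rewrite !mulr_sumr; apply: eq_bigr => t _.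
rewrite noiseZ; last first.
  exact: (good_chain w (good_short s x0 (last y t)) (good_hops bN N0 (y :: t))).1.
case: t => -[//|z t] szt; rewrite -[hops N (x :: _)]/(N x y :: hops N (y :: z :: t)).
rewrite [chain _ _ _ _]/= -/(chain _ _ _).
by rewrite /= -mulnb natrM; ring.
Qed.

(** Backwards from the end of the walk. The indicator of a short displacement is at most
    [exp (theta (s - <y - x0, u>))]. Passing to the preceding direction damps the tilt by [w] and
    costs Gaussian variance ([noise_exp]); each hop gains [sigma] times the current tilt. *)
Let Y_le s x0 i j x u theta : 0 <= theta ->
  Y s x0 i j x u <= expR (theta * s - theta * sigma * \sum_(l < j.+1) w ^+ l +
    theta ^+ 2 * (1 - w ^+ 2) * Delta / 2 * varsum i j) *
    expR (- theta * w ^+ j * dot (pos x - pos x0) u).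
Proof.
move=> th0; have w2 : 0 <= 1 - w ^+ 2.
  by case/andP: w01 => ? ?; rewrite subr_ge0 expr_le1.
(* One hop: it advances by at least [sigma] along the current direction, and since the hop
   probabilities from [x'] sum to at most 1, a bound uniform in [y] survives the sum. *)
have fin (F : X -> R) (C : R) j' x' u' : 0 <= C ->
    (forall y, F y <= C * expR (- theta * w ^+ j' * dot (pos y - pos x0) u')) ->
    \sum_y N x' y u' * F y <= C * expR (- (theta * w ^+ j' * sigma)) *
      expR (- theta * w ^+ j' * dot (pos x' - pos x0) u').
  move=> C0 FC; set rhs := (X in _ <= X).
  have rhs0 : 0 <= rhs by rewrite !mulr_ge0 ?expR_ge0.
  apply: (@le_trans _ _ (\sum_y N x' y u' * rhs)); last by rewrite -mulr_suml ler_piMl.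
  apply: ler_sum => y _; have [->|Nn0] := eqVneq (N x' y u') 0; first by rewrite !mul0r.
  rewrite ler_wpM2l// (le_trans (FC y))// /rhs -[leRHS]mulrA ler_wpM2l// -expRD ler_expR.
  have -> : pos y - pos x0 = (pos y - pos x') + (pos x' - pos x0) by rewrite addrA subrK.
  rewrite dotDl mulrDr lerD2r !mulNr lerN2 ler_wpM2l ?Nst//.
  by rewrite mulr_ge0// exprn_ge0//; case/andP: w01.
elim: j i x u => [|j IH] i x u.
  rewrite Y0; apply: (le_trans (fin _ (expR (theta * s)) 0%N x u (expR_ge0 _) _)).
    move=> y; rewrite -expRD expr0 mulr1; apply: (@le_trans _ _ (short s x0 y u)).
      by rewrite ler_piMl ?ler0n// lern1 leq_b1.
    rewrite /short; case: ltP => h; last exact: expR_ge0.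
    rewrite -expR0 ler_expR mulNr subr_ge0; apply: ler_wpM2l => //; exact: ltW.
  rewrite big_ord1 expr0 mulr1 /= mulr0 addr0 ler_wpM2r ?expR_ge0// -expRD mulr1.
  by [].
rewrite YS.
set C := expR (theta * s - theta * sigma * \sum_(l < j.+1) w ^+ l +
    theta ^+ 2 * (1 - w ^+ 2) * Delta / 2 * varsum i.+1 j +
    theta ^+ 2 * (1 - w ^+ 2) * Delta / 2 * (w ^+ (2 * j) * n_ i)).
apply: (le_trans (fin _ C j.+1 x u (expR_ge0 _) _)).
  move=> y; have [near_y|_] := boolP (sqnorm (pos y - pos x0) <= n_ i * Delta); last by rewrite mul0r mulr_ge0 ?expR_ge0.
  rewrite mul1r.
  have [bY Yge0] := good_Y s x0 i.+1 j y.
  have le1 v : Y s x0 i.+1 j y v <= expR (theta * s - theta * sigma * \sum_(l < j.+1) w ^+ l +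
    theta ^+ 2 * (1 - w ^+ 2) * Delta / 2 * varsum i.+1 j) * expR (dot ((- theta * w ^+ j) *: (pos y - pos x0)) v).
    by rewrite dotZl; apply: IH.
  apply: (le_trans (noise_exp u w01 bY Yge0 (expR_ge0 _) le1)).
  rewrite /C [in leRHS]expRD -[leRHS]mulrA ler_wpM2l ?expR_ge0// -expRD ler_expR addrC.
  rewrite dotZl sqnormZ; apply: lerD; last by rewrite exprS le_eqVlt; apply/orP; left; apply/eqP; ring.
  have -> : (1 - w ^+ 2) * ((- theta * w ^+ j) ^+ 2 * sqnorm (pos y - pos x0)) / 2 =
    (theta ^+ 2 * (1 - w ^+ 2) * w ^+ (2 * j) / 2) * sqnorm (pos y - pos x0).
    by rewrite exprMn sqrrN -exprM mulnC; ring.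
  have -> : theta ^+ 2 * (1 - w ^+ 2) * Delta / 2 * (w ^+ (2 * j) * n_ i) =
    (theta ^+ 2 * (1 - w ^+ 2) * w ^+ (2 * j) / 2) * (n_ i * Delta) by ring.
  rewrite ler_wpM2l// !mulr_ge0// ?exprn_ge0//; by case/andP: w01.
rewrite ler_wpM2r ?expR_ge0// /C -expRD ler_expR [\sum_(l < j.+2) _]big_ord_recr/=.
by rewrite le_eqVlt; apply/orP; left; apply/eqP; ring.
Qed.

Lemma chernoff s m theta : 0 <= theta ->
  \sum_x \sum_(t : m.+1.-tuple X) (near x 1 t)%:R * E (chain w (short s x (last x t)) (hops N (x :: t))) <=
  #|X|%:R * expR (theta * s - theta * sigma * \sum_(l < m.+1) w ^+ l +
    theta ^+ 2 * (1 - w ^+ 2) * Delta / 2 * varsum 1 m).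
Proof.
move=> th0; rewrite [leRHS]mulr_natl -sumr_const; apply: ler_sum => x _.
have gt t := good_chain w (good_short s x (last x t)) (good_hops bN N0 (x :: t)).
rewrite (_ : \sum_t _ = E (Y s x 1 m x)); last first.
  rewrite /Y E_sum; last by move=> t; apply: bmZ; exact: (gt t).1.
  by apply: eq_bigr => t _; rewrite E_Z//; exact: (gt t).1.
rewrite -[leRHS](E_cst g); apply: E_le; [exact: (good_Y _ _ _ _ _).1|exact: bm_cst|].
move=> u; apply: (le_trans (Y_le s x 1 m x u th0)).
by rewrite subrr (_ : dot 0 u = 0) ?mulr0 ?expR0 ?mulr1// -(scale0r 0) dotZl mul0r.
Qed.

End chernoff.

(** * Estimate of the accumulated variance *)

Section variance.
Context {R : realType}.
Implicit Types w x : R.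

Lemma varsum_le w (n_ : nat -> R) i j : 0 <= w <= 1 -> (forall i, n_ i <= i.+1%:R) ->
  (1 - w ^+ 2) * varsum w n_ i j <=
  (i + j).+1%:R - \sum_(l < j) w ^+ (2 * l) - i.+1%:R * w ^+ (2 * j).
Proof.
move=> /andP[w0 w1] nle; elim: j i => [|j IH] i /=.
  by rewrite big_ord0 addn0 mulr0 subr0 muln0 expr0 mulr1 subrr.
rewrite mulrDr (le_trans (lerD (IH i.+1) (_ : _ <= (1 - w ^+ 2) * (w ^+ (2 * j) * i.+1%:R))))//.
  by rewrite ler_wpM2l ?subr_ge0 ?expr_le1// ler_wpM2l// exprn_ge0.
rewrite [\sum_(l < j.+1) _]big_ord_recr/= mulnS exprD addSnnS -[i.+2%:R]natr1.
by rewrite le_eqVlt; apply/orP; left; apply/eqP; ring.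
Qed.

(** Pair [l] with [m - l]: [w^(2l) + w^(2(m-l)) >= 2 w^m]. *)
Lemma geometric_ge w m : 0 <= w -> m.+1%:R * w ^+ m <= \sum_(l < m.+1) w ^+ (2 * l).
Proof.
move=> w0; have h : 2 * (m.+1%:R * w ^+ m) <= 2 * \sum_(l < m.+1) w ^+ (2 * l).
  rewrite [leRHS]mulr_natl [leRHS]mulr2n [X in _ + X](reindex_inj rev_ord_inj)/= -big_split/=.
  rewrite mulrCA mulr_natl -[m.+1 in leLHS]card_ord -sumr_const; apply: ler_sum => l _.
  have lm : (l <= m)%N by rewrite -ltnS.
  rewrite subSS -[m in leLHS](subnK lm) exprD.
  have : 0 <= (w ^+ l - w ^+ (m - l)) ^+ 2 by exact: sqr_ge0.
  by rewrite sqrrB -!exprM ![(_ * 2)%N]mulnC -mulr_natl; lra.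
by move: h; lra.
Qed.

(** The bound has the same shape as the factor [(k+1)(1 - omega^k)] in the hypothesis on
    [beta_k]. *)
Lemma varsum1_le w (n_ : nat -> R) m : 0 <= w <= 1 -> (forall i, n_ i <= i.+1%:R) -> (0 < m)%N ->
  (1 - w ^+ 2) * varsum w n_ 1 m.-1 <= m.+1%:R * (1 - w ^+ m).
Proof.
case: m => [//|m] hw nle _; rewrite (le_trans (varsum_le 1 m hw nle))//= add1n.
have /andP[w0 w1] := hw.
have := geometric_ge m.+1 w0; rewrite 2!big_ord_recr/= => h.
have h2 : w ^+ (2 * m.+1) <= w ^+ (2 * m) by rewrite ler_wiXn2l// leq_mul.
by rewrite mulrBr mulr1; lra.
Qed.

End variance.

(** * The displacement slack across scales *)

Section budget.
Context {R : realType} (r : nat) (C : R) (B beta : nat -> R).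
Let K : R := (2 ^ r)%:R.
Let w : R := 1 - K^-1.
Let a (j : nat) : R := 1 - w ^+ j.
(** The coefficient with which [ln_lambda] bounds [ln 2 - ln lambda_(2j)] below. In the next line,
    [Ex m] is the exponent of [delta] in the count of walks with [m] hops. *)
Let e (j : nat) : R := (2 * j%:R - 1) * (2 * K) + 2 * j%:R.
Let Ex (m : nat) : R := 1 + (m%:R - 1) * (2 * K - 1).
Let n_ (i : nat) : R := if i == 1%N then 1 else i.+1%:R.
Hypotheses (C0 : 0 < C) (r0 : (0 < r)%N) (B1 : B 1%N = 0).

Let K2 : 2 <= K.
Proof. by rewrite /K ler_nat -[X in (X <= _)%N]expn1 leq_exp2l. Qed.

Let w01 : 0 <= w < 1.
Proof.
rewrite /w subr_ge0 ltrBlDr ltrDl invr_gt0 invf_le1 ?(lt_le_trans _ K2)//.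
by rewrite (le_trans _ K2) ?ler1n//= (lt_le_trans _ K2).
Qed.

Let a_double j : a (2 * j) = a j * (1 + w ^+ j).
Proof. by rewrite /a mulnC exprM; ring. Qed.

Let a_gt0 j : (0 < j)%N -> 0 < a j.
Proof. by move=> j0; rewrite /a subr_gt0 exprn_ilt1 ?lt0n_neq0//; case/andP: w01. Qed.

Let sqr_le_mul (x y z : R) : 0 <= x -> 0 <= y -> z ^+ 2 <= x ^+ 2 * y ^+ 2 -> z <= x * y.
Proof.
move=> x0 y0; rewrite -exprMn => h.
have xy0 : 0 <= x * y by rewrite mulr_ge0.
have [z0|/ltW z0] := lerP z 0; first exact: le_trans xy0.
by rewrite -ler_sqr ?nnegrE.
Qed.

(** With [q = w^j], the inequality of means gives [B_(2j)^2 >= 4 (1 + q) B_j beta_j]. The lower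
    bounds on [B_j^2] and [beta_j^2] are multiplied, and [a (2j) = (1 + q) a j], so a bound of the
    same form holds at the doubled scale. *)
Lemma budget i : (0 < i)%N ->
  (forall l, (l < i)%N -> 0 < beta (2 ^ l)%N /\
     B (2 * 2 ^ l)%N = (1 + w ^+ (2 ^ l)) * B (2 ^ l)%N + beta (2 ^ l)%N /\
     C * ((2 ^ l).+1%:R * a (2 ^ l) * e (2 ^ l)) <= beta (2 ^ l)%N ^+ 2) ->
  0 < B (2 ^ i)%N /\
  C * ((1 - w ^+ 2) * varsum w n_ 1 (2 ^ i).-1 * Ex (2 ^ i)) <= B (2 ^ i)%N ^+ 2.
Proof.
have /andP[w0 w1] := w01; move=> i0 H.
(* The recursion starts from [beta_1] alone, which pays for the variance factor 1 at two hops (the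
   radius after one hop is 1) and then for 4 at four hops; from eight hops on the general factor
   [2^i + 1] is affordable. *)
pose x (i : nat) : R := if i == 1%N then 1 else if i == 2 then 4 else (2 ^ i).+1%:R.
suff : 0 < B (2 ^ i)%N /\ C * (x i * a (2 ^ i) * Ex (2 ^ i)) <= B (2 ^ i)%N ^+ 2.
  move=> [Bi0 Bi]; split => //; apply: le_trans Bi; rewrite ler_pM2l//.
  have Ex0 : 0 <= Ex (2 ^ i).
    rewrite /Ex addr_ge0// mulr_ge0 ?subr_ge0 ?ler1n ?expn_gt0//.
    by have KK := K2; lra.
  rewrite ler_wpM2r//; rewrite /x; case: ifPn => [/eqP ->|i1].
    by rewrite expn1/= /n_ eqxx mul1r expr0 add0r mulr1 mulr1 /a.
  case: ifPn => [/eqP ->|i2]; last first.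
    apply: varsum1_le; rewrite ?expn_gt0 ?(ltW w1) ?w0// => k; rewrite /n_.
    by case: ifP => // /eqP ->; rewrite ler1n.
  rewrite /= /n_/= add0r mulr1 muln0 expr0 mul1r (_ : (2 ^ 2 = 2 * 2)%N)// a_double /a muln1.
  have s2 : 0 <= w ^+ 2 by rewrite exprn_ge0.
  have s4 : w ^+ (2 * 2) <= w ^+ 2 by rewrite ler_wiXn2l// ltW.
  have s1 : 0 <= 1 - w ^+ 2 by rewrite subr_ge0 expr_le1// ltW.
  have := ler_wpM2l s1 s4; lra.
elim: i i0 H => [//|i IH] _ H.
have [b0 [Beq bsq]] := H i (ltnSn _).
have [i0|i0] := posnP i.
  move: b0 Beq bsq; rewrite i0 expn0 muln1 expn1 B1 mulr0 add0r => b0 -> bsq; split=> [|]; first exact: b0.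
  apply: le_trans bsq; rewrite ler_pM2l// /x/= mul1r.
  have -> : a 2 = a 1 * (1 + w) by have := a_double 1; rewrite muln1 expr1.
  rewrite /e /Ex /a expr1.
  have w1m : 0 <= 1 - w by rewrite subr_ge0 ltW.
  have h1 : (1 - w) * (1 + w) <= (1 - w) * 2 by rewrite ler_wpM2l// -natr1 addrC lerD2r ltW.
  have KK := K2.
  apply: (@le_trans _ _ ((1 - w) * 2 * (1 + (2%:R - 1) * (2 * K - 1)))).
    by rewrite ler_wpM2r//; lra.
  rewrite [leRHS](_ : _ = (1 - w) * 2 * (2 * K + 2)); last by ring.
  by rewrite ler_wpM2l ?mulr_ge0//; lra.
have {IH} [Bi0 Bi] := IH i0 (fun l li => H l (ltnW li)).
rewrite expnS; move: Beq; set j := (2 ^ i)%N in b0 bsq Bi0 Bi *; set q := w ^+ j => Beq.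
have q0 : 0 <= q by rewrite exprn_ge0.
split; first by rewrite Beq addr_gt0// mulr_gt0// ltr_pwDl.
have j2 : (2 <= j)%N by rewrite /j -[X in (X <= _)%N]expn1 leq_exp2l.
have jR : 2 <= j%:R :> R by rewrite ler_nat.
have aj := a_gt0 (ltnW j2).
have KK := K2.
have E0 : 0 < Ex j by rewrite /Ex ltr_wpDr// mulr_ge0//; lra.
have eE : Ex (2 * j) <= e j.
  rewrite /Ex /e natrM; have : 0 <= 4 * j%:R - 2 :> R by lra.
  lra.
have E20 : 0 < Ex (2 * j) by rewrite /Ex natrM ltr_wpDr// mulr_ge0//; lra.
have xi0 : 0 < x i.+1 by rewrite /x eqSS; case: ifP => // _; case: ifP => // _; rewrite ltr0n.
(* From [j = 8] on this follows from [Ex (2j) <= 4 Ex j] and [2j + 1 <= 2 (j + 1)]; at [j = 2] and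
   [j = 4] the special values of [x] enter. *)
have core : x i.+1 ^+ 2 * Ex (2 * j) <= 16 * (x i * Ex j * j.+1%:R).
  have EE : Ex (2 * j) <= 4 * Ex j.
    rewrite /Ex natrM.
    have : 0 <= (2 * j%:R - 3) * (2 * K - 1) by rewrite mulr_ge0//; lra.
    by lra.
  clear H Beq b0 bsq Bi0 Bi q q0 aj eE xi0 j2.
  move: E0 E20 EE jR; rewrite {}/j; case: i i0 => [//|[|[|i]]] _ E0 E20 EE jR.
  - by rewrite /x/= /Ex !natrM expn1; lra.
  - by rewrite /x/= /Ex (_ : (2 ^ 2 = 4)%N)// (_ : (2 * 4 = 8)%N)//; lra.
  - rewrite /x/= [(2 ^ i.+4)%N]expnS; set j := (2 ^ i.+3)%N in E0 E20 EE jR *.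
    have h1 : (2 * j).+1%:R <= 2 * j.+1%:R :> R by rewrite -natrM ler_nat mulnS addnC addn2.
    have h2 : (2 * j).+1%:R ^+ 2 <= (2 * j.+1%:R) ^+ 2 :> R by rewrite ler_sqr ?nnegrE ?mulr_ge0.
    apply: (@le_trans _ _ ((2 * j.+1%:R) ^+ 2 * (4 * Ex j))).
      by rewrite ler_pM// ?exprn_ge0// ltW.
    by rewrite le_eqVlt; apply/orP; left; apply/eqP; ring.
have Bb : C * (x i.+1 * a j * Ex (2 * j)) / 4 <= B j * beta j.
  apply: sqr_le_mul; [exact: ltW|exact: ltW|].
  apply: (@le_trans _ _ ((C * (x i * a j * Ex j)) * (C * (j.+1%:R * a j * e j)))); last first.
    have t1 : 0 <= C * (x i * a j * Ex j).
      have xi : 0 <= x i by rewrite /x; case: ifP => // _; case: ifP.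
      by rewrite mulr_ge0 ?(ltW C0)// !mulr_ge0// ltW.
    have t2 : 0 <= C * (j.+1%:R * a j * e j).
      by rewrite mulr_ge0 ?(ltW C0)// !mulr_ge0// ?(ltW aj)// (le_trans (ltW E20)).
    exact: ler_pM.
  have f0 : 0 <= (C * a j) ^+ 2 / 16 * Ex (2 * j) by rewrite !mulr_ge0 ?sqr_ge0// ltW.
  have f1 : 0 <= C ^+ 2 * a j ^+ 2 * (x i * Ex j * j.+1%:R).
    have xi : 0 <= x i by rewrite /x; case: ifP => // _; case: ifP.
    by rewrite !mulr_ge0 ?sqr_ge0// ltW.
  have c1 := ler_wpM2l f0 core.
  have c2 := ler_wpM2l f1 eE.
  have -> : (C * (x i.+1 * a j * Ex (2 * j)) / 4) ^+ 2 =
     (C * a j) ^+ 2 / 16 * Ex (2 * j) * (x i.+1 ^+ 2 * Ex (2 * j)) by field.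
  apply: (le_trans c1).
  have -> : (C * a j) ^+ 2 / 16 * Ex (2 * j) * (16 * (x i * Ex j * j.+1%:R)) =
     C ^+ 2 * a j ^+ 2 * (x i * Ex j * j.+1%:R) * Ex (2 * j) by field.
  apply: (le_trans c2).
  by rewrite le_eqVlt; apply/orP; left; apply/eqP; ring.
rewrite Beq a_double -/q.
apply: (@le_trans _ _ (4 * (1 + q) * (B j * beta j))).
  have q10 : 0 <= 4 * (1 + q) by rewrite mulr_ge0// addr_ge0.
  have := ler_wpM2l q10 Bb; lra.
have := sqr_ge0 ((1 + q) * B j - beta j); lra.
Qed.

End budget.

(** * Conditional laws and the law of the Gaussian chain *)

Section constant_kernel.
Context d (W : measurableType d) {R : realType} (nu : {finite_measure set W -> \bar R}).

(** A measure viewed as a kernel from a point, so that mixing a kernel over it is a composition of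
    kernels. *)
Definition kconst (_ : unit) : {measure set W -> \bar R} := nu.

Let kconst_measurable A : measurable A -> measurable_fun setT (kconst ^~ A).
Proof. move=> mA; exact: (@measurable_cst _ _ _ _ setT (nu A)). Qed.

HB.instance Definition _ := isKernel.Build _ _ unit W R kconst kconst_measurable.

Let kconst_uub : measure_fam_uub kconst.
Proof.
exists (fine (nu setT) + 1) => x; rewrite /kconst EFinD fineK; last exact: (fin_num_measure nu).
by rewrite lteDl ?lte01//; exact: (fin_num_measure nu).
Qed.

HB.instance Definition _ := Kernel_isFinite.Build _ _ unit W R kconst kconst_uub.

End constant_kernel.

Section conditional_law.
Context d1 d2 (W : measurableType d1) (X : measurableType d2) {R : realType}
  (P : probability W R) (f : W -> X) (Q : R.-pker X ~> W).
Hypotheses (mf : measurable_fun setT f) (PQ : is_cond_law P f Q).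
Local Open Scope ereal_scope.

(** Extends [is_cond_law] from events to integrands: mixing [Q (f w)] over [P] restricted to the
    event that [f w] lies in [A] gives this restricted measure back. *)
Lemma cond_law_integral (A : set X) (k : W -> \bar R) : measurable A ->
  measurable_fun setT k -> (forall w, 0 <= k w) ->
  \int[P]_w ((\1_A (f w))%:E * \int[Q (f w)]_w' k w') = \int[P]_w ((\1_A (f w))%:E * k w).
Proof.
move=> mA mk k0; pose D := f @^-1` A.
have mD : measurable D by rewrite -[D]setTI; exact: mf.
have nuE (nu := mrestr P mD) B : measurable B -> nu B = \int[P]_(w in B) (\1_D w)%:E.
  by move=> mB; rewrite integral_indic// setIC.
have m1D : measurable_fun setT (\1_D : W -> R) by exact: measurable_indic.
have ind0 w : (0 <= \1_D w :> R)%R by rewrite indicE.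
have mQk : measurable_fun setT (fun w => \int[Q (f w)]_w' k w').
  have h : measurable_fun setT (fun x => \int[Q x]_w' k w').
    by apply: measurable_fun_integral_kernel => // U mU; exact: (measurable_kernel Q).
  exact: (measurableT_comp h mf).
have finnu : fin_num_fun (mrestr P mD).
  by move=> B mB; rewrite /mrestr; apply: fin_num_measure; exact: measurableI.
pose nu : {finite_measure set W -> \bar R} := HB.pack (mrestr P mD) (Measure_isFinite.Build _ _ _ (mrestr P mD) finnu).
have den (h : W -> \bar R) : measurable_fun setT h -> (forall w, 0 <= h w) ->
    \int[P]_w ((\1_A (f w))%:E * h w) = \int[nu]_w h w.
  move=> mh h0; rewrite (ge0_integral_density m1D ind0 nuE)//.
  by apply: eq_integral => w _; rewrite muleC.
rewrite !den//; last by move=> w; exact: integral_ge0.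
pose l := @kconst _ W R nu.
have mfs : measurable_fun setT (fun z : unit * W => f z.2) by exact: (measurableT_comp mf).
pose q := kpullback Q mfs.
rewrite -(@integral_kcomp _ _ _ unit W W R l q tt k k0 mk).
apply: eq_measure_integral => B mB _.
have mQB : measurable_fun setT (fun w => Q (f w) B).
  exact: (measurableT_comp (measurable_kernel Q _ mB) mf).
transitivity (\int[nu]_w Q (f w) B); first by [].
transitivity (P (B `&` f @^-1` A)); last by [].
rewrite setIC (PQ mA mB) -den// [RHS]integral_mkcond/=; apply: eq_integral => w _.
rewrite patchE indicE; have [fA|fA] := boolP (f w \in A).
  by rewrite mul1e mem_set//= -in_setE.
by rewrite mul0e memNset// => h; move: fA; rewrite mem_set.
Qed.

End conditional_law.

Section iprod_facts.
Context {R : realType} d (T : measurableType d).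
Local Open Scope ereal_scope.

Lemma integral_iprodS n (P : 'I_n.+1 -> probability T R) (F : n.+1.-tuple T -> \bar R) :
  measurable_fun setT F -> (forall t, 0 <= F t) ->
  \int[iprod P]_t F t =
  \int[P ord0]_x \int[iprod (fun i => P (lift ord0 i))]_t F (tuple_cons (x, t)).
Proof.
move=> mF F0; rewrite /= /distribution.
rewrite ge0_integral_pushforward//.
rewrite preimage_setT.
apply: (@fubini_tonelli1 _ _ _ _ _ (P ord0) (iprod (fun i => P (lift ord0 i))) (F \o @tuple_cons _ T n)).
  exact: (measurableT_comp mF (@measurable_tuple_cons _ T n)).
by move=> x; exact: F0.
Qed.

Lemma integral_iprod0 (P : 'I_0 -> probability T R) (F : 0.-tuple T -> \bar R) :
  \int[iprod P]_t F t = F [tuple].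
Proof.
transitivity (\int[iprod P]_t F [tuple]); last exact: integral_prob_cst.
by apply: eq_integral => t _; rewrite (tuple0 t).
Qed.

Lemma iprod_rect n (P : 'I_n -> probability T R) (A : 'I_n -> set T) :
  (forall i, measurable (A i)) ->
  iprod P [set t | forall i, A i (tnth t i)] = \prod_(i < n) P i (A i).
Proof.
elim: n P A => [|n IH] P A mA.
  rewrite big_ord0 (_ : [set t | _] = setT); first exact: probability_setT.
  by apply/seteqP; split => // t _ [].
rewrite big_ord_recl -(IH _ (fun i => A (lift ord0 i)))//= /distribution /pushforward.
rewrite -product_measure1E//; last first.
  rewrite (_ : [set t | _] = \bigcap_(i in [set: 'I_n]) (fun t : n.-tuple T => tnth t i) @^-1` (A (lift ord0 i))).
    apply: fin_bigcap_measurable => [|i _]; first exact: finite_finset.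
    by rewrite -[X in measurable X]setTI; exact: (measurable_tnth i).
  by apply/seteqP; split => t /= h i; [move=> _|]; exact: h.
congr (product_measure1 _ _ _); apply/seteqP; split => [[x t] /= h|[x t] /= [h0 h] i].
  split; first exact: (h ord0).
  by move=> i; have := h (lift ord0 i); rewrite tnthS.
by case: (unliftP ord0 i) => [j ->|->]//; rewrite tnthS.
Qed.

End iprod_facts.

Section gaussian_chain.
Context {R : realType} (d : nat).
Local Notation U := 'rV[R]_d.
Local Notation g := (@gauss R d).
Variable w : R.
Hypothesis w01 : (0 <= w <= 1)%R.
Local Notation iG n := (iprod (fun _ : 'I_n => g)).
Local Open Scope ereal_scope.

Lemma nth_walk (s : seq U) u i : (i <= size s)%N ->
  nth 0%R (u :: scanl (correlate w) u s) i = corr_seq w (nth 0%R (u :: s)) i.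
Proof.
elim: s u i => [|v s IH] u [|i]// si.
rewrite [LHS]/= -[_ :: _]/(correlate w u v :: scanl (correlate w) (correlate w u v) s) IH//.
elim: i {si} => [//|i IHi].
exact: (congr1 (fun z => correlate w z (nth 0%R s i)) IHi).
Qed.

Lemma corr_chain_walk n u (t : n.-tuple U) :
  corr_chain w (tuple_cons (u, t)) = u :: scanl (correlate w) u t :> seq U.
Proof.
apply: (@eq_from_nth _ 0%R); first by rewrite size_tuple/= size_scanl size_tuple.
move=> i; rewrite size_tuple => ni; rewrite nth_walk ?size_tuple//.
by rewrite (nth_map (Ordinal ni)) ?size_enum_ord// nth_enum_ord.
Qed.

Lemma measurable_walk n i (d' : measure_display) (X : measurableType d') (f : X -> U) (h : X -> n.-tuple U) :
  measurable_fun setT f -> measurable_fun setT h ->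
  (i <= n)%N ->
  measurable_fun setT (fun x => nth 0%R (f x :: scanl (correlate w) (f x) (h x)) i).
Proof.
move=> mf mh ni; have ni' : (i < n.+1)%N by [].
under eq_fun do rewrite -corr_chain_walk -(tnth_nth _ _ (Ordinal ni')).
apply: (measurableT_comp (measurable_tnth _)).
apply: (measurableT_comp (measurable_corr_chain w (k := n.+1))).
apply: (measurableT_comp (@measurable_tuple_cons _ U n)).
exact: measurable_fun_pair.
Qed.

Lemma integral_chain n (F : n.+1.-tuple U -> \bar R) : measurable_fun setT F ->
  (forall t, 0 <= F t) ->
  \int[gauss_chain d w n.+1]_us F us =
  \int[g]_u \int[iG n]_t F (corr_chain w (tuple_cons (u, t))).
Proof.
move=> mF F0; rewrite /gauss_chain /distribution.
rewrite ge0_integral_pushforward//.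
rewrite preimage_setT; apply: (integral_iprodS _ (F := F \o corr_chain w (k:=n.+1))).
  exact: (measurableT_comp mF (measurable_corr_chain w (k := n.+1))).
by move=> t; exact: F0.
Qed.

(** The semigroup law iterated; it identifies the correlation [w^n] of the two endpoints. *)
Lemma walk_last n u (k : U -> \bar R) : measurable_fun setT k -> (forall v, 0 <= k v) ->
  \int[iG n]_t k (last u (scanl (correlate w) u t)) = \int[g]_v k (correlate (w ^+ n) u v).
Proof.
move=> mk k0; elim: n u => [|n IH] u.
  rewrite integral_iprod0/=; transitivity (\int[g]_v k u); first by rewrite integral_prob_cst.
  by apply: eq_integral => v _; rewrite /correlate expr0 expr1n subrr sqrtr0 scale1r scale0r addr0.
have wn : (0 <= w ^+ n <= 1)%R.
  by case/andP: w01 => w0 w1; rewrite exprn_ge0// exprn_ile1.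
rewrite exprSr -(correlate_comp u w01 wn mk k0) integral_iprodS//.
  by apply: eq_integral => v _; rewrite -IH.
apply: (measurableT_comp mk).
rewrite (_ : (fun _ => _) = fun t : n.+1.-tuple U => nth 0%R (u :: scanl (correlate w) u t) n.+1).
  exact: (@measurable_walk n.+1 n.+1 _ _ (cst u) id).
by apply/funext => t; rewrite -[last _ _]/(last 0%R (u :: scanl (correlate w) u t)) -nth_last/= size_scanl size_tuple.
Qed.

Lemma gauss_chain_endpoints n (F : U * U -> \bar R) : measurable_fun setT F -> (forall z, 0 <= F z) ->
  \int[gauss_chain d w n.+1]_us F (endpoints us) = \int[gauss_pair d (w ^+ n)]_z F z.
Proof.
move=> mF F0.
have mlast : measurable_fun setT (fun us : n.+1.-tuple U => endpoints us).
  apply: measurable_fun_pair.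
    rewrite (_ : (fun _ => _) = fun us : n.+1.-tuple U => tnth us ord0); first exact: measurable_tnth.
    by apply/funext => us; rewrite (tnth_nth 0%R) nth0.
  rewrite (_ : (fun _ => _) = fun us : n.+1.-tuple U => tnth us ord_max); first exact: measurable_tnth.
  by apply/funext => us; rewrite (tnth_nth 0%R) -nth_last size_tuple.
rewrite integral_chain//; last exact: (measurableT_comp mF mlast).
transitivity (\int[g]_u \int[g]_v F (u, correlate (w ^+ n) u v)); last first.
  have mc := measurable_corr_pair (d := d) (w ^+ n).
  have := @ge0_integral_pushforward _ _ _ _ R _ mc (g \x g) setT F measurableT mF (fun z _ => F0 z).
  rewrite preimage_setT => push; apply: (eq_trans _ (esym push)).
  apply/esym; apply: (@fubini_tonelli1 _ _ _ _ _ g g (F \o corr_pair (w ^+ n))).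
    exact: (measurableT_comp mF mc).
  by move=> z; exact: F0.
apply: eq_integral => u _.
rewrite -(@walk_last n u (fun v => F (u, v)))//; last exact: (measurableT_comp mF (pair1_measurable u)).
by apply: eq_integral => t _; rewrite /endpoints corr_chain_walk.
Qed.

End gaussian_chain.

Section chain_integral.
Context {R : realType} (d : nat).
Local Notation U := 'rV[R]_d.
Local Notation g := (@gauss R d).
Local Notation iG n := (iprod (fun _ : 'I_n => g)).
Variable w : R.
Local Notation one := (fun _ : U => 1 : R).

Definition pprod (fs : seq (U -> R)) (us : seq U) : R :=
  \prod_(i < size fs) nth one fs i (nth 0 us i).

Lemma pprod_cons f fs u us : pprod (f :: fs) (u :: us) = f u * pprod fs us.
Proof. by rewrite /pprod big_ord_recl. Qed.

Lemma good_nth fs i : good_funs fs -> good_fun (nth one fs i).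
Proof.
elim: fs i => [|f fs IH] [|i] /=; rewrite ?nth_nil.
- by move=> _; split => //; exact: bm_cst.
- by move=> _; split => //; exact: bm_cst.
- by case.
- by case=> _; exact: IH.
Qed.

Lemma pprod_ge0 fs us : good_funs fs -> 0 <= pprod fs us.
Proof. by move=> gfs; apply: prodr_ge0 => i _; case: (good_nth i gfs) => _; apply. Qed.

Let measurable_pprod_walk n fs u : size fs = n.+1 -> good_funs fs ->
  measurable_fun setT (fun t : n.-tuple U => pprod fs (u :: scanl (correlate w) u t)).
Proof.
move=> sfs gfs; apply: measurable_prod => i _.
case: (good_nth i gfs) => -[mf _] _.
apply: (measurableT_comp mf).
apply: (@measurable_walk R d w n i _ _ (cst u) id) => //.
by rewrite -ltnS -sfs ltn_ord.
Qed.

Let measurable_last_walk n u : measurable_fun setT (fun t : n.-tuple U => last u (scanl (correlate w) u t)).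
Proof.
rewrite (_ : (fun _ => _) = fun t : n.-tuple U => nth 0%R (u :: scanl (correlate w) u t) n).
  exact: (@measurable_walk R d w n n _ _ (cst u) id).
by apply/funext => t; rewrite -[last _ _]/(last 0%R (u :: scanl (correlate w) u t)) -nth_last/= size_scanl size_tuple.
Qed.

(** Justifies reading [chain] as a conditional expectation given the first direction. *)
Lemma integral_walk n h fs u : size fs = n.+1 -> good_fun h -> good_funs fs ->
  (\int[iG n]_t (h (last u (scanl (correlate w) u t)) *
     pprod fs (u :: scanl (correlate w) u t))%:E = (chain w h fs u)%:E)%E.
Proof.
case: fs => [//|f fs] [sfs] gh gfs.
elim: n f fs u sfs gfs => [|n IH] f fs u.
  move=> /size0nil -> gfs; rewrite integral_iprod0/= pprod_cons /pprod big_ord0.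
  by rewrite mulr1 mulrC.
case: fs => [//|f' fs] [sfs] gfs.
rewrite integral_iprodS; last 2 first.
- apply/measurable_EFinP; apply: measurable_funM; last by apply: (@measurable_pprod_walk n.+1 (f :: f' :: fs)) => //=; rewrite sfs.
  by case: gh => -[mh _] _; exact: (measurableT_comp mh (@measurable_last_walk n.+1 u)).
- by move=> t; rewrite lee_fin mulr_ge0 ?pprod_ge0//; case: gh.
have gfs' : good_funs (f' :: fs) by case: gfs.
have [bc c0] := good_chain w gh gfs'.
rewrite [chain _ _ _ _]/= -/(chain w h (f' :: fs)) /noise -E_Z; last exact: bm_correlate1.
rewrite -EFin_E; last by apply: bmZ; exact: bm_correlate1.
apply: eq_integral => v _; rewrite [RHS]EFinM -(IH f' fs _ sfs gfs').
have fu0 : 0 <= f u by case: gfs => -[_].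
rewrite -ge0_integralZl_EFin//.
- by apply: eq_integral => t _; rewrite /= pprod_cons -EFinM mulrCA.
- by move=> t _; rewrite lee_fin mulr_ge0 ?pprod_ge0//; case: gh.
apply/measurable_EFinP; apply: measurable_funM; last by apply: (@measurable_pprod_walk n (f' :: fs)) => //=; rewrite sfs.
by case: gh => -[mh _] _; exact: (measurableT_comp mh (@measurable_last_walk n _)).
Qed.

Lemma gauss_chain_pprod n h1 h fs : size fs = n.+1 -> good_fun h1 -> good_fun h -> good_funs fs ->
  (\int[gauss_chain d w n.+1]_us (h1 (head 0 us) * (h (last 0 us) * pprod fs us))%:E =
   (\int[g]_u (h1 u * chain w h fs u))%R%:E)%E.
Proof.
move=> sfs gh1 gh gfs; have [bc c0] := good_chain w gh gfs.
have mnth i : (i <= n)%N -> measurable_fun setT (fun us : n.+1.-tuple U => nth 0 us i).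
  move=> ni; have ni' : (i < n.+1)%N by [].
  under eq_fun do rewrite -(tnth_nth _ _ (Ordinal ni')).
  exact: measurable_tnth.
rewrite integral_chain; last 2 first.
- apply/measurable_EFinP; apply: measurable_funM.
    case: gh1 => -[mh _] _; apply: (measurableT_comp mh).
    by under eq_fun do rewrite -nth0; exact: mnth.
  apply: measurable_funM.
    case: gh => -[mh _] _; apply: (measurableT_comp mh).
    by under eq_fun do rewrite -nth_last size_tuple; exact: mnth.
  apply: measurable_prod => i _; case: (good_nth i gfs) => -[mf _] _.
  by apply: (measurableT_comp mf); apply: mnth; rewrite -ltnS -sfs ltn_ord.
- move=> t; rewrite lee_fin mulr_ge0//; first by case: gh1.
  by rewrite mulr_ge0 ?pprod_ge0//; case: gh.
rewrite -EFin_E; last by apply: bmM => //; case: gh1.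
apply: eq_integral => u _; rewrite [RHS]EFinM -(integral_walk u sfs gh gfs).
have h10 : 0 <= h1 u by case: gh1.
rewrite -ge0_integralZl_EFin//.
- by apply: eq_integral => t _; rewrite corr_chain_walk -EFinM.
- by move=> t _; rewrite lee_fin mulr_ge0 ?pprod_ge0//; case: gh.
apply/measurable_EFinP; apply: measurable_funM; last exact: measurable_pprod_walk.
by case: gh => -[mh _] _; exact: (measurableT_comp mh (@measurable_last_walk n _)).
Qed.

Lemma measurable_pprod n fs : size fs = n.+1 -> good_funs fs ->
  measurable_fun setT (fun us : n.+1.-tuple U => pprod fs us).
Proof.
move=> sfs gfs; apply: measurable_prod => i _; case: (good_nth i gfs) => -[mf _] _.
apply: (measurableT_comp mf); have ni : (i < n.+1)%N by rewrite -sfs ltn_ord.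
under eq_fun do rewrite -(tnth_nth _ _ (Ordinal ni)).
exact: measurable_tnth.
Qed.

End chain_integral.

(** * Hop probabilities of a matching cover *)

Section cover_facts.
Context {R : realType} (d : nat) (V : {fset 'rV[R]_d}).
Local Notation U := 'rV[R]_d.
Local Notation GM := (gmatching V).

(** There are countably many generalized matchings, so a set of null points is null. *)
Lemma countable_pos (nu : {measure set GM -> \bar R}) (A : set GM) :
  (0 < nu A)%E -> exists2 N, A N & in_support nu N.
Proof.
move=> Apos; apply: contrapT => h.
have A0 N : A N -> nu [set N] = 0%E.
  move=> AN; apply/eqP; rewrite eq_le measure_ge0 andbT leNgt; apply/negP => pos.
  by apply: h; exists N.
pose F (n : nat) : set GM := if choice.unpickle n is Some N then [set N] `&` A else set0.
have AE : A = (\bigcup_n F n)%classic.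
  apply/seteqP; split => [N AN|N [n _]].
    by exists (choice.pickle N) => //; rewrite /F choice.pickleK.
  by rewrite /F; case: choice.unpickle => [N' [-> //]|//].
suff : nu A = 0%E by move=> E; move: Apos; rewrite E ltxx.
rewrite AE; apply/measure_negligible => //; apply: negligible_bigcup => n.
rewrite /F; case: (choice.unpickle n) => [N|]; last exact: negligible_set0.
have [AN|nAN] := pselect (A N); first by exists [set N]; split; [by []|exact: A0|move=> ? []].
by exists set0; split; [by []|exact: measure0|move=> N' [-> ]].
Qed.

Variables (Delta sigma : R) (Matching M : matching_cover V).
Hypotheses (D0 : 0 < Delta) (oneM : one_hop Delta Matching)
  (strM : stretched Delta sigma Matching) (skewM : skew_symmetric M)
  (subM : subcover M Matching).

(** The coupling is concentrated on inclusions: if the supersets of [N] were null for [Matching u],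
    then [N] would be null for [M u]. *)
Lemma subcover_support u N : in_support (M u) N ->
  exists2 N', in_support (Matching u) N' & (gm_paths N `<=` gm_paths N')%fset.
Proof.
move=> MN; have [C [C1 C2 C3]] := subM u.
suff pos : (0 < Matching u [set N' | (gm_paths N `<=` gm_paths N')%fset])%E.
  by have [N' NN' sN'] := countable_pos pos; exists N'.
apply: (lt_le_trans MN); rewrite -C1 -C2.
pose S := [set NN : GM * GM | (gm_paths NN.1 `<=` gm_paths NN.2)%fset].
have mAny (B : set (GM * GM)) : measurable B.
  have -> : B = \bigcup_N' ([set N'] `*` [set N2 | B (N', N2)]).
    by apply/seteqP; split => [[a b] Bab|[a b] [c _ [/= -> //]]]; exists a.
  by apply: countable_bigcupT_measurable => // N'; exact: measurableX.
have CS : C (~` S) = 0%E.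
  by rewrite probability_setC// C3 subee.
have sub : [set N] `*` setT `<=` (setT `*` [set N' | (gm_paths N `<=` gm_paths N')%fset]) `|` ~` S.
  move=> [a b] /= [-> _]; have [ab|ab] := boolP (gm_paths N `<=` gm_paths b)%fset; first by left.
  by right; rewrite /S/=; exact/negP.
apply: (le_trans (le_measure C _ _ sub)); rewrite ?inE//.
apply: (le_trans (measureU2 _ _ _)) => //.
by rewrite [X in (_ + X)%E]CS adde0.
Qed.

Lemma support_hop u N p : in_support (M u) N -> p \in gm_paths N ->
  exists x y : V, [/\ p = [:: x; y], sqnorm (val y - val x) <= Delta &
    sigma <= dot (val y - val x) u].
Proof.
move=> /subcover_support[N' sN' /fsubsetP sub] pN; have pN' := sub _ pN.
have [x [y [pE xy]]] := oneM sN' pN'; exists x, y; split => //.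
have := strM sN' pN'; rewrite pE /displacement/=; apply.
(* A single hop is nonviolating: its only infix with a step is itself, and the violation inequality
   would force [Delta <= 0]. *)
move=> [q [qi sq]].
have qE : q = [:: x; y].
  have key na nq nb : (1 < nq)%N -> 2%N = (na + (nq + nb))%N -> na = 0%N /\ nb = 0%N by lia.
  case/infixP: qi => a [b E]; have := congr1 size E; rewrite !size_cat /= => sE.
  have [a0 b0] := key _ _ _ sq sE.
  by move: E; rewrite (size0nil a0) (size0nil b0) cats0.
rewrite qE /displacement /= big_nat1 /=.
by rewrite lerBrDr gerDl leNgt D0.
Qed.

Definition hopset (x y : V) : set GM := [set N | [:: x; y] \in gm_paths N].

Definition hop_prob (x y : V) (u : U) : R := fine (M u (hopset x y)).

Let Mfin u (A : set GM) : M u A \is a fin_num.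
Proof. exact: (fin_num_measure (kernel_at M u)). Qed.

Lemma hop_probE x y u : (hop_prob x y u)%:E = M u (hopset x y).
Proof. by rewrite /hop_prob fineK. Qed.

Lemma hop_prob_ge0 x y u : 0 <= hop_prob x y u.
Proof. by rewrite /hop_prob fine_ge0. Qed.

Let ind (x y : V) (N : GM) : R := ([:: x; y] \in gm_paths N)%:R.

Let bm_ind x y : bm (ind x y).
Proof.
split; first by move=> _ A mA.
by exists 1 => N; rewrite /ind; case: (_ \in _); rewrite ?normr1 ?normr0.
Qed.

Let hop_prob_ind x y u : hop_prob x y u = (\int[kernel_at M u]_N ind x y N)%R.
Proof.
apply: EFin_inj; rewrite hop_probE -EFin_E; last exact: bm_ind.
transitivity (\int[kernel_at M u]_N (\1_(hopset x y) N)%:E)%E.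
  by rewrite integral_indic// setIT.
apply: eq_integral => N _; rewrite indicE /ind; congr (_%:R)%:E.
by congr nat_of_bool; apply/idP/idP => [/set_mem|h]; [|exact/mem_set].
Qed.

(** A generalized matching has at most one path starting at [x], so the events [hopset x y] are
    disjoint in [y]. *)
Lemma hop_prob_sum x u : \sum_y hop_prob x y u <= 1.
Proof.
under eq_bigr do rewrite hop_prob_ind.
rewrite -E_sum; last by move=> y; exact: bm_ind.
rewrite -[leRHS](E_cst (kernel_at M u)); apply: E_le.
- by apply: bm_sum => y; exact: bm_ind.
- exact: bm_cst.
move=> N; have [[y yN]|nN] := pselect (exists y, [:: x; y] \in gm_paths N); last first.
  by rewrite big1// => y _; rewrite /ind; case: (boolP ([:: x; y] \in _)) => // yN; case: nN; exists y.
rewrite (bigD1 y)//= big1 ?addr0; first by rewrite /ind yN.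
move=> y' y'y; rewrite /ind; case: (boolP ([:: x; y'] \in _)) => // y'N.
have /is_gmatchingP[_ fN _] := gm_is_gmatching N.
by have := fN _ _ yN y'N erefl => -[yy']; rewrite yy' eqxx in y'y.
Qed.

Lemma bm_hop_prob x y : bm (hop_prob x y).
Proof.
apply: (@bm_ge0 _ _ _ _ 1).
  apply: measurableT_comp => //; exact: (measurable_kernel M).
move=> u; rewrite hop_prob_ge0/= (le_trans _ (hop_prob_sum x u))//.
by rewrite (bigD1 y)//= lerDl; apply: sumr_ge0 => *; exact: hop_prob_ge0.
Qed.

Lemma hop_prob_skew x y u : hop_prob x y u = hop_prob y x (- u).
Proof.
rewrite /hop_prob skewM; congr (fine (M _ _)); apply/seteqP; split => N /=.
  by move=> /imfsetP[p /= pN E]; rewrite /hopset/= -[[:: y; x]]/(rev [:: x; y]) E revK.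
by move=> h; apply/imfsetP; exists [:: y; x].
Qed.

Lemma hop_prob_neq0 x y u : hop_prob x y u != 0 ->
  sqnorm (val y - val x) <= Delta /\ sigma <= dot (val y - val x) u.
Proof.
move=> h; have pos : (0 < kernel_at M u (hopset x y))%E.
  by rewrite /kernel_at -hop_probE lte_fin lt_neqAle eq_sym h hop_prob_ge0.
have [N Nxy sN] := countable_pos pos.
by have [x' [y' [[-> ->]]]] := support_hop sN Nxy.
Qed.

(** Almost every sample consists of hops only, so its cardinality is at most the number of pairs
    [(x, y)] whose hop it contains. *)
Lemma cover_size_le :
  (cover_size M <= (#|` V|%:R^-1 * \sum_x (\int[gauss d]_u \sum_y hop_prob x y u)%R)%:E)%E.
Proof.
rewrite /cover_size EFinM lee_wpmul2l ?lee_fin ?invr_ge0//.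
rewrite -E_sum; last by move=> x; apply: bm_sum => y; exact: bm_hop_prob.
have bs : bm (fun u => \sum_x \sum_y hop_prob x y u).
  by apply: bm_sum => x; apply: bm_sum => y; exact: bm_hop_prob.
rewrite -EFin_E//; apply: ge0_le_integral => //.
- by move=> u _; apply: integral_ge0 => N _; rewrite /npaths lee_fin.
- apply: measurable_fun_integral_kernel => //.
    by move=> A mA; exact: (measurable_kernel M).
  by move=> N; rewrite /npaths lee_fin ler0n.
- by apply/measurable_EFinP; case: bs.
move=> u _.
have -> : (\sum_x \sum_y hop_prob x y u)%:E = (\int[kernel_at M u]_N (\sum_x \sum_y ind x y N)%:E)%E.
  rewrite EFin_E; last by apply: bm_sum => x; apply: bm_sum => y; exact: bm_ind.
  congr EFin; rewrite E_sum; last by move=> x; apply: bm_sum => y; exact: bm_ind.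
  by apply: eq_bigr => x _; rewrite E_sum; [apply: eq_bigr => y _; exact: hop_prob_ind|move=> y; exact: bm_ind].
apply: ae_ge0_le_integral => //.
- move=> N _; rewrite /npaths lee_fin; exact: ler0n.
- by move=> N _; rewrite lee_fin; do 2 (apply: sumr_ge0 => ? _); rewrite ler0n.
pose A := [set N : GM | ~ in_support (M u) N].
exists A; split => //.
  apply/eqP; rewrite eq_le measure_ge0 andbT leNgt; apply/negP => pos.
  by have [N AN sN] := countable_pos pos.
move=> N /= nle; rewrite /A /= => sN; apply: nle => _.
rewrite /npaths lee_fin pair_big/= -natr_sum ler_nat.
pose b (p : V * V) := [:: p.1; p.2] \in gm_paths N.
have -> : (\sum_(p : V * V) ([:: p.1; p.2] \in gm_paths N) = #|[pred p | b p]|)%N.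
  by rewrite -sum1_card [RHS]big_mkcond; apply: eq_bigr => p _; rewrite inE /b; case: ([:: p.1; p.2] \in gm_paths N).
rewrite cardE -(size_map (fun p : V * V => [:: p.1; p.2])).
apply: uniq_leq_size; first exact: fset_uniq.
move=> p pN; have [x [y [pE _ _]]] := support_hop sN pN.
by rewrite pE; apply/mapP; exists (x, y); rewrite // mem_enum inE /b/= -pE.
Qed.

End cover_facts.

(** * From hops to the composed and truncated cover *)

Section comp_paths.
Context {R : realType} (d : nat) (V : {fset 'rV[R]_d}).
Local Notation GM := (gmatching V).

(** The composition is a left fold, hence the induction removes the last hop. *)
Lemma path_in_comps (Ms : seq GM) (p : seq V) : (0 < size Ms)%N -> size p = (size Ms).+1 ->
  (forall i, (i < size Ms)%N -> nth setT (hops (@hopset R d V) p) i (nth (gm0 V) Ms i)) ->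
  p \in gm_paths (gm_comps Ms).
Proof.
elim/last_ind: Ms p => [//|Ms M' IH] p _; rewrite size_rcons.
case/lastP: p => [//|p y]; rewrite size_rcons => -[]; case/lastP: p => [//|p x] sp h.
move: sp; rewrite size_rcons => -[sp].
have hM' : [:: x; y] \in gm_paths M'.
  have := h (size Ms) (ltnSn _); rewrite hops_rcons2 !nth_rcons ltnn eqxx.
  by rewrite size_hops size_rcons/= sp ltnn eqxx.
case: Ms IH sp h hM' => [|M1 Ms] IH sp h hM'.
  by move: sp => /size0nil ->.
rewrite [gm_comps _]/= foldl_rcons -[foldl _ _ _]/(gm_comps (M1 :: Ms)).
have IHp : rcons p x \in gm_paths (gm_comps (M1 :: Ms)).
  apply: IH => //; first by rewrite size_rcons sp.
  move=> i iM; have := h i (ltnW iM : (i < (size (M1 :: Ms)).+1)%N).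
  rewrite hops_rcons2 !nth_rcons size_hops size_rcons [_.-1]/= sp iM.
  by [].
rewrite /= /comp_paths; apply/imfset2P; exists (rcons p x) => //.
exists [:: x; y]; last by rewrite /= cats1.
by rewrite inE hM' /= /path_last rev_rcons.
Qed.

End comp_paths.

Section reduction.
Context {R : realType} (d : nat) (V : {fset 'rV[R]_d}).
Local Notation U := 'rV[R]_d.
Local Notation GM := (gmatching V).
Variables (Delta s : R) (M : matching_cover V) (m : nat) (w : R)
  (Q : R.-pker (U * U) ~> (m.+1.-tuple U)).
Local Notation N := (hop_prob M).
Local Open Scope ereal_scope.

(** The endpoint directions under which [p] survives both truncations; only [u_1] and [u_k]
    matter. *)
Definition kept (p : seq V) : set (U * U) := [set uu | violating Delta p \/
  (s <= dot (displacement p) uu.1 /\ s <= dot (displacement p) uu.2)%R].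

Lemma measurable_kept p : measurable (kept p).
Proof.
have [vp|nvp] := pselect (violating Delta p).
  by rewrite (_ : kept p = setT)//; apply/seteqP; split => // uu _; left.
have mle (f : U * U -> U) : measurable_fun setT f ->
    measurable [set uu | (s <= dot (displacement p) (f uu))%R].
  move=> mf; rewrite -[X in measurable X]setTI.
  apply: (@measurable_fun_ler _ _ _ _ (cst s) (fun uu => dot (displacement p) (f uu))) => //.
  by apply: (measurableT_comp _ mf); exact: measurable_dot.
rewrite (_ : kept p = [set uu | (s <= dot (displacement p) uu.1)%R] `&`
   [set uu | (s <= dot (displacement p) uu.2)%R]).
  by apply: measurableI; apply: mle.
by apply/seteqP; split => uu /= => [[//|[? ?]]|[? ?]]; [split|right; split].
Qed.

Lemma kept_in (p : seq V) uu us (Ms : m.+1.-tuple GM) : kept p uu ->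
  p \in gm_paths (gm_comps Ms) -> p \in gm_paths (truncated_comp Delta s (uu, us, Ms)).
Proof.
case: uu => u1 uk /= kp pM; rewrite !inE /= pM /=.
by case: kp => [vp|[-> ->]]; rewrite ?orbT//; have /asboolP -> := vp.
Qed.

Let hit (p : seq V) : set (m.+1.-tuple GM) :=
  [set Ms | forall i : 'I_m.+1, nth setT (hops (@hopset R d V) p) i (tnth Ms i)].

Let mhit p : measurable (hit p).
Proof.
rewrite (_ : hit p = \bigcap_(i in [set: 'I_m.+1]) (fun t : m.+1.-tuple GM => tnth t i) @^-1`
    (nth setT (hops (@hopset R d V) p) i)).
  apply: fin_bigcap_measurable => [|i _]; first exact: finite_finset.
  by rewrite -[X in measurable X]setTI; exact: (measurable_tnth i).
by apply/seteqP; split => t /= h i; [move=> _|]; exact: h.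
Qed.

Lemma ksample_hit (p : m.+2.-tuple V) us : ksample M us (hit p) = (pprod (hops N p) us)%:E.
Proof.
transitivity (\prod_(i < m.+1) kernel_at M (tnth us i) (nth setT (hops (@hopset R d V) p) i)).
  exact: (@iprod_rect R _ GM m.+1 (fun i => kernel_at M (tnth us i)) (fun i => nth setT (hops (@hopset R d V) p) i)).
rewrite /pprod size_hops size_tuple -prodEFin.
apply: eq_bigr => i _; rewrite -tnth_nth /kernel_at.
have -> : hops N p = [seq (fun u => fine (M u A)) | A <- hops (@hopset R d V) p].
  by rewrite map_hops.
rewrite (nth_map setT) ?size_hops ?size_tuple//=.
by rewrite fineK//; exact: (fin_num_measure (kernel_at M _)).
Qed.

(** Distinct vertex sequences are distinct paths, so every sequence that is fully sampled and kept
    counts once. *)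
Let npaths_ge uu us (Ms : m.+1.-tuple GM) :
  (\sum_(p : m.+2.-tuple V) (\1_(kept p) uu * \1_(hit p) Ms)%R)%R%:E <=
  npaths (truncated_comp Delta s (uu, us, Ms)).
Proof.
rewrite /npaths lee_fin.
pose b (p : m.+2.-tuple V) := (uu \in kept p) && (Ms \in hit p).
have -> : (\sum_(p : m.+2.-tuple V) (\1_(kept p) uu * \1_(hit p) Ms) =
    (\sum_(p : m.+2.-tuple V) b p)%:R :> R)%R.
  by rewrite natr_sum; apply: eq_bigr => p _; rewrite !indicE -natrM mulnb.
rewrite ler_nat.
have -> : (\sum_(p : m.+2.-tuple V) b p = #|[pred p | b p]|)%N.
  by rewrite -sum1_card [RHS]big_mkcond; apply: eq_bigr => p _; rewrite inE; case: (b p).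
rewrite cardE -(size_map val); apply: uniq_leq_size.
  by rewrite map_inj_uniq ?enum_uniq//; exact: val_inj.
move=> _ /mapP[p + ->]; rewrite mem_enum inE => /andP[/set_mem kp /set_mem hp].
apply: kept_in => //; apply: path_in_comps; rewrite ?size_tuple// => i im.
by have := hp (Ordinal im); rewrite (tnth_nth (gm0 V)).
Qed.

Lemma cover_power_ge uu :
  \sum_(p : m.+2.-tuple V) (\1_(kept p) uu)%:E * \int[Q uu]_us (pprod (hops N p) us)%:E <=
  \int[cover_power Delta s M Q uu]_N npaths N.
Proof.
have np0 (N' : GM) : 0 <= npaths N' by rewrite /npaths lee_fin.
have mnp : measurable_fun setT (@npaths R d V) by [].
pose k2 := kbind (kpullback (@ksample _ _ _ _ _ M m.+1) measurable_snd)
    (kdirac (@measurable_truncated_comp R d V Delta s m.+1)) : R.-pker (U * U) * m.+1.-tuple U ~> GM.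
have -> : \int[cover_power Delta s M Q uu]_N npaths N = \int[Q uu]_us \int[k2 (uu, us)]_N npaths N.
  by rewrite /cover_power [LHS]integral_kcomp.
have k2E (us : m.+1.-tuple U) : \int[k2 (uu, us)]_N npaths N =
    \int[ksample M us]_Ms npaths (truncated_comp Delta s (uu, us, Ms)).
  rewrite [LHS]integral_kcomp//; apply: eq_integral => Ms _.
  by rewrite [LHS]integral_dirac// diracT mul1e.
have gfs (p : m.+2.-tuple V) := good_hops (bm_hop_prob M) (hop_prob_ge0 M) p.
have sfs (p : m.+2.-tuple V) : size (hops N p) = m.+1 by rewrite size_hops size_tuple.
have mpp (p : m.+2.-tuple V) := measurable_pprod (sfs p) (gfs p).
have lower (us : m.+1.-tuple U) : \sum_(p : m.+2.-tuple V) (\1_(kept p) uu)%:E * (pprod (hops N p) us)%:E <=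
    \int[k2 (uu, us)]_N npaths N.
  rewrite k2E; pose P := iprod (fun i : 'I_m.+1 => kernel_at M (tnth us i)).
  have bh (p : m.+2.-tuple V) : bm (\1_(hit p) : m.+1.-tuple GM -> R).
    apply: (@bm_ge0 _ _ _ _ 1%R) => [|Ms]; first exact: measurable_indic.
    by rewrite indicE; case: (_ \in _); rewrite ?lexx ?ler01.
  have Eh (p : m.+2.-tuple V) : (\int[P]_Ms \1_(hit p) Ms)%R = pprod (hops N p) us.
    apply: EFin_inj; rewrite -ksample_hit -EFin_E; last exact: bh.
    transitivity (P (hit p `&` setT)); last by rewrite setIT.
    exact: (@integral_indic _ _ R P setT measurableT (hit p) (mhit p)).
  have bk (p : m.+2.-tuple V) := bmZ (\1_(kept p) uu) (bh p).
  apply: (@le_trans _ _ (\int[P]_Ms (\sum_(p : m.+2.-tuple V) (\1_(kept p) uu * \1_(hit p) Ms)%R)%R%:E)).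
    rewrite EFin_E; last exact: bm_sum.
    rewrite E_sum//.
    rewrite sumEFin lee_fin; apply: ler_sum => p _.
    by rewrite (E_Z P (\1_(kept p) uu) (bh p)) Eh.
  apply: ge0_le_integral => //.
  - move=> Ms _; rewrite lee_fin; apply: sumr_ge0 => p _.
    by rewrite !indicE mulr_ge0// ler0n.
  - by apply/measurable_EFinP; have [] := @bm_sum _ _ R _ (index_enum _) xpredT _ bk.
  - apply: (measurableT_comp mnp).
    exact: (measurableT_comp (@measurable_truncated_comp R d V Delta s m.+1) (pair1_measurable (uu, us))).
  - by move=> Ms _; exact: npaths_ge.
have kp0 p : (0 <= \1_(kept p) uu :> R)%R by rewrite indicE ler0n.
have pp0 (p : m.+2.-tuple V) (vs : m.+1.-tuple U) : (0 <= pprod (hops N p) vs)%R by exact: pprod_ge0.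
apply: (@le_trans _ _ (\int[Q uu]_us \sum_(p : m.+2.-tuple V) (\1_(kept p) uu)%:E * (pprod (hops N p) us)%:E)).
  rewrite ge0_integral_sum//; last 2 first.
  - by move=> p; apply: measurable_funeM; apply/measurable_EFinP; exact: mpp.
  - by move=> p us _; rewrite mule_ge0// lee_fin.
  apply: lee_sum => p _; rewrite ge0_integralZl_EFin//.
  - by move=> us _; rewrite lee_fin.
  - by apply/measurable_EFinP; exact: mpp.
apply: ge0_le_integral => //.
- by move=> us _; apply: sume_ge0 => p _; rewrite mule_ge0// lee_fin.
- by apply: emeasurable_sum => p; apply: measurable_funeM; apply/measurable_EFinP; exact: mpp.
- have mk : measurable_fun setT (fun z => \int[k2 z]_N npaths N).
    by apply: measurable_fun_integral_kernel => // A mA; exact: (measurable_kernel k2).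
  exact: (measurableT_comp mk (pair1_measurable uu)).
Qed.

Hypotheses (w01 : (0 <= w <= 1)%R) (PQ : is_cond_law (gauss_chain d w m.+1) (@endpoints R d m.+1) Q).

(** The event [kept] depends on the endpoints alone, so drawing the endpoints and then the chain
    from [Q] may be replaced by drawing the whole chain. *)
Lemma ext_size_ge :
  (#|` V|%:R^-1)%:E * \sum_(p : m.+2.-tuple V)
     \int[gauss_chain d w m.+1]_us (\1_(kept p) (endpoints us) * pprod (hops N p) us)%:E <=
  ext_size (w ^+ m) (cover_power Delta s M Q).
Proof.
have gfs (p : m.+2.-tuple V) := good_hops (bm_hop_prob M) (hop_prob_ge0 M) p.
have sfs (p : m.+2.-tuple V) : size (hops N p) = m.+1 by rewrite size_hops size_tuple.
have mpp (p : m.+2.-tuple V) := measurable_pprod (sfs p) (gfs p).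
have pp0 (p : m.+2.-tuple V) (vs : m.+1.-tuple U) : (0 <= pprod (hops N p) vs)%R by exact: pprod_ge0.
have mE : measurable_fun setT (@endpoints R d m.+1).
  apply: measurable_fun_pair.
    rewrite (_ : (fun _ => _) = fun us : m.+1.-tuple U => tnth us ord0); first exact: measurable_tnth.
    by apply/funext => us; rewrite (tnth_nth 0%R) nth0.
  rewrite (_ : (fun _ => _) = fun us : m.+1.-tuple U => tnth us ord_max); first exact: measurable_tnth.
  by apply/funext => us; rewrite (tnth_nth 0%R) -nth_last size_tuple.
rewrite /ext_size lee_wpmul2l ?lee_fin ?invr_ge0//.
have mQp (p : m.+2.-tuple V) : measurable_fun setT (fun uu => \int[Q uu]_us (pprod (hops N p) us)%:E).
  apply: measurable_fun_integral_kernel => //.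
  - by move=> A mA; exact: (measurable_kernel Q).
  - by move=> us; rewrite lee_fin.
  - by apply/measurable_EFinP; exact: mpp.
have mk (p : m.+2.-tuple V) : measurable_fun setT (fun uu => (\1_(kept p) uu : R)%:E).
  by apply/measurable_EFinP; apply: measurable_indic; exact: measurable_kept.
have t0 (p : m.+2.-tuple V) uu : 0 <= (\1_(kept p) uu : R)%:E * \int[Q uu]_us (pprod (hops N p) us)%:E.
  by rewrite mule_ge0 ?lee_fin ?indicE ?ler0n//; apply: integral_ge0 => us _; rewrite lee_fin.
apply: (@le_trans _ _ (\int[gauss_pair d (w ^+ m)]_uu
    \sum_(p : m.+2.-tuple V) (\1_(kept p) uu)%:E * \int[Q uu]_us (pprod (hops N p) us)%:E)); last first.
  apply: ge0_le_integral => //.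
  - by move=> uu _; apply: sume_ge0.
  - by apply: emeasurable_sum => p; apply: emeasurable_funM.
  - apply: measurable_fun_integral_kernel => //.
      by move=> A mA; exact: (measurable_kernel (cover_power Delta s M Q)).
    by move=> N'; rewrite /npaths lee_fin.
  by move=> uu _; exact: cover_power_ge.
rewrite ge0_integral_sum//; last by move=> p; apply: emeasurable_funM.
apply: lee_sum => p _.
rewrite -(@gauss_chain_endpoints R d w w01 m (fun uu => (\1_(kept p) uu)%:E * \int[Q uu]_us (pprod (hops N p) us)%:E))//; last exact: emeasurable_funM.
rewrite (cond_law_integral mE PQ (k := fun us => (pprod (hops N p) us)%:E))//.
- exact: measurable_kept.
- by apply/measurable_EFinP; exact: mpp.
- by move=> us; rewrite lee_fin.
Qed.

End reduction.

(** * Nonviolating walks stay close, and the loss by truncation *)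

Definition walk_radius {R : realType} (i : nat) : R := if i == 1%N then 1 else i.+1%:R.

Section nonviolating.
Context {R : realType} (d : nat) (V : {fset 'rV[R]_d}).
Variables (Delta : R).
Implicit Types p q : seq V.

Definition short_hop (x y : V) := sqnorm (val y - val x) <= Delta.

(** An infix with [i] hops has squared lengths summing to at most [i Delta], and nonviolation adds
    at most one more [Delta]. A single hop is short by itself, whence the smaller [walk_radius] at
    1. *)
Lemma nonviolating_displacement p q : ~ violating Delta p -> sorted short_hop q ->
  infix q p -> (1 < size q)%N -> sqnorm (displacement q) <= walk_radius (size q).-1 * Delta.
Proof.
move=> nv sq qp q1.
case: q q1 sq qp => [//|x [//|y q]] _ sq qp.
have [q0|q0] := posnP (size q).
  move: sq; rewrite (size0nil q0) /= andbT /walk_radius /= mul1r.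
  by [].
rewrite /walk_radius/= eqSS eqn0Ngt q0/=; rewrite leNgt; apply/negP => h; apply: nv.
exists (x :: y :: q); split => //.
rewrite lerBrDr; apply: le_trans (ltW h).
rewrite -natr1 mulrDl mul1r lerD2r.
have -> : (size q).+1%:R * Delta = \sum_(1 <= j < size (x :: y :: q)) Delta.
  by rewrite big_const_nat subSS subn0 iter_addr_0 mulr_natl.
rewrite big_nat [leRHS]big_nat; apply: ler_sum => -[//|j] /andP[_ jq].
rewrite /points !(nth_map x)//; last exact: ltnW.
by move/(sortedP x): sq; apply.
Qed.

Lemma nearP (n_ : nat -> R) (x0 : V) i (t : seq V) :
  (forall j, (j < size t)%N -> sqnorm (val (nth x0 t j) - val x0) <= n_ (i + j)%N * Delta) ->
  near (fun x : V => val x) Delta n_ x0 i t.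
Proof.
elim: t i => [//|y t IH] i h /=; apply/andP; split.
  by have := h 0%N isT; rewrite addn0.
by apply: IH => j jt; have := h j.+1 jt; rewrite addSnnS.
Qed.

Definition near_path p : bool :=
  if p is x :: t then near (fun x : V => val x) Delta walk_radius x 1 t else true.

Lemma near_path_nonviolating p : ~ violating Delta p -> sorted short_hop p -> near_path p.
Proof.
move=> nv; case: p nv => [//|x t] nv st; apply: nearP => j jt.
have pre := prefix_take (x :: t) j.+2.
have sz : size (take j.+2 (x :: t)) = j.+2 by rewrite size_takel.
have := @nonviolating_displacement _ (take j.+2 (x :: t)) nv.
rewrite sz => /(_ (take_sorted _ st) (prefixW pre) isT).
rewrite /displacement /points -nth_last size_map sz /= (nth_map x) /=.
  by rewrite (take_nth x jt) nth_rcons size_takel ?ltnn ?eqxx// ltnW.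
by rewrite size_takel.
Qed.

(** Distances from the last vertex are displacements of suffixes, which are infixes as well as
    prefixes are. *)
Lemma near_path_rev p : ~ violating Delta p -> sorted short_hop p -> near_path (rev p).
Proof.
case/lastP: p => [//|t z] nv st; rewrite rev_rcons; apply: nearP => j.
rewrite size_rev => jt.
pose q := drop (size t - j.+1) (rcons t z).
have sz : size q = j.+2.
  by rewrite /q size_drop size_rcons subSn ?leq_subr// subKn.
have := @nonviolating_displacement _ q nv (drop_sorted _ st) (suffixW (suffix_drop _ _)).
rewrite sz => /(_ isT).
have hq : nth z q 0 = nth z (rev t) j.
  rewrite /q nth_drop addn0 nth_rcons nth_rev//.
  by rewrite ltn_subrL/= (leq_trans _ jt).
have lq : nth z q j.+1 = z.
  by rewrite /q nth_drop nth_rcons subnK// ltnn eqxx.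
rewrite /displacement /points -nth_last -nth0 size_map sz /=.
rewrite !(nth_map z) ?sz// hq lq -sqnormN opprB.
by [].
Qed.

End nonviolating.

Section unused_paths.
Context {R : realType} (d : nat) (X : finType) (N : X -> X -> 'rV[R]_d -> R) (e : rel X) (w : R).
Hypothesis Ne : forall x y u, ~~ e x y -> N x y u = 0.

Lemma chain_unsorted h p u : ~~ sorted e p -> chain w h (hops N p) u = 0.
Proof.
case: p => [//|x p]; elim: p x u => [//|y p IH] x u.
rewrite [sorted _ _]/= negb_and => /orP[nexy|ns]; first by rewrite /= Ne// mul0r.
case: p IH ns => [//|z p] IH ns.
have c0 : chain w h (hops N (y :: z :: p)) = fun=> 0 by apply/funext => v; exact: IH.
by rewrite -[LHS]/(N x y u * noise w (chain w h (hops N (y :: z :: p))) u) c0 noise_cst mulr0.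
Qed.

End unused_paths.

Section kept_paths.
Context {R : realType} (d : nat) (V : {fset 'rV[R]_d}).
Local Notation U := 'rV[R]_d.
Local Notation g := (@gauss R d).
Local Notation E f := (\int[g]_u f u)%R.
Variables (Delta sigma s w : R) (Matching M : matching_cover V) (m : nat).
Hypotheses (D0 : 0 < Delta) (oneM : one_hop Delta Matching)
  (strM : stretched Delta sigma Matching) (skewM : skew_symmetric M)
  (subM : subcover M Matching) (w01 : 0 <= w <= 1).
Local Notation N := (hop_prob M).
Local Notation pos := (fun x : V => val x).
Local Notation one := (fun _ : U => 1 : R).

Definition short_path (p : seq V) : U -> R :=
  if p is x :: t then short pos s x (last x t) else one.

Let good_one : good_fun one. Proof. by split => //; exact: bm_cst. Qed.

Let good_short_path p : good_fun (short_path p).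
Proof. by case: p => [|x t] //=; exact: good_short. Qed.

Let gfs (p : seq V) : good_funs (hops N p).
Proof. exact: (good_hops (bm_hop_prob M) (hop_prob_ge0 M)). Qed.

Let E_ge0_chain h p : good_fun h -> 0 <= E (chain w h (hops N p)).
Proof. by move=> gh; apply: E_ge0 => u; case: (good_chain w gh (gfs p)). Qed.

(** A violating path is always kept. A nonviolating one is lost only if it is short along the first
    or the last direction, and if all its hops are admissible it is near from both ends. A path with
    an inadmissible hop has weight zero. *)
Lemma path_lower (p : m.+2.-tuple V) :
  ((E (chain w one (hops N p)) - (near_path Delta p)%:R * E (chain w (short_path p) (hops N p))
   - (near_path Delta (rev p))%:R * E (fun u => short_path p u * chain w one (hops N p) u))%:E <=
  \int[gauss_chain d w m.+1]_us (\1_(kept Delta s p) (endpoints us) * pprod (hops N p) us)%:E)%E.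
Proof.
have sfs : size (hops N p) = m.+1 by rewrite size_hops size_tuple.
have gsp := good_short_path p.
have pp0 (us : m.+1.-tuple U) : 0 <= pprod (hops N p) us by exact: pprod_ge0.
have rhs0 : (0 <= \int[gauss_chain d w m.+1]_us (\1_(kept Delta s p) (endpoints us) * pprod (hops N p) us)%:E)%E.
  by apply: integral_ge0 => us _; rewrite lee_fin indicE mulr_ge0// ler0n.
have x1 : 0 <= (near_path Delta p)%:R * E (chain w (short_path p) (hops N p)).
  by rewrite mulr_ge0 ?E_ge0_chain.
have x2 : 0 <= (near_path Delta (rev p))%:R * E (fun u => short_path p u * chain w one (hops N p) u).
  rewrite mulr_ge0//; apply: E_ge0 => u; case: gsp => _ h0.
  by rewrite mulr_ge0//; case: (good_chain w good_one (gfs p)).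
have total := @gauss_chain_pprod R d w m one one (hops N p) sfs good_one good_one (gfs p).
have totalE : (\int[gauss_chain d w m.+1]_us (pprod (hops N p) us)%:E = (E (chain w one (hops N p)))%:E)%E.
  rewrite (_ : E (chain w one (hops N p)) = E (fun u => one u * chain w one (hops N p) u)); last first.
    by apply: E_eq => u; rewrite mul1r.
  by rewrite -total; apply: eq_integral => us _; rewrite !mul1r.
have [vp|nvp] := pselect (violating Delta p).
  apply: (@le_trans _ _ (E (chain w one (hops N p)))%:E); first by rewrite lee_fin; lra.
  rewrite -totalE le_eqVlt; apply/orP; left; apply/eqP; apply: eq_integral => us _.
  by rewrite indicE mem_set ?mul1r//; left.
have [sp|nsp] := boolP (sorted (@short_hop _ _ _ Delta) p); last first.
  apply: le_trans rhs0; rewrite lee_fin.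
  have N0 x y u : ~~ short_hop Delta x y -> N x y u = 0.
    move=> nxy; apply/eqP; apply: contraNT nxy => h.
    by have [] := hop_prob_neq0 D0 oneM strM subM h.
  rewrite (_ : E (chain w one (hops N p)) = 0); first by lra.
  rewrite -[RHS](E_cst g 0); apply: E_eq => u; exact: (chain_unsorted w N0).
rewrite near_path_nonviolating// near_path_rev// !mul1r.
have lastE := @gauss_chain_pprod R d w m one (short_path p) (hops N p) sfs good_one gsp (gfs p).
have firstE := @gauss_chain_pprod R d w m (short_path p) one (hops N p) sfs gsp good_one (gfs p).
have mpp := measurable_pprod sfs (gfs p).
have mnth i : (i <= m)%N -> measurable_fun setT (fun us : m.+1.-tuple U => nth 0 us i).
  move=> ni; have ni' : (i < m.+1)%N by [].
  under eq_fun do rewrite -(tnth_nth _ _ (Ordinal ni')).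
  exact: measurable_tnth.
have mhd : measurable_fun setT (fun us : m.+1.-tuple U => head 0 us).
  by under eq_fun do rewrite -nth0; exact: mnth.
have mls : measurable_fun setT (fun us : m.+1.-tuple U => last 0 us).
  by under eq_fun do rewrite -nth_last size_tuple; exact: mnth.
have [[msp _] sp0] := gsp.
have f1 : measurable_fun setT (fun us : m.+1.-tuple U => (\1_(kept Delta s p) (endpoints us) * pprod (hops N p) us)%:E).
  apply/measurable_EFinP; apply: measurable_funM => //.
  have mk : measurable_fun setT (\1_(kept Delta s p) : U * U -> R) by apply: measurable_indic; exact: measurable_kept.
  exact: (measurableT_comp mk (measurable_fun_pair mhd mls)).
have f2 : measurable_fun setT (fun us : m.+1.-tuple U => (short_path p (last 0 us) * pprod (hops N p) us)%:E).
  by apply/measurable_EFinP; apply: measurable_funM => //; exact: (measurableT_comp msp mls).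
have f3 : measurable_fun setT (fun us : m.+1.-tuple U => (short_path p (head 0 us) * pprod (hops N p) us)%:E).
  by apply/measurable_EFinP; apply: measurable_funM => //; exact: (measurableT_comp msp mhd).
have p1 (us : m.+1.-tuple U) : (0 <= (\1_(kept Delta s p) (endpoints us) * pprod (hops N p) us)%:E)%E.
  by rewrite lee_fin indicE mulr_ge0// ler0n.
have p2 (us : m.+1.-tuple U) : (0 <= (short_path p (last 0 us) * pprod (hops N p) us)%:E)%E.
  by rewrite lee_fin mulr_ge0.
have p3 (us : m.+1.-tuple U) : (0 <= (short_path p (head 0 us) * pprod (hops N p) us)%:E)%E.
  by rewrite lee_fin mulr_ge0.
have i2 : (\int[gauss_chain d w m.+1]_us (short_path p (last 0 us) * pprod (hops N p) us)%:E =
   (E (chain w (short_path p) (hops N p)))%:E)%E.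
  rewrite (_ : E (chain w (short_path p) (hops N p)) = E (fun u => one u * chain w (short_path p) (hops N p) u)); last first.
    by apply: E_eq => u; rewrite mul1r.
  by rewrite -lastE; apply: eq_integral => us _; rewrite mul1r.
have i3 : (\int[gauss_chain d w m.+1]_us (short_path p (head 0 us) * pprod (hops N p) us)%:E =
   (E (fun u => short_path p u * chain w one (hops N p) u))%:E)%E.
  by rewrite -firstE; apply: eq_integral => us _; rewrite mul1r.
rewrite !EFinB leeBlDr// leeBlDr// -i2 -i3 -totalE.
rewrite -(ge0_integralD (gauss_chain d w m.+1) measurableT (fun x _ => p1 x) f1 (fun x _ => p3 x) f3).
have f13 := emeasurable_funD f1 f3.
have p13 (us : m.+1.-tuple U) : (0 <= (\1_(kept Delta s p) (endpoints us) * pprod (hops N p) us)%:E + (short_path p (head 0 us) * pprod (hops N p) us)%:E)%E by exact: adde_ge0.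
rewrite -(ge0_integralD (gauss_chain d w m.+1) measurableT (fun x _ => p13 x) f13 (fun x _ => p2 x) f2).
apply: ge0_le_integral => //.
- by move=> us _; rewrite lee_fin.
- exact/measurable_EFinP.
- exact: emeasurable_funD.
move=> us _; rewrite -!EFinD lee_fin -!mulrDl ler_peMl//.
rewrite indicE; case: (boolP (endpoints us \in _)) => [_|nk].
  by rewrite -addrA lerDl addr_ge0.
rewrite add0r; move: nk; rewrite notin_setE /kept/= => nk.
have dE u : short_path p u = (dot (displacement p) u < s)%R%:R.
  case: (p) => -[//|x t] _ /=; rewrite /short /displacement /points/=.
  by rewrite (last_map (fun x : V => val x)).
rewrite !dE; case: ltP => h1; first by rewrite lerDl.
case: ltP => h2; first by rewrite lerDr.
by case: nk; right.
Qed.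

(** By reversibility of the chain and skew-symmetry, the weight of [p] with short displacement along
    [u_1] equals the weight of [rev p] with short displacement along the last direction:
    displacement and direction both change sign. *)
Lemma sum_rev_paths :
  \sum_(p : m.+2.-tuple V) (near_path Delta (rev p))%:R * E (fun u => short_path p u * chain w one (hops N p) u) =
  \sum_(p : m.+2.-tuple V) (near_path Delta p)%:R * E (chain w (short_path p) (hops N p)).
Proof.
rewrite [RHS](reindex_inj (h := fun p : m.+2.-tuple V => [tuple of rev p]))/=; last first.
  by move=> p q /(congr1 val) /= /(can_inj revK) pq; exact: val_inj.
apply: eq_bigr => p _; congr (_ * _).
case: p => -[//|x [//|y t]] /= _.
rewrite (@E_chain_first _ _ _ w01 (short pos s x (last y t)) (N x y) (hops N (y :: t))) ; last 3 first.
- exact: good_short.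
- by split; [exact: bm_hop_prob|exact: hop_prob_ge0].
- exact: gfs.
have -> : rev [seq (fun u => f (- u)) | f <- N x y :: hops N (y :: t)] = hops N (rev (x :: y :: t)).
  rewrite -[N x y :: _]/(hops N (x :: y :: t)) map_hops rev_hops; congr (hops _ _).
  by apply/funext => a; apply/funext => b; apply/funext => u; rewrite (hop_prob_skew skewM) opprK.
congr (\int[g]_u (chain w _ _ u))%R.
rewrite (lastI x) rev_rcons /short_path; apply/funext => u; rewrite /short.
have -> : last (last x (y :: t)) (rev (belast x (y :: t))) = x.
  by rewrite /= rev_cons last_rcons.
by apply/funext => v; rewrite -dotNN opprK opprB.
Qed.

End kept_paths.

(** * The size at one scale, with a free exponential parameter *)

Section size_bound.
Context {R : realType} (d : nat) (V : {fset 'rV[R]_d}).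
Local Notation U := 'rV[R]_d.
Local Notation g := (@gauss R d).
Local Notation E f := (\int[g]_u f u)%R.
Variables (Delta sigma s w : R) (Matching M : matching_cover V) (m : nat)
  (Q : R.-pker (U * U) ~> (m.+1.-tuple U)).
Hypotheses (D0 : 0 < Delta) (oneM : one_hop Delta Matching)
  (strM : stretched Delta sigma Matching) (skewM : skew_symmetric M)
  (subM : subcover M Matching) (w01 : 0 <= w <= 1) (V0 : (0 < #|` V|)%N)
  (PQ : is_cond_law (gauss_chain d w m.+1) (@endpoints R d m.+1) Q).
Local Notation N := (hop_prob M).
Local Notation n := (#|` V|%:R : R).

Let loss := \sum_(p : m.+2.-tuple V) (near_path Delta p)%:R * E (chain w (short_path s p) (hops N p)).
Let mass := \sum_x E (fun u => \sum_y N x y u).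

Let nV : n = #|{: V}|%:R. Proof. by rewrite cardfE. Qed.

Lemma ext_size_lower :
  ((n^-1 * (\sum_x E (count_eps N w 0 m x) - 2 * loss))%:E <=
   ext_size (w ^+ m) (cover_power Delta s M Q))%E.
Proof.
apply: le_trans (ext_size_ge _ _ _ w01 PQ).
rewrite EFinM lee_wpmul2l ?lee_fin ?invr_ge0//.
apply: (@le_trans _ _ (\sum_(p : m.+2.-tuple V)
  ((E (chain w (fun=> 1) (hops N p)) - (near_path Delta p)%:R * E (chain w (short_path s p) (hops N p))
   - (near_path Delta (rev p))%:R * E (fun u => short_path s p u * chain w (fun=> 1) (hops N p) u))%:E))%E); last first.
  by apply: lee_sum => p _; exact: (path_lower s w D0 oneM strM subM p).
rewrite sumEFin lee_fin !sumrB (sum_rev_paths Delta s m skewM w01) -/loss.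
have -> : \sum_x E (count_eps N w 0 m x) = \sum_(p : m.+2.-tuple V) E (chain w (fun=> 1) (hops N p)).
  rewrite sum_tupleS; apply: eq_bigr => x _.
  have g1 : good_fun ((fun=> 1) : U -> R) by split => //; exact: bm_cst.
  rewrite -E_sum; last first.
    by move=> t; have [] := good_chain w g1 (good_hops (bm_hop_prob M) (hop_prob_ge0 M) [tuple of x :: t]).
  by apply: E_eq => u; rewrite (count_eps0E w (bm_hop_prob M) (hop_prob_ge0 M)).
by lra.
Qed.

Lemma mass_ge delta : (delta%:E <= cover_size M)%E -> delta <= mass / n.
Proof.
move=> /le_trans/(_ (cover_size_le D0 oneM strM subM)).
by rewrite lee_fin mulrC.
Qed.

Lemma loss_le theta : 0 <= theta ->
  loss <= n * expR (theta * s - theta * sigma * \sum_(l < m.+1) w ^+ l +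
    theta ^+ 2 * (1 - w ^+ 2) * Delta / 2 * varsum w walk_radius 1 m).
Proof.
move=> th0; rewrite nV.
have Nst x y u : N x y u != 0 -> sigma <= dot (val y - val x) u.
  by move=> h; have [] := hop_prob_neq0 D0 oneM strM subM h.
have := chernoff Delta walk_radius (bm_hop_prob M) (hop_prob_ge0 M) (hop_prob_sum M) w01 Nst s m th0.
by apply: le_trans; rewrite /loss sum_tupleS.
Qed.

(** All walks by [chain_lower], minus the two equal losses, each bounded by [chernoff]. *)
Lemma size_bound K delta theta : (1 < K)%N -> w = 1 - K%:R^-1 -> 0 <= delta -> 0 <= theta ->
  (delta%:E <= cover_size M)%E ->
  ((delta ^+ (1 + m * (2 * K - 1)) - 2 * expR (theta * s - theta * sigma * \sum_(l < m.+1) w ^+ l +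
    theta ^+ 2 * (1 - w ^+ 2) * Delta / 2 * varsum w walk_radius 1 m))%:E <=
   ext_size (w ^+ m) (cover_power Delta s M Q))%E.
Proof.
move=> K1 wE de0 th0 /mass_ge dm; apply: le_trans ext_size_lower; rewrite lee_fin.
have n0 : 0 < n by rewrite ltr0n.
have V0' : (0 < #|{: V}|)%N by rewrite -cardfE.
have := chain_lower (bm_hop_prob M) (hop_prob_ge0 M) (hop_prob_sum M) (hop_prob_skew skewM) K1 wE m V0'.
rewrite -nV -/mass => low; have up := loss_le th0.
rewrite [leRHS]mulrBr; apply: lerB.
  apply: (@le_trans _ _ (n^-1 * (mass * (mass / n) ^+ (m * (2 * K - 1))))).
    rewrite mulrA [n^-1 * _]mulrC -exprS add1n lerXn2r// nnegrE//.
    exact: le_trans dm.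
  by rewrite ler_wpM2l// invr_ge0 ltW.
rewrite mulrCA ler_wpM2l//.
apply: (le_trans (ler_wpM2l _ up)); first by rewrite invr_ge0 ltW.
by rewrite mulKf// gt_eqF.
Qed.

End size_bound.

(** With one hop the threshold is [sigma] itself, which every sampled hop meets, so truncation loses
    nothing. *)
Lemma size_bound1 (R : realType) d (V : {fset 'rV[R]_d}) (Delta sigma w : R)
    (Matching M : matching_cover V) (Q : R.-pker ('rV[R]_d * 'rV[R]_d) ~> (1.-tuple 'rV[R]_d)) delta :
  0 < Delta -> one_hop Delta Matching -> stretched Delta sigma Matching -> skew_symmetric M ->
  subcover M Matching -> 0 <= w <= 1 -> is_cond_law (gauss_chain d w 1) (@endpoints R d 1) Q ->
  (delta%:E <= cover_size M)%E ->
  (delta%:E <= ext_size (w ^+ 0) (cover_power Delta sigma M Q))%E.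
Proof.
move=> D0 oneM strM skewM subM w01 PQ /(mass_ge D0 oneM strM subM) dm.
apply: le_trans (ext_size_lower sigma D0 oneM strM skewM subM w01 PQ); rewrite lee_fin.
rewrite [X in 2 * X]big1; last first.
  move=> p _; rewrite -[RHS](mulr0 (near_path Delta p)%:R); congr (_ * _).
  rewrite -[RHS](E_cst (gauss d) 0); apply: E_eq => u.
  case: p => -[//|x [//|y [|//]]] _ /=.
  have [->|h] := eqVneq (hop_prob M x y u) 0; first by rewrite mul0r.
  have [_ sh] := hop_prob_neq0 D0 oneM strM subM h.
  by rewrite /short ltNge sh mulr0.
by rewrite mulr0 subr0 mulrC.
Qed.

(** * Numerical comparison with [lambda] *)

Lemma scalesP r k : reflect (exists2 i, (i <= r)%N & k = (2 ^ i)%N) (k \in scales r).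
Proof.
apply: (iffP mapP) => -[i]; first by rewrite mem_iota add0n ltnS => ir ->; exists i.
by move=> ir ->; exists i; rewrite // mem_iota add0n ltnS.
Qed.

Lemma dscales_exp r l : (l < r)%N -> (2 ^ l)%N \in dscales r.
Proof.
move=> lr; rewrite mem_filter eqn_exp2l// ltn_eqF//=.
by apply/scalesP; exists l => //; exact: ltnW.
Qed.

Lemma varsum_gt0 (R : realType) (w : R) (n_ : nat -> R) i j : 0 < w -> (forall i, 0 < n_ i) ->
  0 < varsum w n_ i j.+1.
Proof.
move=> w0 n0; elim: j i => [|j IH] i.
  by rewrite /= add0r mulr_gt0// exprn_gt0.
by rewrite [varsum _ _ _ _]/= addr_gt0// ?IH// mulr_gt0// exprn_gt0.
Qed.

Section numerics.
Context {R : realType} (r : nat) (Delta : R) (beta delta lambda theta : nat -> R).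
Let K : R := (2 ^ r)%:R.
Let w : R := 1 - K^-1.
Hypotheses (D0 : 0 < Delta)
  (delta01 : forall k, k \in scales r -> 0 < delta k < 1)
  (delta_incr : forall k l, k \in scales r -> l \in scales r -> (k < l)%N -> delta k < delta l)
  (lambda1 : lambda 1%N = delta 1%N)
  (lambdaS : forall k, k \in dscales r -> lambda (2 * k)%N = theta (2 * k)%N * lambda k ^+ 2)
  (thetaS : forall k, k \in dscales r ->
      theta (2 * k)%N = 2^-1 * (2^-1 * (delta (2 * k)%N - delta k)) `^ (2 / (1 - w))).

Let K0 : 0 < K. Proof. by rewrite /K ltr0n expn_gt0. Qed.

(** For [t_k = ln 2 - ln lambda_k] the recursion reads [t_(2k) = 2 t_k - 2K ln x], where [x] is half
    an increment of [delta] and so at most [delta (2^i) / 2]; the bound unrolls it. *)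
Lemma ln_lambda i l : (l <= i)%N -> (i <= r)%N ->
  0 < lambda (2 ^ l)%N /\
  ln 2 + ((2 ^ l)%:R - 1) * (2 * K) * (ln 2 - ln (delta (2 ^ i)%N)) +
    (2 ^ l)%:R * (ln 2 - ln (delta (2 ^ i)%N)) - ln 2 <= ln 2 - ln (lambda (2 ^ l)%N).
Proof.
move=> + ir; have si : (2 ^ i)%N \in scales r by apply/scalesP; exists i.
have /andP[di0 _] := delta01 si.
have dle j : (j <= i)%N -> delta (2 ^ j)%N <= delta (2 ^ i)%N.
  rewrite leq_eqVlt => /orP[/eqP ->//|ji]; apply/ltW/delta_incr => //; last by rewrite ltn_exp2l.
  by apply/scalesP; exists j => //; exact: leq_trans (ltnW ji) ir.
elim: l => [|l IH] li.
  rewrite expn0 lambda1; have s1 : 1%N \in scales r by apply/scalesP; exists 0%N.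
  have /andP[d10 _] := delta01 s1; split => //.
  have : ln (delta 1%N) <= ln (delta (2 ^ i)%N) by rewrite ler_ln ?posrE//; exact: (dle 0%N).
  by lra.
have [l0 lb] := IH (ltnW li).
have lr : (l < r)%N by exact: leq_trans li ir.
have dl := dscales_exp lr.
rewrite expnS lambdaS// thetaS//.
have s1 : (2 ^ l)%N \in scales r by apply/scalesP; exists l => //; exact: ltnW.
have s2 : (2 * 2 ^ l)%N \in scales r by rewrite -expnS; apply/scalesP; exists l.+1.
have dd : delta (2 ^ l)%N < delta (2 * 2 ^ l)%N by apply: delta_incr => //; rewrite -expnS ltn_exp2l.
have /andP[dl0 _] := delta01 s1.
have d2 : delta (2 * 2 ^ l)%N <= delta (2 ^ i)%N by rewrite -expnS; exact: dle.
set x := 2^-1 * (delta (2 * 2 ^ l)%N - delta (2 ^ l)%N); have x0 : 0 < x by rewrite mulr_gt0 ?invr_gt0// subr_gt0.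
have p0 : 0 < x `^ (2 / (1 - w)) by exact: powR_gt0.
split; first by rewrite mulr_gt0 ?exprn_gt0// mulr_gt0 ?invr_gt0.
have w1 : 2 / (1 - w) = 2 * K by rewrite /w opprB addrC subrK invrK.
have h2 : 0 < 2^-1 :> R by rewrite invr_gt0.
have hp : 0 < 2^-1 * x `^ (2 / (1 - w)) by rewrite mulr_gt0.
rewrite lnM ?posrE ?exprn_gt0// lnM ?posrE// lnV ?posrE// ln_powR w1 lnXn// -[ln (lambda _) *+ 2]mulr_natl natrM.
have lx : ln x <= ln (delta (2 ^ i)%N) - ln 2.
  rewrite -ln_div ?posrE// ler_ln ?posrE ?divr_gt0//.
  rewrite /x; lra.
have := ler_wpM2l (_ : 0 <= 2 * K) lx; rewrite mulr_ge0 ?(ltW K0)// => /(_ isT).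
move: lb; move: (ln x) (ln 2) (ln (lambda _)) (ln (delta _)) => a b c e0.
by lra.
Qed.

(** Both the loss and [lambda m] are compared with the main term [delta m ^ Ex]: the two losses
    together take at most half of it, and [lambda m] is at most the other half. *)
Lemma final_numerics i (B : nat -> R) (m := (2 ^ i)%N) : (0 < i)%N -> (i <= r)%N ->
  (forall l, (l < r)%N -> 0 < beta (2 ^ l)%N) ->
  (forall l, (l < r)%N ->
     expR (- (beta (2 ^ l)%N ^+ 2 / (2 * ((2 ^ l).+1)%:R * (1 - w ^+ (2 ^ l)) * Delta)))
      <= 2^-1 * lambda (2 * 2 ^ l)%N) ->
  B 1%N = 0 ->
  (forall l, (l < r)%N -> B (2 * 2 ^ l)%N = (1 + w ^+ (2 ^ l)) * B (2 ^ l)%N + beta (2 ^ l)%N) ->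
  let S := (1 - w ^+ 2) * Delta * varsum w walk_radius 1 m.-1 in
  [/\ 0 < B m, 0 < S & lambda m <= delta m ^+ (1 + m.-1 * (2 * 2 ^ r - 1)) - 2 * expR (- (B m ^+ 2 / (2 * S)))].
Proof.
move=> i0 ir b0 bexp B1 BS S.
have r0 : (0 < r)%N by exact: leq_trans ir.
have K2 : 2 <= K by rewrite /K ler_nat -[X in (X <= _)%N]expn1 leq_exp2l.
have w0 : 0 < w by rewrite /w subr_gt0 invf_lt1// (lt_le_trans _ K2)// ltr1n.
have w1 : w < 1 by rewrite /w ltrBlDr ltrDl invr_gt0.
have si : (2 ^ i)%N \in scales r by apply/scalesP; exists i.
have /andP[di0 di1] := delta01 si.
pose h := - ln (delta m); have h0 : 0 < h by rewrite /h oppr_gt0 ln_lt0// di0.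
have ln20 : 0 < ln 2 :> R by rewrite ln_gt0// ltr1n.
pose C := 2 * Delta * (h + ln 2).
have C0 : 0 < C by rewrite !mulr_gt0// addr_gt0.
(* Logarithm of the hypothesis on [beta], with [ln_lambda] inserted at [2^(l+1)]. Only scales up to
   [2^i] occur, so [delta m] bounds every [delta] involved. *)
have bsq l : (l < i)%N -> C * ((2 ^ l).+1%:R * (1 - w ^+ (2 ^ l)) * ((2 * (2 ^ l)%:R - 1) * (2 * K) + 2 * (2 ^ l)%:R))
     <= beta (2 ^ l)%N ^+ 2.
  move=> li; have lr : (l < r)%N by exact: leq_trans li ir.
  have [lp ll] := ln_lambda li ir; rewrite expnS in lp ll.
  have a0 : 0 < 1 - w ^+ (2 ^ l) by rewrite subr_gt0 exprn_ilt1// ?expn_gt0 ?ltW// -lt0n expn_gt0.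
  have den : 0 < 2 * ((2 ^ l).+1)%:R * (1 - w ^+ (2 ^ l)) * Delta.
    by rewrite !mulr_gt0// ltr0n.
  have := bexp l lr; rewrite -[X in _ <= X]lnK ?posrE ?mulr_gt0 ?invr_gt0// ler_expR.
  rewrite lnM ?posrE ?invr_gt0// lnV ?posrE// => hb.
  have : ln 2 - ln (lambda (2 * 2 ^ l)%N) <= beta (2 ^ l)%N ^+ 2 / (2 * ((2 ^ l).+1)%:R * (1 - w ^+ (2 ^ l)) * Delta).
    by move: hb; move: (_ / _) => t; lra.
  rewrite ler_pdivlMr// => hb2; apply: le_trans hb2.
  have -> : C * ((2 ^ l).+1%:R * (1 - w ^+ (2 ^ l)) * ((2 * (2 ^ l)%:R - 1) * (2 * K) + 2 * (2 ^ l)%:R)) =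
    (h + ln 2) * ((2 * (2 ^ l)%:R - 1) * (2 * K) + 2 * (2 ^ l)%:R) * (2 * ((2 ^ l).+1)%:R * (1 - w ^+ (2 ^ l)) * Delta).
    by rewrite /C; ring.
  rewrite ler_wpM2r// ?(ltW den)//; apply: le_trans ll.
  by rewrite /h natrM le_eqVlt; apply/orP; left; apply/eqP; ring.
have [Bm0 Bm] := @budget R r C B beta C0 r0 B1 i i0 (fun l li =>
  conj (b0 l (leq_trans li ir)) (conj (BS l (leq_trans li ir)) (bsq l li))).
have m2 : (2 <= m)%N by rewrite /m -[X in (X <= _)%N]expn1 leq_exp2l.
have mR : 2 <= m%:R :> R by rewrite ler_nat.
have V0 : 0 < varsum w walk_radius 1 m.-1.
  case: (m) m2 => [//|[//|m'] _]; apply: varsum_gt0 => // j.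
  by rewrite /walk_radius; case: ifP => // _; rewrite ltr0n.
have w2 : 0 < 1 - w ^+ 2 by rewrite subr_gt0 exprn_ilt1// ltW.
have S0 : 0 < S by rewrite !mulr_gt0.
pose Ex : R := 1 + (m%:R - 1) * (2 * K - 1).
have ExE : (1 + m.-1 * (2 * 2 ^ r - 1))%:R = Ex.
  rewrite natrD natrM natrB ?natrM; last by rewrite muln_gt0 expn_gt0.
  have mE : m%:R = m.-1%:R + 1 :> R by rewrite natr1 prednK// ltnW.
  by rewrite /Ex mE addrK.
have Ex2 : 2 <= Ex.
  have : 1 <= (m%:R - 1) * (2 * K - 1) by rewrite -[leLHS]mulr1 ler_pM//; lra.
  by rewrite /Ex; lra.
have dE : delta m ^+ (1 + m.-1 * (2 * 2 ^ r - 1)) = expR (- (h * Ex)).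
  by rewrite -[delta m]lnK ?posrE// -expRM_natl ExE /h; congr expR; ring.
(* The bound from [budget] exceeds [h * Ex] by [ln 2 * Ex], and [Ex >= 2] makes this a factor of at
   most 1/4. *)
have lossE : expR (- (B m ^+ 2 / (2 * S))) <= expR (- (h * Ex)) / 4.
  have : (h + ln 2) * Ex <= B m ^+ 2 / (2 * S).
    rewrite ler_pdivlMr ?mulr_gt0//.
    rewrite [leLHS](_ : _ = C * ((1 - w ^+ 2) * varsum w walk_radius 1 m.-1 * Ex)); first exact: Bm.
    by rewrite /C /S; clearbody Ex; ring.
  move=> hB; have l4 : ln 4 = 2 * ln 2 :> R.
    by rewrite (_ : 4 = 2 * 2) ?lnM ?posrE//; [rewrite mulr_natl mulr2n|rewrite -natrM].
  have -> : expR (- (h * Ex)) / 4 = expR (- (h * Ex) - ln 4) by rewrite expRD expRN lnK ?posrE.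
  rewrite ler_expR l4.
  have : 2 * ln 2 <= ln 2 * Ex by rewrite [leRHS]mulrC ler_wpM2r// ltW.
  by rewrite mulrDl in hB; lra.
have lamE : lambda m <= expR (- (h * Ex)) / 2.
  have [lp ll] := ln_lambda (leqnn i) ir.
  rewrite -/m -/h in lp ll.
  have -> : expR (- (h * Ex)) / 2 = expR (- (h * Ex) - ln 2) by rewrite expRD expRN lnK ?posrE.
  rewrite -[lambda m]lnK ?posrE// ler_expR.
  have e1 : (h + ln 2) * ((m%:R - 1) * (2 * K) + m%:R) <= ln 2 - ln (lambda m).
    apply: le_trans ll; rewrite /h le_eqVlt; apply/orP; left; apply/eqP; ring.
  have e2 : h * Ex <= h * ((m%:R - 1) * (2 * K) + m%:R).
    by rewrite ler_wpM2l ?(ltW h0)// /Ex; lra.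
  have e3 : ln 2 * 2 <= ln 2 * ((m%:R - 1) * (2 * K) + m%:R).
    rewrite ler_wpM2l ?(ltW ln20)//.
    have : 0 <= (m%:R - 1) * (2 * K) by rewrite !mulr_ge0//; lra.
    by lra.
  by rewrite mulrDl in e1; lra.
split => //; rewrite dE; lra.
Qed.

End numerics.

Theorem theorem7 (R : realType) (d : nat) (V : {fset 'rV[R]_d}) (Delta : R)
    (r : nat) (sigma : R) (Matching : matching_cover V)
    (beta sigma_ delta lambda theta : nat -> R) :
  (0 < d)%N -> (0 < #|` V|)%N -> 0 < Delta -> 0 < sigma ->
  let K := (2 ^ r)%N in
  let omega : R := 1 - K%:R^-1 in
  one_hop Delta Matching ->
  stretched Delta sigma Matching ->
  skew_symmetric Matching ->
  (forall k, k \in dscales r -> 0 < beta k) ->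
  sigma_ 1%N = sigma ->
  (forall k, k \in dscales r ->
    sigma_ (2 * k)%N = (1 + omega ^+ k) * sigma_ k - beta k) ->
  (forall k, k \in scales r -> 0 < delta k < 1) ->
  (forall k l, k \in scales r -> l \in scales r -> (k < l)%N ->
    delta k < delta l) ->
  lambda 1%N = delta 1%N ->
  (forall k, k \in dscales r ->
    lambda (2 * k)%N = theta (2 * k)%N * lambda k ^+ 2) ->
  (forall k, k \in dscales r ->
    theta (2 * k)%N =
      2^-1 * (2^-1 * (delta (2 * k)%N - delta k)) `^ (2 / (1 - omega))) ->
  (forall k, k \in dscales r ->
    expR (- (beta k ^+ 2 / (2 * (k.+1)%:R * (1 - omega ^+ k) * Delta)))
      <= 2^-1 * lambda (2 * k)%N) ->
  forall k, k \in scales r ->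
  forall M : matching_cover V, skew_symmetric M -> subcover M Matching ->
  ((delta k)%:E <= cover_size M)%E ->
  forall Q : R.-pker ('rV[R]_d * 'rV[R]_d) ~> (k.-tuple 'rV[R]_d),
  is_cond_law (gauss_chain d omega k) (@endpoints R d k) Q ->
  ((lambda k)%:E <=
    ext_size (omega ^+ k.-1) (cover_power Delta (sigma_ k) M Q))%E.
Proof.
move=> _ V0 D0 _ K omega oneM strM skewM0 b0 sig1 sigS d01 dincr lam1 lamS thS bexp k ks M skewM subM dM Q PQ.
have [i ir kE] := scalesP _ _ ks.
have K1 : 1 <= K%:R :> R by rewrite ler1n expn_gt0.
have w01 : 0 <= omega <= 1.
  by rewrite /omega subr_ge0 invf_le1 ?(lt_le_trans ltr01 K1)// K1 gerBl invr_ge0 (le_trans ler01 K1).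
have [i0|i0] := posnP i.
  move: kE; rewrite i0 expn0 => k1; rewrite k1 in ks dM Q PQ *.
  rewrite lam1 sig1.
  exact: (size_bound1 D0 oneM strM skewM subM w01 PQ).
(* The slack between the stretch guaranteed to [j] hops, after damping, and the truncation
   threshold. Splitting the geometric sum into halves gives its recursion. *)
pose B j := sigma * \sum_(l < j) omega ^+ l - sigma_ j.
have B1 : B 1%N = 0 by rewrite /B big_ord1 expr0 mulr1 sig1 subrr.
have BS l : (l < r)%N -> B (2 * 2 ^ l)%N = (1 + omega ^+ (2 ^ l)) * B (2 ^ l)%N + beta (2 ^ l)%N.
  move=> lr; rewrite /B sigS ?dscales_exp// mul2n -addnn big_split_ord/=.
  have -> : \sum_(j < 2 ^ l) omega ^+ (2 ^ l + j) = omega ^+ (2 ^ l) * \sum_(j < 2 ^ l) omega ^+ j.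
    by rewrite mulr_sumr; apply: eq_bigr => j _; rewrite exprD.
  by move: (\sum_(j < _) _) => t; ring.
have [Bk S0 fin] := final_numerics D0 d01 dincr lam1 lamS thS i0 ir
  (fun l lr => b0 _ (dscales_exp lr)) (fun l lr => bexp _ (dscales_exp lr)) B1 BS.
rewrite -kE in Bk S0 fin.
have k0 : (0 < k)%N by rewrite kE expn_gt0.
have K2 : (1 < K)%N by rewrite /K -[X in (X < _)%N](expn0 2) ltn_exp2l// (leq_trans i0).
case: k k0 ks kE dM Q PQ Bk S0 fin => [//|m] _ ks kE dM Q PQ Bk S0.
set S := (1 - _) * _ * _ in S0 * => fin.
(* The parameter [theta = B / S] minimizes [- theta B + theta^2 S / 2], with value
   [- B^2 / (2 S)]. *)
have th0 : 0 <= B m.+1 / S by rewrite divr_ge0// ltW.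
have /andP[de0 _] := d01 _ ks.
apply: le_trans (size_bound (sigma_ m.+1) D0 oneM strM skewM subM w01 V0 PQ K2 erefl (ltW de0) th0 dM).
rewrite lee_fin; apply: (le_trans fin).
rewrite lerD2l lerN2 ler_wpM2l// ler_expR le_eqVlt; apply/orP; left; apply/eqP.
have -> : sigma_ m.+1 = sigma * \sum_(l < m.+1) omega ^+ l - B m.+1 by rewrite /B opprB addrC subrK.
have -> : (B m.+1 / S) ^+ 2 * (1 - omega ^+ 2) * Delta / 2 * varsum omega walk_radius 1 m =
  (B m.+1 / S) ^+ 2 * S / 2.
  have SE : S = (1 - omega ^+ 2) * Delta * varsum omega walk_radius 1 m by [].
  move: (B m.+1 / S) => c; rewrite SE; ring.
by field; rewrite gt_eqF.
Qed.
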